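(* Let $n\ge2$ be an integer, $g\in\mathrm{U}_n$, $\rho\in\mathrm{Irr}(\mathrm{U}_n)$, and $0<\gamma<\frac12$. Denote $\epsilon=\rho(1)^{-\gamma(1-\gamma)/n^2}$ and assume that $\rho(1)>2^{\frac{16}{\gamma}n^2\log n}$ and that $g$ is $(\gamma,\epsilon)$-separated. Then $$|\rho(g)|\le\rho(1)^{1-\frac12\gamma(1-\gamma)}.$$
   Context: $\mathrm{Irr}(\mathrm{U}_n)$ is the set of irreducible (continuous, finite-dimensional complex) characters of $\mathrm{U}_n$. An element $g\in\mathrm{U}_n$ is $(\gamma,\epsilon)$-separated if its eigenvalues (counted with multiplicity) can be separated into two disjoint sets $Q,R$ such that $|Q|,|R|\ge\gamma n$ and every element of $Q$ is at (Euclidean) distance at least $\epsilon$ in $\mathbb{C}$ from every element of $R$. Here $\log$ is the base-$2$ logarithm. *)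

(* Defs.v *)
From HB Require Import structures.
From mathcomp Require Import all_boot all_order all_algebra.
From mathcomp Require Import spectral.
From mathcomp Require Import all_classical all_reals all_analysis.
From mathcomp Require Export complex.

Set Implicit Arguments.
Unset Strict Implicit.
Unset Printing Implicit Defensive.

Import Order.TTheory GRing.Theory Num.Theory.
Import numFieldNormedType.Exports.

Local Open Scope classical_set_scope.
Local Open Scope ring_scope.
Local Open Scope complex_scope.

Definition log2 (R : realType) (x : R) : R := ln x / ln 2.

Section UnitaryGroup.
Variables (R : realType) (n : nat).

(* The [^o] on complex numbers selects the norm topology; the matrix spaces
   then carry their usual topology. *)
Local Notation C := (R[i]^o).

Definition Un : set 'M[C]_n := [set g | g \is unitarymx].

(* Maps on U_n are total functions on 'M_n whose values outside U_n are
   irrelevant: every condition below is restricted to Un. *)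
Definition continuous_rep (d : nat) (rho : 'M[C]_n -> 'M[C]_d) : Prop :=
  [/\ rho 1%:M = 1%:M,
      forall g h, Un g -> Un h -> rho (g *m h) = rho g *m rho h
    & {within Un, continuous rho}].

Definition invariant_subspace (d : nat) (rho : 'M[C]_n -> 'M[C]_d)
    (W : {vspace 'cV[R[i]]_d}) : Prop :=
  forall g, Un g -> forall v : 'cV[R[i]]_d, v \in W -> rho g *m v \in W.

Definition irreducible_rep (d : nat) (rho : 'M[C]_n -> 'M[C]_d) : Prop :=
  (0 < d)%N /\
  forall W : {vspace 'cV[R[i]]_d},
    invariant_subspace rho W -> W = 0%VS \/ W = fullv.

Definition Irr_U : set ('M[R[i]]_n -> R[i]) :=
  [set chi | exists (d : nat) (rho : 'M[C]_n -> 'M[C]_d),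
    [/\ continuous_rep rho, irreducible_rep rho
      & forall g, Un g -> chi g = \tr (rho g)]].

(* [Q] and [S] list the two parts of the multiset of eigenvalues; [Q ++ S]
   is the full list of roots of the characteristic polynomial. *)
Definition eig_separated (gamma epsilon : R) (g : 'M[R[i]]_n) : Prop :=
  exists Q S : seq R[i],
    [/\ char_poly g = \prod_(z <- Q ++ S) ('X - z%:P),
        gamma * n%:R <= (size Q)%:R,
        gamma * n%:R <= (size S)%:R
      & forall a b, a \in Q -> b \in S -> epsilon%:C <= `|a - b|].

End UnitaryGroup.

Arguments Un R n : clear implicits.
Arguments Irr_U R n : clear implicits.

(* Main.v *)
Require Import Defs.
From mathcomp Require Import all_boot all_order all_fingroup all_algebra.
From mathcomp Require Import spectral.
From mathcomp Require Import all_classical all_reals all_analysis.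
From mathcomp Require Import zify ring lra.

(** Let [chi] be the character of [rho], [D] its dimension, and [z] the list of
    eigenvalues of [g], the first [k] of which belong to [Q] and the last [k'] to
    [S], so that [n = k + k'].

    The Weyl character formula ([weyl_formula_torus]) provides integers
    [l_0 < ... < l_(n-1)] with [vdm z * chi z = \det (z_j ^ l_i)], where [vdm z] is
    the product of the [z_j - z_i] for [i < j].  Expanding the determinant along
    the two blocks of columns gives a sum over permutations of products of two
    smaller determinants of the same shape.  For unit complex numbers such a
    determinant is at most the product of the differences of the [z_j] times the
    product of the differences of its exponents ([norm_det_powers]).  After
    division by the differences inside each block there remains ([chi_bound])
    [|chi z| * \prod |z_j - z_i| <= \sum_s P_s], where the product is over pairs
    across the blocks and [P_s] is the product of the differences of the exponents
    that [s] places in a common block.  By separation the product on the left is at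
    least [epsilon ^ (k k')], which loses the factor [D ^ (gamma (1 - gamma) k k' / n^2)].

    On the right, let [P] be the product of all differences of exponents.  By the
    Weyl dimension formula ([dimension_formula]) [P] is [D] times the product of the
    [j - i], which is [n ^ O(n^2)].  The factors across the blocks cannot be small:
    as all differences are nonzero integers,
    [|a - b| <= 2 |a - c| |b - c|] for [a], [b] in one block and [c] in the other,
    and multiplying these inequalities ([gap_pow_le_cross]) shows that the factors
    across contribute at least [P ^ (k k' / n^2)] up to a power of 2.  Hence
    [P_s <= n ^ O(n^2) * D ^ (1 - k k' / n^2)].  The quantity [k k' / n^2] lies
    between [gamma (1 - gamma)] and [1/4], so the gain exceeds the loss by at least
    [D ^ (3/4 gamma (1 - gamma))].  Of this, [D ^ (1/2 gamma (1 - gamma))] is claimed,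
    and the lower bound on [D] makes the rest absorb the [n ^ O(n^2)]
    ([separated_bound]).

    The Weyl formula is proved through the Lie algebra.  On the diagonal torus [rho]
    is diagonal in a suitable basis, with monomials as entries ([torus_weights]):
    this holds for matrices of dyadic torsion, and then by density.  With the
    spectral theorem it follows that [rho] is Lipschitz ([rho_lipschitz]), so that
    the derivative of [rho] along a curve of unitary matrices depends on the velocity
    only.  This yields a differential [drho] that is linear and equivariant, hence
    respects brackets ([drho_bracket]), and leaves only trivial subspaces invariant
    ([drho_invariant]).  The Casimir element is then scalar by Schur's lemma, and
    computing its trace against a torus element shows that [vdm * chi] is an
    eigenfunction of a Laplacian ([laplace_eigen]).  This function is alternating,
    its exponents are dominated by the highest one, which occurs once, and the
    eigenvalue condition excludes all exponents but the permutations of that one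
    ([weyl_formula]). *)

Set Implicit Arguments.
Unset Strict Implicit.
Unset Printing Implicit Defensive.

Import Order.TTheory GRing.Theory Num.Theory.
Import numFieldNormedType.Exports.
Local Open Scope ring_scope.

(** * Determinants of powers of unit complex numbers *)

Definition gap k (l : 'I_k -> nat) : nat :=
  (\prod_(i < k) \prod_(j < k | (i < j)%N) `|l j - l i|)%N.

Definition gapn (C : numDomainType) k (x : 'I_k -> C) : C :=
  \prod_(i < k) \prod_(j < k | (i < j)%N) `|x j - x i|.

Lemma prod_pairs_recl (T : Type) (idx : T) (op : Monoid.com_law idx) k
    (f : 'I_k.+1 -> 'I_k.+1 -> T) :
  \big[op/idx]_(i < k.+1) \big[op/idx]_(j < k.+1 | (i < j)%N) f i j =
  op (\big[op/idx]_(j < k) f ord0 (lift ord0 j))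
     (\big[op/idx]_(i < k) \big[op/idx]_(j < k | (i < j)%N)
       f (lift ord0 i) (lift ord0 j)).
Proof.
rewrite big_ord_recl; congr (op _ _).
  by rewrite big_mkcond big_ord_recl /= Monoid.mul1m; apply: eq_bigr.
by apply: eq_bigr => i _; rewrite big_mkcond big_ord_recl /= Monoid.mul1m -big_mkcond.
Qed.

Lemma prod_pairs_recr (T : Type) (idx : T) (op : Monoid.com_law idx) k
    (f : 'I_k.+1 -> 'I_k.+1 -> T) :
  \big[op/idx]_(i < k.+1) \big[op/idx]_(j < k.+1 | (i < j)%N) f i j =
  op (\big[op/idx]_(i < k) f (widen_ord (leqnSn k) i) (lift ord0 i))
     (\big[op/idx]_(i < k) \big[op/idx]_(j < k | (i < j)%N)
       f (widen_ord (leqnSn k) i) (lift ord0 j)).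
Proof.
rewrite big_ord_recr /= [X in op _ X]big_pred0 ?Monoid.mulm1; last first.
  by move=> j; apply/negbTE; rewrite -leqNgt -ltnS.
rewrite -big_split /=; apply: eq_bigr => i _.
rewrite big_mkcond big_ord_recl /= Monoid.mul1m -big_mkcond /= (bigD1 i) ?ltnSn//=.
by congr (op _ _); apply: eq_bigl => j; rewrite -(inj_eq val_inj) /bump /= add1n ltnS; lia.
Qed.

Lemma det_row_sums (R : comRingType) k T (P : 'I_k -> pred 'I_T)
    (f : 'I_k -> 'I_T -> 'I_k -> R) :
  \det (\matrix_(i, j) \sum_(t | P i t) f i t j) =
  \sum_(h in family P) \det (\matrix_(i, j) f i (h i) j).
Proof.
rewrite /determinant exchange_big /=; apply: eq_bigr => s _.
rewrite -mulr_sumr; congr (_ * _).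
under eq_bigr => i _ do rewrite mxE.
rewrite bigA_distr_big_dep /=; apply: eq_bigr => h _.
by apply: eq_bigr => i _; rewrite mxE.
Qed.

(** When the first column is constant, subtracting from each row the previous
    one leaves a single nonzero entry in that column. *)
Lemma det_subr_rows (R : comRingType) k (A : 'M[R]_k.+1) :
  (forall i, A i ord0 = 1) ->
  \det A = \det (\matrix_(i < k, j < k)
     (A (lift ord0 i) (lift ord0 j) - A (widen_ord (leqnSn k) i) (lift ord0 j))).
Proof.
move=> A1.
pose L : 'M[R]_k.+1 := \matrix_(i, j) ((i == j)%:R - (i == j.+1 :> nat)%:R).
have detL : \det L = 1.
  rewrite det_trig; last first.
    apply/is_trig_mxP => i j ij; rewrite mxE.
    by rewrite -(inj_eq val_inj) (ltn_eqF ij) ltn_eqF ?subr0// ltnS ltnW.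
  by rewrite big1 // => i _; rewrite mxE eqxx ltn_eqF // subr0.
have LA i j : (L *m A) (lift ord0 i) j =
    A (lift ord0 i) j - A (widen_ord (leqnSn k) i) j.
  rewrite mxE; under eq_bigr => a _ do rewrite mxE mulrBl.
  rewrite sumrB; congr (_ - _).
    rewrite (bigD1 (lift ord0 i)) //= eqxx mul1r big1 ?addr0 // => a.
    by rewrite eq_sym => /negPf ->; rewrite mul0r.
  rewrite (bigD1 (widen_ord (leqnSn k) i)) //= eqxx mul1r big1 ?addr0 // => a.
  rewrite -(inj_eq val_inj) /= /bump /= add1n eqSS eq_sym => /negPf ->.
  by rewrite mul0r.
have LA0 : (L *m A) ord0 ord0 = 1.
  rewrite mxE (bigD1 ord0) //= mxE eqxx A1 subr0 mulr1 big1 ?addr0 // => a.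
  by rewrite mxE eq_sym => /negPf ->; rewrite subr0 mul0r.
rewrite -[LHS]mul1r -detL -det_mulmx (expand_det_col _ ord0) big_ord_recl LA0 mul1r.
rewrite big1 ?addr0; last first.
  by move=> i _; rewrite LA !A1 subrr mul0r.
rewrite /cofactor addn0 expr0 mul1r; congr (\det _).
by apply/matrixP => i j; rewrite !mxE -LA mxE.
Qed.

Section GenVandermonde.
Variable C : numFieldType.

Lemma gap_recr k (l : 'I_k.+1 -> nat) : gap l =
  (\prod_(i < k) `|l (lift ord0 i) - l (widen_ord (leqnSn k) i)| *
   \prod_(i < k) \prod_(j < k | (i < j)%N)
      `|l (lift ord0 j) - l (widen_ord (leqnSn k) i)|)%N.
Proof. exact: (@prod_pairs_recr nat 1%N muln). Qed.

Lemma subrXX_sum (y : C) a b : (a <= b)%N ->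
  y ^+ b - y ^+ a = (y - 1) * \sum_(t < b | (t < b - a)%N) y ^+ (a + t).
Proof.
move=> ab; rewrite -{1}(subnKC ab) exprD -{2}[y ^+ a]mulr1 -mulrBr.
rewrite subrX1 mulrCA; congr (_ * _); rewrite mulr_sumr.
rewrite (big_ord_widen _ (fun i => y ^+ a * y ^+ i) (leq_subr a b)).
by apply: eq_bigr => i _; rewrite exprD.
Qed.

Lemma det_scale_cols k (c : 'I_k -> C) (A : 'M[C]_k) :
  \det (\matrix_(i, j) (c j * A i j)) = (\prod_j c j) * \det A.
Proof.
have -> : \matrix_(i, j) (c j * A i j) = A *m diag_mx (\row_j c j).
  by rewrite mul_mx_diag; apply/matrixP => i j; rewrite !mxE mulrC.
by rewrite det_mulmx det_diag mulrC; congr (_ * _); apply: eq_bigr => j _; rewrite mxE.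
Qed.

Lemma det_scale_rows k (c : 'I_k -> C) (A : 'M[C]_k) :
  \det (\matrix_(i, j) (c i * A i j)) = (\prod_j c j) * \det A.
Proof.
rewrite -det_tr -[in RHS]det_tr -det_scale_cols; congr (\det _).
by apply/matrixP => i j; rewrite !mxE.
Qed.

(** The determinant is a Vandermonde product times a Schur polynomial, and a
    Schur polynomial has at most [gap l] monomials, counted with multiplicity.
    The induction follows the branching rule behind this count.  Dividing row
    [i] by [x_0 ^ l_i] makes the first column constant; subtracting adjacent
    rows and using [y^b - y^a = (y - 1) (y^a + ... + y^(b-1))] leaves a sum of
    determinants of the same kind whose exponents interlace those of [l]. *)
Lemma norm_det_powers_sorted k (x : 'I_k -> C) (l : 'I_k -> nat) :
  (forall i, `|x i| = 1) -> {homo l : i j / (i <= j)%N} ->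
  `|\det (\matrix_(i, j) x j ^+ l i)| <= gapn x * (gap l)%:R.
Proof.
elim: k => [|k IHk] in x l *.
  by move=> _ _; rewrite det_mx00 normr1 /gapn /gap !big_ord0 mulr1.
move=> x1 lS.
have x0N0 i : x i != 0 by rewrite -normr_gt0 x1.
pose y (j : 'I_k) := x (lift ord0 j) / x ord0.
have y1 j : `|y j| = 1 by rewrite normrM normfV !x1 invr1 mulr1.
pose lo (i : 'I_k) := l (widen_ord (leqnSn k) i).
pose hi (i : 'I_k) := l (lift ord0 i).
have lohi i : (lo i <= hi i)%N by apply: lS; rewrite /= /bump; lia.
pose T := (\max_i hi i)%N.
pose P (i : 'I_k) : pred 'I_T := fun t => (t < hi i - lo i)%N.
have hiT i : (hi i <= T)%N by exact: leq_bigmax.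
have -> : \det (\matrix_(i, j) x j ^+ l i) = (\prod_i x ord0 ^+ l i) *
   (\prod_j (y j - 1)) *
   \sum_(h in family P) \det (\matrix_(i, j) y j ^+ (lo i + h i)).
  transitivity ((\prod_i x ord0 ^+ l i) *
      \det (\matrix_(i, j) (x j / x ord0) ^+ l i)).
    rewrite -det_scale_rows; congr (\det _); apply/matrixP => i j.
    by rewrite !mxE -exprMn mulrC divfK.
  rewrite -mulrA; congr (_ * _); rewrite det_subr_rows; last first.
    by move=> i; rewrite mxE divff // expr1n.
  rewrite -(det_row_sums P (fun i t j => y j ^+ (lo i + t))) -det_scale_cols; congr (\det _).
  apply/matrixP => i j; rewrite !mxE subrXX_sum ?lohi //; congr (_ * _).
  rewrite (big_ord_widen_cond T (fun t => (t < hi i - lo i)%N)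
             (fun t => y j ^+ (lo i + t))) ?hiT //.
  by apply: eq_bigl => t; rewrite /P /= -/(hi i); lia.
rewrite !normrM normr_prod big1 ?mul1r; last by move=> i _; rewrite normrX x1 expr1n.
rewrite normr_prod.
have -> : gapn x = \prod_j `|y j - 1| * gapn y.
  rewrite /gapn (@prod_pairs_recl C 1 *%R); congr (_ * _).
    apply: eq_bigr => j _; rewrite -(divff (x0N0 ord0)) -mulrBl normrM normfV x1.
    by rewrite invr1 mulr1.
  apply: eq_bigr => i _; apply: eq_bigr => j _.
  by rewrite -mulrBl normrM normfV x1 invr1 mulr1.
rewrite -mulrA ler_wpM2l ?prodr_ge0 //.
apply: (le_trans (ler_norm_sum _ _ _)).
pose B := (\prod_(i < k) \prod_(j < k | (i < j)%N) `|hi j - lo i|)%N.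
have famP h : h \in family P -> forall i, (lo i + h i < hi i)%N.
  by move=> /familyP hP i; have := hP i; rewrite unfold_in; lia.
apply: (@le_trans _ _ (\sum_(h in family P) gapn y * B%:R)).
  apply: ler_sum => h /famP hP; apply: le_trans (IHk _ _ y1 _) _.
    move=> i j; rewrite leq_eqVlt => /orP [/eqP/val_inj -> //|ij].
    apply: leq_trans (ltnW (hP i)) _; apply: leq_trans (leq_addr _ _).
    by apply: lS; rewrite /= /bump; lia.
  rewrite ler_wpM2l ?prodr_ge0 //; first by move=> i _; rewrite prodr_ge0.
  rewrite ler_nat; apply: leq_prod => i _; apply: leq_prod => j ij.
  have /= := lS (lift ord0 i) (widen_ord (leqnSn k) j).
  rewrite /bump /= add1n => /(_ ij); rewrite -/(hi i) -/(lo j).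
  move: (hP i) (hP j); move: (lo i) (lo j) (hi i) (hi j) (val (h i)) (val (h j)).
  by move=> a b c e s t; lia.
rewrite sumr_const -[leLHS]mulr_natr -mulrA ler_wpM2l ?prodr_ge0 //.
  by move=> i _; rewrite prodr_ge0.
rewrite -natrM ler_nat gap_recr mulnC leq_mul2r; apply/orP; right.
rewrite card_family foldrE big_map -big_enum /= leq_prod // => i _.
have -> : #|P i| = #|'I_(hi i - lo i)|.
  have le : (hi i - lo i <= T)%N by have := hiT i; lia.
  rewrite -(fintype.card_image (f := widen_ord le)); last by move=> a b /(congr1 val)/= /val_inj.
  apply: eq_card => t; apply/idP/fintype.imageP.
    by rewrite unfold_in => Ht; exists (Ordinal Ht) => //; apply/val_inj.
  by case=> s _ ->; rewrite unfold_in /= /P /=.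
by rewrite card_ord; have := lohi i; rewrite -/(hi i) -/(lo i); lia.
Qed.

End GenVandermonde.

Lemma gap_sqr k (l : 'I_k -> nat) :
  (gap l ^ 2 = \prod_(i < k) \prod_(j < k | j != i) `|l j - l i|)%N.
Proof.
rewrite /gap; have -> : (\prod_(i < k) \prod_(j < k | j != i) `|l j - l i| =
   (\prod_(i < k) \prod_(j < k | (i < j)%N) `|l j - l i|) *
   (\prod_(i < k) \prod_(j < k | (j < i)%N) `|l j - l i|))%N.
  rewrite -big_split /=; apply: eq_bigr => i _.
  rewrite (bigID (fun j : 'I_k => (i < j)%N)) /=; congr (_ * _)%N.
    by apply: eq_bigl => j; rewrite -(inj_eq val_inj) /=; lia.
  by apply: eq_bigl => j; rewrite -(inj_eq val_inj) /=; lia.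
rewrite -mulnn; congr (_ * _)%N; rewrite (exchange_big_dep xpredT) //=.
by apply: eq_bigr => i _; apply: eq_bigr => j _; rewrite distnC.
Qed.

Lemma gap_perm k (l : 'I_k -> nat) (s : 'S_k) : gap (l \o s) = gap l.
Proof.
apply/eqP; rewrite -eqn_sqr !gap_sqr [X in _ == X](reindex_inj (@perm_inj _ s)) /=.
apply/eqP; apply: eq_bigr => i _; rewrite [RHS](reindex_inj (@perm_inj _ s)) /=.
by apply: eq_bigl => j; rewrite (inj_eq perm_inj).
Qed.

Lemma exists_sorting_perm disp (T : orderType disp) k (l : 'I_k -> T) :
  exists s : 'S_k, forall i j : 'I_k, (i <= j)%N -> (l (s i) <= l (s j))%O.
Proof.
pose t := [tuple l i | i < k].
have /tuple_permP [s Es] : perm_eq (sort <=%O t) t by rewrite perm_sort.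
exists s => i j ij /=.
have E a : l (s a) = nth (l i) (sort <=%O t) a.
  by rewrite Es -tnth_nth tnth_mktuple tnth_mktuple.
rewrite !E; apply: (sorted_leq_nth le_trans lexx) => //.
- by rewrite inE size_sort size_tuple.
- by rewrite inE size_sort size_tuple.
Qed.

(** Both sides are unchanged when the rows, hence the exponents, are sorted. *)
Lemma norm_det_powers (C : numFieldType) k (x : 'I_k -> C) (l : 'I_k -> nat) :
  (forall i, `|x i| = 1) ->
  `|\det (\matrix_(i, j) x j ^+ l i)| <= gapn x * (gap l)%:R.
Proof.
move=> x1; have [s sl] := exists_sorting_perm l.
rewrite -(gap_perm l s); apply: le_trans (norm_det_powers_sorted (l := l \o s) x1 _); last first.
  by move=> i j ij /=; rewrite -leEnat; apply: sl.
have -> : \matrix_(i, j) x j ^+ (l \o s) i = row_perm s (\matrix_(i, j) x j ^+ l i).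
  by apply/matrixP => i j; rewrite !mxE.
by rewrite row_permE det_mulmx det_perm normrM normrX normrN1 expr1n mul1r.
Qed.

(** * Averaging over block-preserving permutations *)
Section BlockAverage.
Variables (R : comRingType) (k m : nat).

Definition diag_blocks (A : 'M[R]_(k + m)) : 'M[R]_(k + m) :=
  block_mx (ulsubmx A) 0 0 (drsubmx A).

Let same (i j : 'I_(k + m)) := (i < k)%N == (j < k)%N.

Let diag_blocksE A i j : diag_blocks A i j = A i j *+ same i j.
Proof.
have L (a : 'I_k) : (lshift m a < k)%N by rewrite /= ltn_ord.
have G (a : 'I_m) : (rshift k a < k)%N = false by rewrite /= ltnNge leq_addr.
rewrite /diag_blocks /same; have [a ->|a ->] := split_ordP i;
  have [b ->|b ->] := split_ordP j; rewrite ?L ?G ?eqxx.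
- by rewrite block_mxEul !mxE.
- by rewrite block_mxEur !mxE.
- by rewrite block_mxEdl !mxE.
by rewrite block_mxEdr !mxE.
Qed.

(** A symmetric form of the Laplace expansion along the first [k] rows: writing
    both determinants as sums over permutations, every permutation [t] that
    preserves the two blocks of indices contributes one copy of [\det A], so
    [N] is the number [k! m!] of such permutations. *)
Lemma sum_det_diag_blocks : exists2 N : nat, (0 < N)%N & forall A : 'M[R]_(k + m),
  \sum_(s : 'S_(k + m)) (-1) ^+ s * \det (diag_blocks (row_perm s A)) =
  \det A *+ N.
Proof.
pose K := [pred t : 'S_(k + m) | [forall i, same i (t i)]].
exists #|K| => [|A].
  by apply/card_gt0P; exists 1%g; apply/forallP => i; rewrite perm1 /same.
under eq_bigr => s _.
  rewrite /determinant (bigID K) /= [X in _ + X]big1 ?addr0; last first.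
    move=> t /forallPn [i /negbTE ti]; rewrite (bigD1 i) //= diag_blocksE ti.
    by rewrite mulr0n mul0r mulr0.
  rewrite mulr_sumr; under eq_bigr => t /forallP tK.
    under eq_bigr => i _ do rewrite diag_blocksE tK mulr1n mxE.
    rewrite mulrA -signr_addb (reindex_inj (@perm_inj _ s^-1%g)) /=.
    under eq_bigr => i _ do rewrite permKV -permM.
    rewrite -odd_permV -odd_permM.
    over.
  over.
rewrite exchange_big /= -sumr_const; apply: eq_bigr => t _.
rewrite (reindex_inj (@invg_inj _)) (reindex_inj (mulIg t^-1)%g) /=.
by apply: eq_bigr => s _; rewrite invgK mulgKV.
Qed.

End BlockAverage.

Lemma gapn_split (C : numDomainType) k m (x : 'I_(k + m) -> C) :
  gapn x = gapn (x \o @lshift k m) * gapn (x \o @rshift k m) *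
           \prod_(i < k) \prod_(j < m) `|x (rshift k j) - x (lshift m i)|.
Proof.
rewrite /gapn big_split_ord /= mulrAC; congr (_ * _); last first.
  apply: eq_bigr => i _; rewrite big_mkcond big_split_ord /= big1 ?mul1r; last first.
    by move=> j _; rewrite ifN // -leqNgt ltnW // ltn_addr.
  by rewrite -big_mkcond /=; apply: eq_bigl => j; rewrite ltn_add2l.
rewrite -big_split /=; apply: eq_bigr => i _.
rewrite big_mkcond big_split_ord /= -big_mkcond /=; congr (_ * _).
by apply: eq_bigr => j _; rewrite ltn_addr.
Qed.

Lemma gap_split k m (l : 'I_(k + m) -> nat) :
  (gap l = gap (l \o @lshift k m) * gap (l \o @rshift k m) *
           \prod_(i < k) \prod_(j < m) `|l (rshift k j) - l (lshift m i)|)%N.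
Proof.
rewrite /gap big_split_ord /= mulnAC; congr (_ * _)%N; last first.
  apply: eq_bigr => i _; rewrite big_mkcond big_split_ord /= big1 ?mul1n; last first.
    by move=> j _; rewrite ifN // -leqNgt ltnW // ltn_addr.
  by rewrite -big_mkcond /=; apply: eq_bigl => j; rewrite ltn_add2l.
rewrite -big_split /=; apply: eq_bigr => i _.
rewrite big_mkcond big_split_ord /= -big_mkcond /=; congr (_ * _)%N.
by apply: eq_bigr => j _; rewrite ltn_addr.
Qed.

Lemma norm_det_powers_blocks (C : numFieldType) k m (x : 'I_(k + m) -> C)
    (l : 'I_(k + m) -> nat) :
  (forall i, `|x i| = 1) ->
  `|\det (\matrix_(i, j) x j ^+ l i)| <=
  gapn (x \o @lshift k m) * gapn (x \o @rshift k m) *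
  (\sum_(s : 'S_(k + m))
     gap (l \o s \o @lshift k m) * gap (l \o s \o @rshift k m))%N%:R.
Proof.
move=> x1; set A := \matrix_(i, j) _.
have [N N0 EN] := sum_det_diag_blocks C k m.
apply: (@le_trans _ _ `|\det A *+ N|).
  by rewrite normrMn -(prednK N0) mulrS lerDl mulrn_wge0.
rewrite -EN; apply: le_trans (ler_norm_sum _ _ _) _.
rewrite natr_sum mulr_sumr; apply: ler_sum => s _.
rewrite normrM normrX normrN1 expr1n mul1r det_ublock normrM natrM mulrACA.
have E1 : ulsubmx (row_perm s A) =
    \matrix_(i, j) (x \o @lshift k m) j ^+ (l \o s \o @lshift k m) i.
  by apply/matrixP => i j; rewrite !mxE.
have E2 : drsubmx (row_perm s A) =
    \matrix_(i, j) (x \o @rshift k m) j ^+ (l \o s \o @rshift k m) i.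
  by apply/matrixP => i j; rewrite !mxE.
by rewrite E1 E2 ler_pM // norm_det_powers // => i; rewrite /= x1.
Qed.

(** Every [b_s] separates the [a_i]: since all [|b_s - a_i|] are at least 1,
    [|a_i - a_j| <= |b_s - a_i| + |b_s - a_j| <= 2 |b_s - a_i| |b_s - a_j|].
    The inequality is the product of these over all [i], [j] and [s]. *)
Lemma gap_le_cross k m (a : 'I_k -> nat) (b : 'I_m -> nat) :
  (forall i j, a i != b j) ->
  (gap a ^ (2 * m) <= 2 ^ (k ^ 2 * m) *
     (\prod_(i < k) \prod_(j < m) `|b j - a i|) ^ (2 * k))%N.
Proof.
move=> ab; have d1 i j : (0 < `|b j - a i|)%N by rewrite absz_gt0 subr_eq0 eqz_nat eq_sym.
rewrite expnM gap_sqr.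
apply: (@leq_trans (\prod_(s < m) \prod_(i < k) \prod_(j < k)
          (2 * `|b s - a i| * `|b s - a j|))%N).
  rewrite -[m in X in (_ ^ X)%N]card_ord -prod_nat_const.
  apply: leq_prod => s _; apply: leq_prod => i _; rewrite big_mkcond.
  apply: leq_prod => j _; case: eqP => [->|_] /=.
    by rewrite !muln_gt0 d1.
  have h1 := d1 i s; have h2 := d1 j s.
  apply: (@leq_trans (`|b s - a i| + `|b s - a j|)%N); last by nia.
  by move: (a i) (a j) (b s) => p q r; lia.
rewrite leq_eqVlt; apply/orP; left; apply/eqP.
under eq_bigr => s _.
  under eq_bigr => i _.
    rewrite big_split /= prod_nat_const card_ord expnMn -mulnA.
  over.
  rewrite big_split /= prod_nat_const card_ord -expnM.
  rewrite big_split /= prod_nat_const card_ord.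
  have -> : (\prod_(i < k) `|b s - a i| ^ k =
    (\prod_(i < k) `|b s - a i|) ^ k)%N.
    by elim/big_rec2: _ => [|i u v _ ->]; rewrite ?exp1n ?expnMn.
  rewrite -expnD addnn -mul2n.
over.
rewrite big_split /= prod_nat_const card_ord -expnM mulnn; congr (_ * _)%N.
rewrite [X in _ = (X ^ _)%N]exchange_big /=.
by elim/big_rec2: _ => [|i u v _ ->]; rewrite ?exp1n ?expnMn.
Qed.

(** The differences inside each of the two blocks are controlled by those across
    the blocks, so the latter contribute at least a fraction [k m / n^2] of the
    logarithm of [gap l], up to a multiple of [ln 2]. *)
Lemma gap_pow_le_cross k m (l : 'I_(k + m) -> nat) (n := (k + m)%N) :
  injective l ->
  (gap l ^ (2 * (k * m)) <= 2 ^ (k * m * n ^ 2) *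
     (\prod_(i < k) \prod_(j < m) `|l (rshift k j) - l (lshift m i)|) ^ (2 * n ^ 2))%N.
Proof.
move=> linj; rewrite {1}gap_split; set X := (\prod_(i < k) _)%N.
set a := l \o _; set b := l \o _.
have ab i j : a i != b j.
  by rewrite (inj_eq linj) -(inj_eq val_inj) /= neq_ltn ltn_addr.
have X1 : (0 < X)%N.
  rewrite prodn_gt0 // => i; rewrite prodn_gt0 // => j.
  by rewrite absz_gt0 subr_eq0 eqz_nat eq_sym ab.
have ha : (gap a ^ (2 * m) <= 2 ^ (k ^ 2 * m) * X ^ (2 * k))%N.
  exact: (gap_le_cross ab).
have hb : (gap b ^ (2 * k) <= 2 ^ (m ^ 2 * k) * X ^ (2 * m))%N.
  suff -> : X = (\prod_(j < m) \prod_(i < k) `|a i - b j|)%N.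
    by apply: gap_le_cross => i j; rewrite eq_sym.
  rewrite /X exchange_big /=.
  by apply: eq_bigr => j _; apply: eq_bigr => i _; rewrite distnC.
have E u v e : (u <= v -> u ^ e <= v ^ e)%N by case: e => // e; rewrite leq_exp2r.
rewrite !expnMn.
apply: (@leq_trans ((2 ^ (k ^ 2 * m) * X ^ (2 * k)) ^ k *
   (2 ^ (m ^ 2 * k) * X ^ (2 * m)) ^ m * X ^ (2 * (k * m)))%N).
  rewrite leq_mul2r; apply/orP; right; apply: leq_mul.
    by rewrite [(k * m)%N]mulnC mulnA expnM E.
  by rewrite mulnA expnM E.
rewrite !expnMn -!expnM mulnACA -expnD -mulnA -!expnD.
apply: leq_mul; apply: leq_pexp2l => //; rewrite /n.
  by rewrite !expnS !expn0; nia.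
by rewrite !expnS !expn0; nia.
Qed.

(** * Independence of monomials on the torus *)

Section Independence.
Variable C : numClosedFieldType.

(** Infinitely many points of the unit circle, without trigonometry. *)
Definition cunit (k : nat) : C := (1 + 'i * k%:R) / (1 - 'i * k%:R).

Lemma cunit_den k : 1 - 'i * k%:R != 0 :> C.
Proof.
apply/eqP => /(congr1 (@Re C)) /eqP.
by rewrite raddfB /= ReMil raddf0 (Creal_ReP _ _) ?rpred1 // (Creal_ImP _ _) ?rpred_nat // oppr0 subr0 oner_eq0.
Qed.

Lemma norm_cunit k : `|cunit k| = 1.
Proof.
rewrite /cunit normrM normfV -[X in X / _]norm_conjC rmorphD rmorph1 rmorphM /= conjCi.
by rewrite rmorph_nat mulNr divff // normr_eq0 cunit_den.
Qed.

Lemma cunit_inj : injective cunit.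
Proof.
move=> k l /eqP; rewrite /cunit eqr_div ?cunit_den // => /eqP E.
have : ('i * 2) * (k%:R - l%:R) = 0 :> C.
  transitivity ((1 + 'i * k%:R) * (1 - 'i * l%:R) - (1 + 'i * l%:R) * (1 - 'i * k%:R) : C).
    by ring.
  by rewrite E subrr.
move/eqP; rewrite !mulf_eq0 (negPf (neq0Ci C)) pnatr_eq0 /= subr_eq0 eqr_nat.
by move=> /eqP.
Qed.

Lemma poly_unit_eq0 (p : {poly C}) : (forall q : C, `|q| = 1 -> p.[q] = 0) -> p = 0.
Proof.
move=> H; apply/eqP; apply: contraT => p0; rewrite -(ltnn (size p)).
have := @max_poly_roots _ p [seq cunit k | k <- iota 0 (size p)] p0.
rewrite size_map size_iota => -> //; last by rewrite map_inj_uniq ?iota_uniq //; exact: cunit_inj.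
by apply/allP => _ /mapP [k _ ->]; rewrite /root H ?norm_cunit.
Qed.

Definition mon n (z : 'I_n -> C) (e : 'I_n -> int) : C := \prod_i z i ^ e i.

(** An expansion in base [M] with small signed digits is unique. *)
Lemma digits_eq0 n (f : 'I_n -> int) (M : nat) :
  (forall i, (`|f i| < M)%N) -> \sum_i f i * (M ^ i)%N%:Z = 0 -> forall i, f i = 0.
Proof.
elim: n f => [f _ _ []//|n IHn f fM]; rewrite big_ord_recl expn0 mulr1.
have -> : \sum_(i < n) f (lift ord0 i) * (M ^ lift ord0 i)%N%:Z =
   M%:Z * \sum_(i < n) f (lift ord0 i) * (M ^ i)%N%:Z.
  rewrite mulr_sumr; apply: eq_bigr => i _.
  by rewrite /= /bump /= add1n expnS PoszM mulrCA.
set S := \sum_(_ < n) _ => E.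
have S0 : S = 0.
  have := fM ord0; case: (S =P 0) => // /eqP S0 f0; exfalso.
  have : (1 <= `|S|)%N by rewrite absz_gt0.
  have : `|f ord0|%N = (M * `|S|)%N.
    by rewrite -[M in RHS]/(`|M%:Z|%N) -abszM -[RHS]abszN; congr absz; lia.
  by nia.
move: E; rewrite S0 mulr0 addr0 => f0 i.
have [j ->|->] := unliftP ord0 i; last exact: f0.
by apply: (IHn (fun j => f (lift ord0 j))) => // j'.
Qed.

(** Substituting [z_i = q^(M^i)] with [M] larger than twice every exponent sends
    distinct monomials to distinct powers of [q], and a Laurent polynomial in one
    variable that vanishes on the circle is zero.  Points with two equal
    coordinates are excluded from the hypothesis because this is where the
    Casimir computation divides by [z_i - z_j]. *)
Lemma mon_independent n (A : finType) (k : A -> C) (e : A -> {ffun 'I_n -> int}) :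
  (forall z, (forall i, `|z i| = 1) -> injective z -> \sum_a k a * mon z (e a) = 0) ->
  forall mu, \sum_(a | e a == mu) k a = 0.
Proof.
move=> H mu; have [a0 /eqP Ea0|Ne] := pickP (fun a => e a == mu); last by rewrite big_pred0.
pose B := (\max_a \max_i `|e a i|)%N; pose M := (2 * B).+2.
have eB a i : (`|e a i| <= B)%N.
  apply: leq_trans (leq_bigmax (F := fun a => (\max_i `|e a i|)%N) a).
  exact: (leq_bigmax (F := fun i => `|e a i|%N) i).
pose N a : int := \sum_i e a i * (M ^ i)%N%:Z.
pose S := (\sum_a `|N a|)%N.
have NS a : (0 <= N a + S%:Z).
  have : (`|N a| <= S)%N by rewrite /S (bigD1 a) //= leq_addr.
  by lia.
have Ninj a b : N a = N b -> e a = e b.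
  move=> E; apply/ffunP => i; apply/eqP; rewrite -subr_eq0; apply/eqP.
  apply: (@digits_eq0 n (fun i => e a i - e b i) M) => [j|].
    by have := eB a j; have := eB b j; rewrite /M; lia.
  rewrite -[RHS](subrr (N b)) -{1}E /N -sumrB.
  by apply: eq_bigr => j _; rewrite mulrBl.
(* The shift by [S] clears negative exponents; [r] vanishes exactly where two of
   the numbers [q^(M^i)] coincide. *)
pose p : {poly C} := \sum_a k a *: 'X^(absz (N a + S%:Z)).
pose r : {poly C} := \prod_(i < n) \prod_(j < n | (i < j)%N) ('X^(M ^ j) - 'X^(M ^ i)).
have Minj (i j : 'I_n) : (M ^ i == M ^ j)%N = (i == j) by rewrite eqn_exp2l.
have r0 : r != 0.
  apply/prodf_neq0 => i _; apply/prodf_neq0 => j ij.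
  have /negPf ji : j != i by rewrite -(inj_eq val_inj) gtn_eqF.
  apply/eqP => /(congr1 (fun p : {poly C} => p`_(M ^ j))) /eqP.
  by rewrite coefB !coefXn eqxx Minj ji coef0 subr0 oner_eq0.
have : p * r = 0.
  apply: poly_unit_eq0 => q q1; rewrite hornerM.
  have [->|rq] := eqVneq r.[q] 0; first by rewrite mulr0.
  pose z (i : 'I_n) := q ^+ (M ^ i).
  have q0 : q != 0 by rewrite -normr_gt0 q1.
  have zi : injective z.
    move=> i j zij; apply/eqP; apply: contraNT rq => ij.
    rewrite /r horner_prod.
    have [ltij|ltji|/val_inj Eij] := ltngtP i j; last by rewrite Eij eqxx in ij.
      rewrite (bigD1 i) //= horner_prod (bigD1 j) //= hornerD hornerN !hornerXn.
      by rewrite -/(z i) -/(z j) zij subrr !mul0r.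
    rewrite (bigD1 j) //= horner_prod (bigD1 i) //= hornerD hornerN !hornerXn.
    by rewrite -/(z i) -/(z j) zij subrr !mul0r.
  have z1 i : `|z i| = 1 by rewrite normrX q1 expr1n.
  have := H z z1 zi; move/(congr1 (fun x => x * q ^+ S)); rewrite mul0r => E.
  rewrite (_ : p.[q] = 0) ?mul0r // -[RHS]E /p horner_sum mulr_suml.
  apply: eq_bigr => a _; rewrite hornerZ hornerXn -mulrA; congr (_ * _).
  have -> : mon z (e a) = q ^ N a.
    rewrite /mon /N (big_morph (fun x => q ^ x) (id1 := 1) (op1 := *%R)) //; last first.
      by move=> x y; rewrite expfzDr.
    by apply: eq_bigr => i _; rewrite /z exprnP exprz_exp mulrC.
  by rewrite !exprnP gez0_abs // expfzDr.
move/eqP; rewrite mulf_eq0 (negPf r0) orbF => /eqP /(congr1 (fun p : {poly C} => p`_(absz (N a0 + S%:Z)))).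
rewrite coef0 /p coef_sum => E0; rewrite -[RHS]E0 [LHS]big_mkcond; apply: eq_bigr => a _.
rewrite coefZ coefXn -Ea0; case: eqP => [E|NE].
  by rewrite /N E eqxx mulr1.
case: eqP => [/(congr1 Posz)|_]; last by rewrite mulr0.
by rewrite !gez0_abs // => /addIr /Ninj /esym.
Qed.

Lemma mon_comb_eq0 n (A : finType) (k : A -> C) (e : A -> {ffun 'I_n -> int}) :
  (forall mu, \sum_(a | e a == mu) k a = 0) -> forall z, \sum_a k a * mon z (e a) = 0.
Proof.
move=> H z; pose U := undup [seq e a | a : A].
transitivity (\sum_(mu <- U) \sum_(a | e a == mu) k a * mon z mu).
  rewrite (exchange_big_dep xpredT) //=; apply: eq_bigr => a _.
  rewrite big_mkcond (bigD1_seq (e a)) ?undup_uniq //=; last first.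
    by rewrite mem_undup; apply/fintype.imageP; exists a.
  by rewrite eqxx big1 ?addr0 // => mu; rewrite eq_sym => /negPf ->.
by rewrite big1 // => mu _; rewrite -mulr_suml H mul0r.
Qed.

End Independence.

(** * Derivatives of the Vandermonde product *)
Section VandermondeDerivative.
Variable C : fieldType.

Definition dlog (p : {poly C}) : C := p^`().[0] / p.[0].

Lemma dlogM p q : p.[0] != 0 -> q.[0] != 0 -> dlog (p * q) = dlog p + dlog q.
Proof.
move=> p0 q0; rewrite /dlog derivM !hornerE; field.
by rewrite p0 q0.
Qed.

Lemma dlog_prod (I : Type) (r : seq I) (P : pred I) (p : I -> {poly C}) :
  (forall i, P i -> (p i).[0] != 0) ->
  dlog (\prod_(i <- r | P i) p i) = \sum_(i <- r | P i) dlog (p i).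
Proof.
move=> p0; elim: r => [|i r IH].
  by rewrite !big_nil /dlog derivC horner0 mul0r.
rewrite !big_cons; case: ifP => // Pi; rewrite dlogM ?IH ?p0 // horner_prod.
elim: (r) => [|j s IHs]; first by rewrite big_nil oner_eq0.
by rewrite big_cons; case: ifP => // Pj; rewrite mulf_neq0 ?p0.
Qed.

Lemma dlogX p k : p.[0] != 0 -> dlog (p ^+ k) = k%:R * dlog p.
Proof.
move=> p0; elim: k => [|k IH]; first by rewrite mul0r /dlog derivC horner0 mul0r.
by rewrite exprS dlogM ?horner_exp ?expf_neq0 // IH -natr1 mulrDl mul1r addrC.
Qed.

Lemma deriv_dlog p : p.[0] != 0 -> p^`().[0] = p.[0] * dlog p.
Proof. by move=> p0; rewrite mulrC divfK. Qed.

Definition vdm n (z : 'I_n -> C) : C :=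
  \prod_(i < n) \prod_(j < n | (i < j)%N) (z j - z i).

Lemma vdm_det (F : comNzRingType) n (z : 'I_n -> F) :
  \prod_(i < n) \prod_(j < n | (i < j)%N) (z j - z i) =
  \sum_(s : 'S_n) (-1) ^+ s * \prod_i z i ^+ s i.
Proof.
have := det_Vandermonde (\row_i z i); rewrite -det_tr.
under eq_bigr => i _ do under eq_bigr => j _ do rewrite !mxE.
move=> <-; apply: eq_bigr => s _; congr (_ * _).
by apply: eq_bigr => i _; rewrite !mxE.
Qed.

(** Both sides are the derivative at 0 of the Vandermonde product along the lines
    [z_i + z_i u_i X], that is, the image of [vdm] under the operator
    [\sum_i u_i z_i d/dz_i]: on the left after expansion into monomials, on the
    right as the product times its logarithmic derivative. *)
Lemma vdm_derivative n (z u : 'I_n -> C) : (forall i, z i != 0) -> injective z ->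
  \sum_(s : 'S_n) (-1) ^+ s * (\sum_i (s i)%:R * u i) * \prod_i z i ^+ s i =
  vdm z * \sum_(i < n) \sum_(j < n | (i < j)%N) (z j * u j - z i * u i) / (z j - z i).
Proof.
move=> z0 zi; pose a i : {poly C} := (z i)%:P + (z i * u i) *: 'X.
have a0 i : (a i).[0] = z i by rewrite /a !hornerE.
have da i : (a i)^`().[0] = z i * u i by rewrite /a derivD derivC derivZ derivX !hornerE.
clearbody a; have := congr1 (fun p : {poly C} => p^`().[0]) (vdm_det a).
rewrite deriv_dlog; last first.
  rewrite horner_prod; apply/prodf_neq0 => i _; rewrite horner_prod.
  apply/prodf_neq0 => j ij; rewrite hornerD hornerN !a0 subr_eq0.
  by rewrite (inj_eq zi) -(inj_eq val_inj) gtn_eqF.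
have -> : (\prod_(i < n) \prod_(j < n | (i < j)%N) (a j - a i)).[0] = vdm z.
  rewrite horner_prod; apply: eq_bigr => i _; rewrite horner_prod.
  by apply: eq_bigr => j _; rewrite hornerD hornerN !a0.
have zij (i j : 'I_n) : (i < j)%N -> (a j - a i).[0] != 0.
  move=> ij; rewrite hornerD hornerN !a0 subr_eq0.
  by rewrite (inj_eq zi) -(inj_eq val_inj) gtn_eqF.
rewrite dlog_prod; last first.
  by move=> i _; rewrite horner_prod; apply/prodf_neq0 => j ij; apply: zij.
have -> : \sum_(i < n) dlog (\prod_(j < n | (i < j)%N) (a j - a i)) =
    \sum_(i < n) \sum_(j < n | (i < j)%N) (z j * u j - z i * u i) / (z j - z i).
  apply: eq_bigr => i _; rewrite dlog_prod; last by move=> j; apply: zij.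
  by apply: eq_bigr => j _; rewrite /dlog derivB !hornerD !hornerN !a0 !da.
move=> ->; rewrite raddf_sum /= horner_sum; apply: eq_bigr => s _.
have E0 : (\prod_i a i ^+ s i).[0] = \prod_i z i ^+ s i.
  by rewrite horner_prod; apply: eq_bigr => i _; rewrite horner_exp a0.
have N0 : (\prod_i a i ^+ s i).[0] != 0.
  by rewrite E0; apply/prodf_neq0 => i _; rewrite expf_neq0.
have D : (\prod_i a i ^+ s i)^`().[0] = (\sum_i (s i)%:R * u i) * \prod_i z i ^+ s i.
  rewrite deriv_dlog // E0 mulrC; congr (_ * _); rewrite dlog_prod.
    by apply: eq_bigr => i _; rewrite dlogX ?a0 // /dlog da a0 mulrAC mulfV ?mul1r.
  by move=> i _; rewrite horner_exp a0 expf_neq0.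
case: (odd_perm s); rewrite ?expr0 ?expr1 ?mul1r ?mulN1r ?D //.
by rewrite derivN hornerN D mulNr.
Qed.

End VandermondeDerivative.

(** * The Casimir element and the Laplacian of the torus *)

(** A subspace inside [P] that is not all of [P] can be enlarged, and dimensions
    are bounded. *)
Lemma vspace_of_pred (F : fieldType) (V : vectType F) (P : V -> Prop) :
  P 0 -> (forall c u v, P u -> P v -> P (c *: u + v)) ->
  exists W : {vspace V}, forall u, u \in W <-> P u.
Proof.
move=> P0 PD.
suff : forall N, (exists W : {vspace V}, forall u, u \in W <-> P u) \/
    exists2 W : {vspace V}, (N <= \dim W)%N & forall u, u \in W -> P u.
  move/(_ (\dim {:V}).+1) => [//|[W]].
  by rewrite leqNgt ltnS dimvS ?subvf.
elim=> [|N [IH|[W WN WP]]]; [|by left|].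
  by right; exists 0%VS => // u; rewrite memv0 => /eqP ->.
have [H|/existsNP [v Hv]] := pselect (forall u, P u -> u \in W).
  by left; exists W => u; split; [apply: WP|apply: H].
move/not_implyP: Hv => [Pv /negP vW]; right; exists (<[v]> + W)%VS.
  rewrite (leq_ltn_trans WN) // ltnNge; apply: contra vW => le.
  have /eqP -> : (W == <[v]> + W)%VS by rewrite eqEdim addvSr.
  exact: (subvP (addvSl _ _)) _ (memv_line _).
by move=> u /memv_addP [_ /vlineP [c ->] [w wW ->]]; apply: PD => //; apply: WP.
Qed.

(** An irreducible module over the Lie algebra of all matrices, in a basis of
    weight vectors: [E i j] is the action of the elementary matrix with entry 1
    at [(i, j)], and [m a] is the weight of the basis vector of index [a]. *)
Section GlnModule.
Variable C : numClosedFieldType.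
Variables n d : nat.
Variable E : 'I_n -> 'I_n -> 'M[C]_d.
Variable m : 'I_d -> 'I_n -> int.
Hypothesis Erel : forall i j k l, E i j *m E k l - E k l *m E i j =
  (j == k)%:R *: E i l - (l == i)%:R *: E k j.
Hypothesis Ediag : forall i, E i i = diag_mx (\row_a (m a i)%:~R).
Hypothesis Eirr : forall W : {vspace 'cV[C]_d},
  (forall i j v, v \in W -> E i j *m v \in W) -> W = 0%VS \/ W = fullv.
Hypothesis d0 : (0 < d)%N.

(** The bracket of [E k k] with [E i j] is [((k == i) - (k == j)) E i j]; its
    entry at [(a, b)] compares the weights of [a] and [b]. *)
Lemma E_weight i j a b : E i j a b != 0 ->
  forall k, m a k = m b k + (k == i)%:R - (k == j)%:R.
Proof.
move=> nz k; have := congr1 (fun A : 'M[C]_d => A a b) (Erel k k i j).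
rewrite Ediag mul_diag_mx mul_mx_diag !mxE eq_sym [(j == k)]eq_sym.
have -> : (i == k)%:R * E k j a b = (k == i)%:R * E i j a b.
  by rewrite eq_sym; case: eqP => [->|_] //; rewrite !mul0r.
have -> : (k == j)%:R * E i k a b = (k == j)%:R * E i j a b.
  by case: eqP => [->|_] //; rewrite !mul0r.
rewrite [E i j a b * _]mulrC -!mulrBl => /(mulIf nz) /eqP.
have N (x : bool) : x%:R = (x%:R : int)%:~R :> C by case: x.
by rewrite !N -!intrB eqr_int [i == k]eq_sym => /eqP H; lia.
Qed.

Definition casimir := \sum_i \sum_j E i j *m E j i.

(** By the Leibniz rule the bracket with [E a b] splits into four double sums, two
    of each sign, which collapse to [S1] and [S2] and cancel. *)
Lemma casimir_comm a b : casimir *m E a b = E a b *m casimir.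
Proof.
apply/eqP; rewrite -subr_eq0; apply/eqP.
pose S1 := \sum_j E a j *m E j b; pose S2 := \sum_i E i b *m E a i.
rewrite /casimir mulmx_suml mulmx_sumr -sumrB.
under eq_bigr => i _.
  rewrite mulmx_suml mulmx_sumr -sumrB.
  under eq_bigr => j _.
    have -> : E i j *m E j i *m E a b - E a b *m (E i j *m E j i) =
      E i j *m (E j i *m E a b - E a b *m E j i) +
      (E i j *m E a b - E a b *m E i j) *m E j i.
      by rewrite mulmxBr mulmxBl !mulmxA addrA subrK.
    rewrite !Erel mulmxBr mulmxBl -!scalemxAr -!scalemxAl.
  over.
  rewrite big_split /= !sumrB.
over.
rewrite big_split /= !sumrB.
have e1 : \sum_i \sum_j (i == a)%:R *: (E i j *m E j b) = S1.
  rewrite (bigD1 a) //= [X in _ + X]big1 ?addr0.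
    by apply: eq_bigr => j _; rewrite eqxx scale1r.
  by move=> i /negPf ia; rewrite big1 // => j _; rewrite ia scale0r.
have e2 : \sum_i \sum_j (b == j)%:R *: (E i j *m E a i) = S2.
  apply: eq_bigr => i _; rewrite (bigD1 b) //= eqxx scale1r big1 ?addr0 // => j.
  by rewrite eq_sym => /negPf ->; rewrite scale0r.
have e3 : \sum_i \sum_j (j == a)%:R *: (E i b *m E j i) = S2.
  apply: eq_bigr => i _; rewrite (bigD1 a) //= eqxx scale1r big1 ?addr0 // => j.
  by move=> /negPf ->; rewrite scale0r.
have e4 : \sum_i \sum_j (b == i)%:R *: (E a j *m E j i) = S1.
  rewrite (bigD1 b) //= [X in _ + X]big1 ?addr0.
    by apply: eq_bigr => j _; rewrite eqxx scale1r.
  by move=> i; rewrite eq_sym => /negPf ib; rewrite big1 // => j _; rewrite ib scale0r.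
by rewrite e1 e2 e3 e4 addrA subrK subrr.
Qed.

(** Schur's lemma: the kernel of [casimir - c] is a submodule for an eigenvalue
    [c]. *)
Lemma casimir_scalar : exists c : C, casimir = c%:M.
Proof.
have [c /eigenvalueP [v vE v0]] := eigenvalue_closed (casimir^T) d0.
exists c; pose f := linfun (mulmx (casimir - c%:M) : 'cV[C]_d -> 'cV[C]_d).
have fE u : (u \in lker f) = (casimir *m u == c *: u).
  by rewrite memv_ker lfunE /= mulmxBl mul_scalar_mx subr_eq0.
have [i j u||fT] := @Eirr (lker f).
- rewrite !fE => /eqP uE.
  by rewrite mulmxA casimir_comm -mulmxA uE -scalemxAr.
- move=> f0; have : v^T \in lker f.
    by rewrite fE -[casimir]trmxK -trmx_mul vE linearZ.
  by rewrite f0 memv0 -(inj_eq trmx_inj) trmxK trmx0 (negPf v0).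
apply/matrixP => a b.
have : delta_mx b 0 \in lker f by rewrite fT memvf.
rewrite fE => /eqP /matrixP /(_ a 0); rewrite -colE !mxE => ->.
by rewrite andbT mulr_natr.
Qed.

(** The character on the diagonal torus, read off the weights. *)
Definition chi (z : 'I_n -> C) : C := \sum_a mon z (m a).

Section TraceIdentity.
Variable z : 'I_n -> C.
Hypothesis z0 : forall i, z i != 0.

Let T : 'M[C]_d := diag_mx (\row_a mon z (m a)).

Lemma tor_E i j : z j *: (T *m E i j) = z i *: (E i j *m T).
Proof.
apply/matrixP => a b; rewrite mul_diag_mx mul_mx_diag !mxE.
have [->|nz] := eqVneq (E i j a b) 0; first by rewrite !(mulr0, mul0r).
have H := E_weight nz.
suff K : z j * mon z (m a) = z i * mon z (m b).
  by rewrite mulrA K -mulrA [mon _ _ * _]mulrC.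
have [Eij|ij] := eqVneq i j.
  rewrite Eij in H *; congr (_ * _); apply: eq_bigr => k _; rewrite H; congr (_ ^ _); lia.
rewrite /mon (bigD1 i) //= [in RHS](bigD1 i) //= (bigD1 j) 1?eq_sym //=.
rewrite [in RHS](bigD1 j) 1?eq_sym //= !H !eqxx (negPf ij) [j == i]eq_sym (negPf ij).
rewrite (eq_bigr (fun k => z k ^ m b k)); last first.
  by move=> k /andP [ki kj]; rewrite H (negPf ki) (negPf kj); congr (_ ^ _); lia.
set p := \prod_(_ < n | _) _.
have -> : z i ^ (m b i + 1%:R - 0%:R) = z i ^ m b i * z i.
  by rewrite subr0 expfzDr // expr1z.
have -> : z j ^ (m b j + 0%:R - 1%:R) = z j ^ m b j / z j.
  by rewrite addr0 expfzDr.
by field; rewrite z0.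
Qed.

(** Moving [E i j] around the trace multiplies it by [z_i / z_j] and exchanges
    the two factors, whose bracket [E i i - E j j] is diagonal.  This determines
    the trace as soon as [z_i != z_j]. *)
Lemma trace_E i j : (z i - z j) * \tr (T *m (E i j *m E j i)) =
  z i * \sum_a mon z (m a) * (m a i - m a j)%:~R.
Proof.
have Eb : E j i *m E i j = E i j *m E j i - (E i i - E j j).
  by have := Erel i j j i; rewrite !eqxx !scale1r => <-; rewrite opprB addrC subrK.
have ET : \tr (T *m (E i i - E j j)) = \sum_a mon z (m a) * (m a i - m a j)%:~R.
  rewrite !Ediag -raddfB /= mulmx_diag mxtrace_diag; apply: eq_bigr => a _.
  by rewrite !mxE intrB.
rewrite -ET mulrBl.
have -> : z j * \tr (T *m (E i j *m E j i)) = z i * \tr (T *m (E j i *m E i j)).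
  rewrite -!mxtraceZ mulmxA scalemxAl tor_E -scalemxAl !mxtraceZ; congr (_ * _).
  by rewrite -mulmxA mxtrace_mulC mulmxA.
by rewrite Eb mulmxBr raddfB /= mulrBr opprB addrC subrK.
Qed.

End TraceIdentity.

Lemma sum_offdiag (V : zmodType) (g : 'I_n -> 'I_n -> V) :
  \sum_i \sum_(j | j != i) g i j = \sum_(i < n) \sum_(j < n | (i < j)%N) (g i j + g j i).
Proof.
have -> : \sum_i \sum_(j | j != i) g i j = \sum_(i < n) (\sum_(j < n | (i < j)%N) g i j) +
    \sum_(i < n) (\sum_(j < n | (j < i)%N) g i j).
  rewrite -big_split /=; apply: eq_bigr => i _; rewrite (bigID (fun j : 'I_n => (i < j)%N)) /=.
  by congr (_ + _); apply: eq_bigl => j; rewrite -(inj_eq val_inj) /=; lia.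
rewrite [X in _ + X](exchange_big_dep xpredT) //= -big_split /=.
by apply: eq_bigr => i _; rewrite -big_split.
Qed.

(** The eigenvalue of [\sum_i (D_i^2 - (n - 1) D_i)], with [D_i = z_i d/dz_i], on
    the monomial of exponent [mu]. *)
Definition quad (mu : 'I_n -> int) : int := \sum_i (mu i ^+ 2 - n.-1%:Z * mu i).

Lemma sum_pairs (u : 'I_n -> C) :
  \sum_(i < n) \sum_(j < n | (i < j)%N) (u i + u j) = n.-1%:R * \sum_i u i.
Proof.
rewrite -(sum_offdiag (fun i _ => u i)) mulr_sumr; apply: eq_bigr => i _.
rewrite sumr_const mulr_natl; congr (_ *+ _).
by rewrite -[n in RHS]card_ord (cardC1 i).
Qed.

(** The exponents in the product of [vdm] and [chi], whose monomials are indexed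
    by a permutation and a weight. *)
Definition shifted (p : 'I_d * 'S_n) : {ffun 'I_n -> int} :=
  [ffun i => m p.1 i + (p.2 i)%:Z].

Lemma quad_shifted a s : quad (shifted (a, s)) =
  quad (m a) + quad (fun i : 'I_n => i%:Z) + 2 * \sum_i m a i * (s i)%:Z.
Proof.
have -> : quad (fun i : 'I_n => i%:Z) = quad (fun i => (s i)%:Z).
  exact: (reindex_inj (@perm_inj _ s)).
rewrite /quad mulr_sumr -!big_split /=; apply: eq_bigr => i _.
by rewrite ffunE /=; ring.
Qed.

Lemma mon_shifted (z : 'I_n -> C) a s : (forall i, z i != 0) ->
  mon z (shifted (a, s)) = mon z (m a) * \prod_i z i ^+ s i.
Proof.
move=> z0; rewrite /mon -big_split /=; apply: eq_bigr => i _.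
by rewrite ffunE /= expfzDr.
Qed.

(** The trace of the Casimir element against the torus element [z] is a multiple
    of [chi z], and by [trace_E] it is also a second-order differential operator
    applied to [chi].  Multiplying by [vdm z] turns that operator into the
    Laplacian of which [quad] gives the eigenvalues, because the cross terms are
    the derivative computed in [vdm_derivative].  Hence the product of [vdm] and
    [chi] is an eigenfunction of this Laplacian. *)
Lemma laplace_eigen : exists c : C, forall z : 'I_n -> C, (forall i, `|z i| = 1) -> injective z ->
  \sum_(p : 'I_d * 'S_n) (-1) ^+ p.2 * ((quad (shifted p))%:~R - c) * mon z (shifted p) = 0.
Proof.
have [c Ec] := casimir_scalar.
exists (c + (quad (fun i : 'I_n => i%:Z))%:~R) => z z1 zi.
have z0 i : z i != 0 by rewrite -normr_gt0 z1.
have zij i j : i != j -> z i - z j != 0 by move=> ij; rewrite subr_eq0 (inj_eq zi).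
pose T : 'M[C]_d := diag_mx (\row_a mon z (m a)).
have trC : c * chi z = \sum_i \sum_j \tr (T *m (E i j *m E j i)).
  transitivity (\tr (T *m casimir)).
    rewrite Ec mul_mx_scalar mxtraceZ mxtrace_diag; congr (_ * _).
    by apply: eq_bigr => a _; rewrite mxE.
  rewrite /casimir mulmx_sumr raddf_sum; apply: eq_bigr => i _.
  by rewrite mulmx_sumr raddf_sum.
pose L a : C := \sum_i (m a i)%:~R ^+ 2 + \sum_i \sum_(j | j != i)
   z i / (z i - z j) * (m a i - m a j)%:~R.
have EL : \sum_a mon z (m a) * (L a - c) = 0.
  under eq_bigr do rewrite mulrBr.
  rewrite sumrB -mulr_suml [_ * c]mulrC -/(chi z) trC.
  apply/eqP; rewrite subr_eq0; apply/eqP.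
  under [RHS]eq_bigr => i _.
    rewrite (bigD1 i) //=.
    have -> : \tr (T *m (E i i *m E i i)) = \sum_a mon z (m a) * (m a i)%:~R ^+ 2.
      rewrite Ediag !mulmx_diag mxtrace_diag; apply: eq_bigr => a _.
      by rewrite !mxE expr2.
    have -> : \sum_(j | j != i) \tr (T *m (E i j *m E j i)) =
       \sum_a mon z (m a) * \sum_(j | j != i) z i / (z i - z j) * (m a i - m a j)%:~R.
      under [RHS]eq_bigr do rewrite mulr_sumr.
      rewrite [RHS]exchange_big /=; apply: eq_bigr => j ji.
      have h : z i - z j != 0 by rewrite zij // eq_sym.
      apply: (mulfI h); rewrite trace_E // mulr_sumr mulr_sumr.
      by apply: eq_bigr => a _; field.
    over.
  rewrite big_split /= [X in _ = X + _]exchange_big [X in _ = _ + X]exchange_big /=.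
  rewrite -big_split; apply: eq_bigr => a _ /=.
  by rewrite /L mulrDr !mulr_sumr.
have Evdm : vdm z = \sum_(s : 'S_n) (-1) ^+ s * \prod_i z i ^+ s i by exact: vdm_det.
rewrite -(pair_bigA _ (fun a s => (-1) ^+ (s : 'S_n) *
   ((quad (shifted (a, s)))%:~R - (c + (quad (fun i : 'I_n => i%:Z))%:~R)) *
   mon z (shifted (a, s)))) /=.
transitivity (\sum_a vdm z * (mon z (m a) * (L a - c))); last first.
  by rewrite -mulr_sumr EL mulr0.
apply: eq_bigr => a _.
have V := vdm_derivative (fun i => (m a i)%:~R) z0 zi.
transitivity (mon z (m a) * ((((quad (m a))%:~R - c) * vdm z) +
  2 * (\sum_(s : 'S_n) (-1) ^+ s * (\sum_i (s i)%:R * (m a i)%:~R) * \prod_i z i ^+ s i))).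
  rewrite Evdm mulr_sumr mulr_sumr -big_split /= mulr_sumr; apply: eq_bigr => s _.
  rewrite quad_shifted mon_shifted //; move: (quad (m a)) (quad (fun i : 'I_n => i%:Z)) => q q0.
  rewrite !rmorphD /= rmorphM /= rmorph_sum /=.
  have -> : \sum_i (m a i * s i)%:~R = \sum_i (s i)%:R * (m a i)%:~R :> C.
    by apply: eq_bigr => i _; rewrite intrM mulrC.
  move: (\sum_i _) (\prod_i _) ((-1) ^+ s) (mon _ _) => S p e M.
  by move: (q%:~R) (q0%:~R) => u v; ring.
rewrite V mulrCA; have -> : L a - c = ((quad (m a))%:~R - c) +
  2 * \sum_(i < n) \sum_(j < n | (i < j)%N)
        (z j * (m a j)%:~R - z i * (m a i)%:~R) / (z j - z i).
  rewrite [RHS]addrAC /L; congr (_ - _).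
  have -> : (quad (m a))%:~R = \sum_i (m a i)%:~R ^+ 2 - n.-1%:R * \sum_i (m a i)%:~R :> C.
    rewrite /quad rmorph_sum mulr_sumr -sumrB; apply: eq_bigr => i _ /=.
    by rewrite !expr2 intrB !intrM.
  rewrite -sum_pairs -addrA; congr (_ + _).
  rewrite sum_offdiag mulr_sumr addrC -sumrB; apply: eq_bigr => i _.
  rewrite mulr_sumr -sumrB; apply: eq_bigr => j ij.
  have ji : z j - z i != 0 by rewrite zij // -(inj_eq val_inj) gtn_eqF.
  have ij' : z i - z j != 0 by rewrite -opprB oppr_eq0.
  by rewrite !intrB; field; rewrite ji ij'.
by rewrite [RHS]mulrCA [vdm z * (_ + _)]mulrDr [_ * vdm z]mulrC.
Qed.

(** * The highest weight and the Weyl character formula *)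
(** A linear functional that every [E i j] with [i < j] decreases. *)
Definition ht (mu : 'I_n -> int) : int := \sum_(i < n) i%:Z * mu i.
Definition suffix (r : nat) (mu : 'I_n -> int) : int := \sum_(i < n | (r <= i)%N) mu i.

Definition below (mu lam : 'I_n -> int) :=
  [/\ forall r, suffix r mu <= suffix r lam, \sum_i mu i = \sum_i lam i & ht mu < ht lam].

Lemma sum_shift_one (P : pred 'I_n) (w : 'I_n -> int) (i j : 'I_n) mu nu :
  (forall k, mu k = nu k + (k == i)%:R - (k == j)%:R) ->
  \sum_(k | P k) w k * mu k = \sum_(k | P k) w k * nu k + w i * (P i)%:R - w j * (P j)%:R.
Proof.
move=> H; have delta (l : 'I_n) : \sum_(k | P k) w k * (k == l)%:R = w l * (P l)%:R.
  rewrite big_mkcond (bigD1 l) //= eqxx big1 ?addr0; first by case: (P l); rewrite ?mulr0.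
  by move=> k /negPf ->; rewrite mulr0 if_same.
rewrite -!delta -big_split -sumrB /=; apply: eq_bigr => k _.
by rewrite H mulrBr mulrDr.
Qed.

Lemma exists_highest : exists j0, forall a, ht (m a) <= ht (m j0).
Proof.
pose a0 := Ordinal d0; exists [arg max_(a > a0) ht (m a)]%O.
by case: Order.TotalTheory.arg_maxP => // j0 _ H a; apply: H.
Qed.

Section HighestWeight.
Variable j0 : 'I_d.
Hypothesis j0_max : forall a, ht (m a) <= ht (m j0).

Let v : 'cV[C]_d := delta_mx j0 0.

(** The submodule generated by the weight vector [v] of maximal height, built with
    lowering operators only: it is shown to be stable under all [E i j]. *)
Inductive lowered : 'cV[C]_d -> Prop :=
| lowered_hw : lowered v
| lowered_E (i j : 'I_n) u : (i < j)%N -> lowered u -> lowered (E i j *m u)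
| lowered_lin c u w : lowered u -> lowered w -> lowered (c *: u + w).

Lemma lowered0 : lowered 0.
Proof. by have := lowered_lin (-1) lowered_hw lowered_hw; rewrite scaleN1r addNr. Qed.

Lemma loweredD u w : lowered u -> lowered w -> lowered (u + w).
Proof. by move=> Hu Hw; have := lowered_lin 1 Hu Hw; rewrite scale1r. Qed.

Lemma loweredZ c u : lowered u -> lowered (c *: u).
Proof. by move=> Hu; have := lowered_lin c Hu lowered0; rewrite addr0. Qed.

Lemma raise_hw (i j : 'I_n) : (j < i)%N -> E i j *m v = 0.
Proof.
move=> ji; apply/matrixP => a b; rewrite [b]ord1 -colE !mxE.
apply/eqP; apply: contraT => nz; have H := E_weight nz.
have := j0_max a; rewrite /ht (sum_shift_one xpredT (fun i : 'I_n => i%:Z) H) /= !mulr1; lia.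
Qed.

(** An operator [E k l] is commuted past the lowering operators until it reaches
    [v], which it kills when it is raising. *)
Lemma lowered_stable i j u : lowered u -> lowered (E i j *m u).
Proof.
move=> Hu; elim: Hu i j => [k l|i j w ij Hw IH k l|c w w' _ IH _ IH' k l].
- have [kl|lk|/val_inj ->] := ltngtP k l.
  + exact: lowered_E lowered_hw.
  + by rewrite raise_hw //; exact: lowered0.
  have -> : E l l *m v = (m j0 l)%:~R *: v.
    rewrite Ediag /v; apply/matrixP => a b; rewrite mul_diag_mx !mxE.
    by case: eqP => [->|_] //=; rewrite !mulr0.
  exact: loweredZ lowered_hw.
- have -> : E k l *m (E i j *m w) = E i j *m (E k l *m w) +
      ((l == i)%:R *: (E k j *m w) + (- (j == k)%:R) *: (E i l *m w)).
    by rewrite !mulmxA !scalemxAl -mulmxDl scaleNr -Erel -mulmxDl addrC subrK.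
  apply: loweredD; first exact: lowered_E.
  by apply: lowered_lin => //; apply: loweredZ.
by rewrite mulmxDr -scalemxAr; apply: lowered_lin.
Qed.

Lemma lowered_all u : lowered u.
Proof.
have [W HW] := vspace_of_pred lowered0 lowered_lin.
have [i j w /HW ww|W0|Wf] := @Eirr W; first by apply/HW/lowered_stable.
- have : v \in W by apply/HW/lowered_hw.
  rewrite W0 memv0 => /eqP /matrixP /(_ j0 0); rewrite !mxE !eqxx => /eqP.
  by rewrite oner_eq0.
by apply/HW; rewrite Wf memvf.
Qed.

Lemma lowered_below u : lowered u -> forall a, u a 0 != 0 -> a = j0 \/ below (m a) (m j0).
Proof.
elim=> [a|i j w ij _ IH a|c w w' _ IH _ IH' a].
- rewrite !mxE andbT; case: (a =P j0) => [->|_]; first by left.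
  by rewrite eqxx.
- rewrite mxE => nz; have [b nzb] : exists b, E i j a b * w b 0 != 0.
    apply/existsP; apply: contraNT nz => /existsPn H.
    by rewrite big1 // => b _; apply/eqP; rewrite -[_ == _]negbK H.
  move: nzb; rewrite mulf_eq0 negb_or => /andP [nzE nzw]; right.
  have H := E_weight nzE.
  have below_b : (forall r, suffix r (m b) <= suffix r (m j0)) /\
     \sum_i m b i = \sum_i m j0 i /\ ht (m b) <= ht (m j0).
    by case: (IH b nzw) => [->|[h1 h2 /ltW h3]].
  case: below_b => h1 [h2 h3]; split.
  + move=> r; have := h1 r; apply: le_trans.
    have := sum_shift_one (fun k : 'I_n => (r <= k)%N) (fun=> 1) H.
    under eq_bigr do rewrite mul1r; under [X in _ = X + _ - _]eq_bigr do rewrite mul1r.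
    rewrite !mul1r -!/(suffix _ _) => ->; rewrite -addrA gerDl subr_le0 ler_nat.
    by case ri: (r <= i)%N => //; rewrite (leq_trans ri (ltnW ij)).
  + have := sum_shift_one xpredT (fun=> 1) H.
    under eq_bigr do rewrite mul1r; under [X in _ = X + _ - _]eq_bigr do rewrite mul1r.
    by rewrite !mul1r /= addrK h2.
  have -> : ht (m a) = ht (m b) + i%:Z - j%:Z.
    by rewrite /ht (sum_shift_one xpredT (fun i : 'I_n => i%:Z) H) /= !mulr1.
  by move: h3 ij; lia.
rewrite !mxE => nz; have [w0|w0] := eqVneq (w a 0) 0; last exact: IH.
by apply: IH'; move: nz; rewrite w0 mulr0 add0r.
Qed.

(** The vector of index [j0] has multiplicity one, and every other weight arises
    from its weight by lowering. *)
Lemma weight_below a : a = j0 \/ below (m a) (m j0).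
Proof.
by apply: (lowered_below (lowered_all (delta_mx a 0))); rewrite mxE !eqxx oner_eq0.
Qed.

End HighestWeight.

(** The coefficient of the monomial of exponent [mu] in the product of [vdm] and
    [chi]. *)
Definition coef (mu : {ffun 'I_n -> int}) : C := \sum_(p | shifted p == mu) (-1) ^+ p.2.

Lemma coef_quad : exists c : C, forall mu, coef mu != 0 -> (quad mu)%:~R = c.
Proof.
have [c H] := laplace_eigen; exists c => mu nz.
have := mon_independent (k := fun p : 'I_d * 'S_n =>
  (-1) ^+ p.2 * ((quad (shifted p))%:~R - c)) (e := shifted) H mu.
under eq_bigr => p /eqP -> do idtac.
rewrite -mulr_suml => /eqP; rewrite mulf_eq0 -/(coef mu) (negPf nz) /= subr_eq0.
by move=> /eqP.
Qed.

Definition chi_symmetric := forall (s : 'S_n) (z : 'I_n -> C),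
  (forall i, `|z i| = 1) -> chi (fun i => z (s i)) = chi z.

Lemma chi_vdm (z : 'I_n -> C) : (forall i, z i != 0) ->
  \sum_(p : 'I_d * 'S_n) (-1) ^+ p.2 * mon z (shifted p) = vdm z * chi z.
Proof.
move=> z0; rewrite -(pair_bigA _ (fun a (s : 'S_n) => (-1) ^+ s * mon z (shifted (a, s)))) /=.
rewrite /chi mulr_sumr; apply: eq_bigr => a _.
rewrite [vdm z](vdm_det z) mulr_suml; apply: eq_bigr => s _.
by rewrite mon_shifted // mulrCA mulrC.
Qed.

Hypothesis chi_sym : chi_symmetric.

Lemma mon_perm (s : 'S_n) (z : 'I_n -> C) (e : {ffun 'I_n -> int}) :
  mon (fun i => z (s i)) [ffun i => e (s i)] = mon z e.
Proof.
rewrite /mon [RHS](reindex_inj (@perm_inj _ s)) /=.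
by apply: eq_bigr => i _; rewrite ffunE.
Qed.

Lemma vdm_perm (s : 'S_n) (z : 'I_n -> C) : vdm (fun i => z (s i)) = (-1) ^+ s * vdm z.
Proof.
rewrite [LHS](vdm_det (fun i => z (s i))) [vdm z](vdm_det z) mulr_sumr.
rewrite (reindex_inj (mulgI s)) /=; apply: eq_bigr => t _.
rewrite odd_permM signr_addb mulrA; congr (_ * _).
rewrite [RHS](reindex_inj (@perm_inj _ s)) /=.
by apply: eq_bigr => i _; rewrite permM.
Qed.

(** The product of the alternating [vdm] and the symmetric [chi] is alternating;
    independence of monomials transfers this to the coefficients. *)
Lemma coef_perm (s : 'S_n) (mu : {ffun 'I_n -> int}) : coef [ffun i => mu (s i)] = (-1) ^+ s * coef mu.
Proof.
pose K (q : ('I_d * 'S_n) + ('I_d * 'S_n)) : C :=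
  match q with inl p => (-1) ^+ s * (-1) ^+ p.2 | inr p => - (-1) ^+ p.2 end.
pose e (q : ('I_d * 'S_n) + ('I_d * 'S_n)) : {ffun 'I_n -> int} :=
  match q with inl p => [ffun i => shifted p (s i)] | inr p => shifted p end.
have H z : (forall i, `|z i| = 1) -> injective z -> \sum_q K q * mon z (e q) = 0.
  move=> z1 _; have z0 i : z i != 0 by rewrite -normr_gt0 z1.
  rewrite big_sumType /=.
  have -> : \sum_(p : 'I_d * 'S_n) (-1) ^+ s * (-1) ^+ p.2 * mon z [ffun i => shifted p (s i)] =
      (-1) ^+ s * (vdm (fun i => z (s^-1%g i)) * chi (fun i => z (s^-1%g i))).
    rewrite -chi_vdm; last by move=> i.
    rewrite mulr_sumr; apply: eq_bigr => p _; rewrite -mulrA; congr (_ * (_ * _)).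
    rewrite -(mon_perm s); apply: eq_bigr => i _; congr (_ ^ _).
    by rewrite permK.
  rewrite chi_sym // vdm_perm odd_permV mulrA mulrA -signr_addb addbb mul1r -chi_vdm //.
  by under [X in _ + X]eq_bigr do rewrite mulNr; rewrite sumrN subrr.
have := mon_independent H [ffun i => mu (s i)].
rewrite big_mkcond big_sumType /= -!big_mkcond /= sumrN.
move/eqP; rewrite subr_eq0 => /eqP E1; rewrite /coef -E1 mulr_sumr.
apply: eq_bigl => p; apply/eqP/eqP => [/ffunP Ef|-> //].
by apply/ffunP => i; have := Ef (s^-1%g i); rewrite !ffunE permKV.
Qed.

Lemma coef_inj mu : coef mu != 0 -> injective mu.
Proof.
move=> nz i j Eij; apply/eqP; apply: contraNT nz => ij.
have := coef_perm (tperm i j) mu; rewrite odd_tperm ij expr1 mulN1r.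
have -> : [ffun k => mu (tperm i j k)] = mu.
  by apply/ffunP => k; rewrite ffunE; case: tpermP => [->|->|].
move/eqP; rewrite -subr_eq0 opprK -mulr2n mulrn_eq0 /= => /eqP ->.
by rewrite eqxx.
Qed.

Lemma coef_neq0P mu : coef mu != 0 -> exists p, shifted p = mu.
Proof.
move=> nz; case: (pickP (fun p => shifted p == mu)) => [p /eqP Ep|N]; first by exists p.
by move: nz; rewrite /coef big_pred0 ?eqxx.
Qed.

(** The values outside the suffix are smaller than those inside, so exchanging
    some of them can only decrease the sum. *)
Lemma suffix_perm (s : 'S_n) r :
  \sum_(i < n | (r <= i)%N) (s i)%:Z <= \sum_(i < n | (r <= i)%N) i%:Z.
Proof.
pose U := [set i : 'I_n | (r <= i)%N]; pose T := [set s i | i in U].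
have ET : \sum_(i < n | (r <= i)%N) (s i)%:Z = \sum_(t in T) (nat_of_ord t)%:Z.
  rewrite big_imset /=; last by move=> a b _ _; apply: perm_inj.
  by apply: eq_bigl => i; rewrite inE.
have EU : \sum_(i < n | (r <= i)%N) i%:Z = \sum_(t in U) (nat_of_ord t)%:Z.
  by apply: eq_bigl => i; rewrite inE.
have cTU : #|T :\: U| = #|U :\: T|.
  by apply/eqP; rewrite -(eqn_add2l #|T :&: U|) cardsID finset.setIC cardsID card_imset //; apply: perm_inj.
rewrite ET EU (big_setID U) [X in _ <= X](big_setID T) /= finset.setIC lerD2l.
apply: (@le_trans _ _ (\sum_(t in T :\: U) r%:Z)).
  apply: ler_sum => t; rewrite !inE -ltnNge => /andP [/ltnW tr _].
  by rewrite lez_nat.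
rewrite sumr_const cTU -sumr_const; apply: ler_sum => t; rewrite !inE => /andP [_ rt].
by rewrite lez_nat.
Qed.

(** Rearrangement inequality: the difference of the two sides is half the sum of
    the squares [(s i - i)^2]. *)
Lemma ht_perm (s : 'S_n) : s != 1%g -> ht (fun i => (s i)%:Z) < ht (fun i : 'I_n => i%:Z).
Proof.
move=> s1; have Hsq : \sum_i ((s i)%:Z - i%:Z) ^+ 2 =
    2 * (ht (fun i : 'I_n => i%:Z) - ht (fun i => (s i)%:Z)).
  have Esq : \sum_(i < n) (s i)%:Z ^+ 2 = \sum_(i < n) i%:Z ^+ 2.
    by rewrite [RHS](reindex_inj (@perm_inj _ s)).
  rewrite /ht -sumrB mulr_sumr.
  transitivity (\sum_(i < n) (s i)%:Z ^+ 2 + \sum_(i < n) (i%:Z ^+ 2 - 2 * i%:Z * (s i)%:Z)).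
    by rewrite -big_split; apply: eq_bigr => i _ /=; ring.
  by rewrite Esq -big_split; apply: eq_bigr => i _ /=; ring.
have [i si] : exists i, s i != i.
  apply/existsP; apply: contraNT s1 => /existsPn H.
  by apply/eqP/permP => i; rewrite perm1; apply/eqP; rewrite -[_ == _]negbK H.
have : 0 < \sum_i ((s i)%:Z - i%:Z) ^+ 2.
  rewrite (bigD1 i) //= ltr_wpDr ?sumr_ge0 //; first by move=> k _; rewrite sqr_ge0.
  by rewrite exprn_even_gt0 //= subr_eq0 eqz_nat (inj_eq val_inj).
by rewrite Hsq pmulr_rgt0 // subr_gt0.
Qed.

(** Summation by parts writes the sum as a combination of the nonnegative suffix
    sums of [f] with the positive coefficients [x_i - x_(i-1)] (and [x_0 - c]). *)
Lemma abel_eq0 k (f x : 'I_k -> int) (c : int) :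
  (forall r, 0 <= \sum_(i < k | (r <= i)%N) f i) ->
  (forall i j : 'I_k, (i < j)%N -> x i < x j) -> (forall i, c < x i) ->
  \sum_i f i * (x i - c) <= 0 -> forall i, f i = 0.
Proof.
elim: k f x c => [f x c _ _ _ _ []//|k IH f x c f0 xS cx H].
have S0 := f0 0%N; rewrite big_ord_recl /= in S0 *.
set S := \sum_(i < k) f (lift ord0 i) in S0.
have Ef : \sum_i f i * (x i - c) = (f ord0 + S) * (x ord0 - c) +
    \sum_(i < k) f (lift ord0 i) * (x (lift ord0 i) - x ord0).
  rewrite big_ord_recl mulrDl -addrA; congr (_ + _); rewrite mulr_suml -big_split /=.
  by apply: eq_bigr => i _; ring.
have c0 : 0 < x ord0 - c by rewrite subr_gt0.
have fl : forall i, f (lift ord0 i) = 0.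
  apply: (IH _ (fun i => x (lift ord0 i)) (x ord0)).
  - move=> r; have := f0 r.+1; rewrite big_mkcond big_ord_recl /= add0r -big_mkcond.
    by congr (0 <= _); apply: eq_bigl => i; rewrite /bump /= add1n ltnS.
  - by move=> i j ij; apply: xS; rewrite /= /bump /= !add1n ltnS.
  - by move=> i; apply: xS.
  by move: H; rewrite Ef; nra.
have SE : S = 0 by rewrite /S big1.
move=> i; have [j ->|->] := unliftP ord0 i; first exact: fl.
have : \sum_(j < k) f (lift ord0 j) * (x (lift ord0 j) - x ord0) = 0.
  by rewrite big1 // => j _; rewrite fl mul0r.
by move: H; rewrite Ef SE => H1 H2; move: H1 S0; rewrite H2 SE; nra.
Qed.

(** The alternating coefficients are determined by those at strictly increasing
    exponents [mu].  Such an exponent is dominated by [l], the highest weight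
    shifted by [i |-> i], and has the same eigenvalue [quad mu = quad l].  As
    [quad l - quad mu = \sum_i (l_i - mu_i) (l_i + mu_i - (n - 1))], with strictly
    increasing second factors, summation by parts forces [mu = l].  The numerator
    is thus the alternant of [l], whose leading coefficient is 1 because the
    highest weight has multiplicity one. *)
Theorem weyl_formula : exists2 l : 'I_n -> int,
  forall i j : 'I_n, (i < j)%N -> l i < l j &
  forall z : 'I_n -> C, (forall i, `|z i| = 1) ->
    vdm z * chi z = \det (\matrix_(i, j) z j ^ l i).
Proof.
have [j0 j0_max] := exists_highest.
have wb := weight_below j0_max.
pose l : {ffun 'I_n -> int} := [ffun i => m j0 i + i%:Z].
have htl a (s : 'S_n) : ht (shifted (a, s)) = ht (m a) + ht (fun i => (s i)%:Z).
  by rewrite /ht -big_split; apply: eq_bigr => i _; rewrite ffunE /= mulrDr.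
have El : shifted (j0, 1%g) = l by apply/ffunP => i; rewrite !ffunE perm1.
have ht1 : ht (fun i => ((1%g : 'S_n) i)%:Z) = ht (fun i : 'I_n => i%:Z).
  by apply: eq_bigr => i _; rewrite perm1.
have htmax p : ht (shifted p) <= ht l ?= iff (p == (j0, 1%g)).
  apply/leifP; case: eqP => [->|]; first by rewrite El.
  case: p => a s Np; rewrite -El !htl ht1.
  have [s1|s1] := eqVneq s 1%g.
    rewrite s1 in Np *; rewrite ht1 ltrD2r.
    by case: (wb a) => [aj|[]//]; rewrite aj in Np.
  by rewrite ler_ltD // ht_perm.
have coefl : coef l = 1.
  rewrite /coef (bigD1 (j0, 1%g)) ?El //= odd_perm1 expr0 big1 ?addr0 //.
  by move=> p /andP [/eqP pl /negPf pN]; have := (htmax p).2; rewrite pl eqxx pN.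
(* Exchanging a decreasing pair of entries of [l] would give an exponent of the
   numerator of larger height. *)
have lS (i j : 'I_n) : (i < j)%N -> l i < l j.
  move=> ij; have linj := @coef_inj l; rewrite coefl oner_eq0 in linj.
  have nij : i != j by rewrite -(inj_eq val_inj) /= ltn_eqF.
  rewrite ltNge; apply/negP => lji.
  have lt : l j < l i by rewrite lt_neqAle lji andbT (inj_eq (linj isT)) eq_sym.
  pose s := tperm i j; pose mu := [ffun k => l (s k)].
  have : coef mu != 0 by rewrite coef_perm coefl mulr1 signr_eq0.
  move=> /coef_neq0P [p Ep]; have := (htmax p).1; rewrite Ep.
  have -> : ht mu = ht l + (j%:Z - i%:Z) * (l i - l j).
    rewrite /ht (bigD1 i) // (bigD1 j) 1?eq_sym //= [X in _ = X + _](bigD1 i) //.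
    rewrite [X in _ = _ + X + _](bigD1 j) 1?eq_sym //= !ffunE /s tpermL tpermR.
    rewrite (eq_bigr (fun k : 'I_n => k%:Z * l k)); last first.
      by move=> k /andP [ki kj]; rewrite ffunE tpermD // eq_sym.
    by ring.
  have : 0 < (j%:Z - i%:Z) * (l i - l j) by rewrite mulr_gt0 ?subr_gt0 // ltz_nat.
  by lia.
have [c Hc] := coef_quad.
have uniq_l mu : coef mu != 0 -> (forall i j : 'I_n, (i < j)%N -> mu i < mu j) -> mu = l.
  move=> nz muS; have [[a s] Ep] := coef_neq0P nz.
  have quadE : quad mu = quad l.
    by apply: (mulrIz (oner_neq0 C)); rewrite (Hc _ nz) Hc ?coefl ?oner_eq0.
  have suf r : 0 <= \sum_(i < n | (r <= i)%N) (l i - mu i).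
    rewrite -Ep sumrB subr_ge0.
    under eq_bigr do rewrite ffunE /=; under [X in _ <= X]eq_bigr do rewrite ffunE /=.
    rewrite !big_split /= lerD ?suffix_perm //.
    by case: (wb a) => [-> //|[h _ _]]; apply: h.
  have tot : \sum_i (l i - mu i) = 0.
    rewrite -Ep sumrB; under eq_bigr do rewrite ffunE /=.
    under [X in _ - X]eq_bigr do rewrite ffunE /=.
    rewrite !big_split /=.
    have -> : \sum_(i < n) (s i)%:Z = \sum_(i < n) i%:Z.
      by rewrite [RHS](reindex_inj (@perm_inj _ s)).
    by case: (wb a) => [->|[_ -> _]]; rewrite subrr.
  (* The constant [c0] only makes all [x i - c0] positive: the entries of [l - mu]
     sum to 0, so constants do not matter. *)
  pose x i := l i + mu i; pose c0 : int := - (\sum_i `|x i|) - 1.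
  have cx i : c0 < x i.
    have : `|x i| <= \sum_i `|x i| by rewrite (bigD1 i) //= lerDl sumr_ge0.
    by rewrite /c0; lia.
  have xS (i j : 'I_n) : (i < j)%N -> x i < x j by move=> ij; rewrite ltrD ?lS ?muS.
  have := abel_eq0 suf xS cx; have -> : \sum_i (l i - mu i) * (x i - c0) = 0.
    transitivity (quad l - quad mu + (n.-1%:Z - c0) * \sum_i (l i - mu i)).
      rewrite mulr_sumr /quad -sumrB -big_split; apply: eq_bigr => i _ /=.
      by rewrite /x; ring.
    by rewrite tot mulr0 addr0 quadE subrr.
  move=> /(_ (lexx 0)) fl; apply/ffunP => i; apply/esym/eqP.
  by rewrite -subr_eq0 fl.
have linj : injective l by apply: coef_inj; rewrite coefl oner_eq0.
exists l => // z z1; have z0 i : z i != 0 by rewrite -normr_gt0 z1.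
rewrite -chi_vdm // -det_tr.
have -> : \det (\matrix_(i, j) z j ^ l i)^T =
    \sum_(s : 'S_n) (-1) ^+ s * mon z [ffun i => l (s i)].
  apply: eq_bigr => s _; congr (_ * _); apply: eq_bigr => i _.
  by rewrite !mxE ffunE.
(* The difference of the two sides as one combination of monomials, all of whose
   collected coefficients vanish. *)
pose K (q : ('I_d * 'S_n) + 'S_n) : C :=
  match q with inl p => (-1) ^+ p.2 | inr s => - (-1) ^+ s end.
pose e (q : ('I_d * 'S_n) + 'S_n) : {ffun 'I_n -> int} :=
  match q with inl p => shifted p | inr s => [ffun i => l (s i)] end.
have H mu : \sum_(q | e q == mu) K q = 0.
  rewrite big_mkcond big_sumType /= -!big_mkcond /= sumrN -/(coef mu).
  have [/existsP [s0 /eqP <-]|N] := boolP [exists s0 : 'S_n, [ffun i => l (s0 i)] == mu].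
    rewrite coef_perm coefl mulr1 (bigD1 s0) //= big1 ?addr0 ?subrr // => s /andP [/eqP /ffunP sE /eqP ns].
    by case: ns; apply/permP => i; apply: linj; have := sE i; rewrite !ffunE.
  rewrite [X in _ - X]big_pred0; last first.
    by move=> s; apply/negbTE; move/existsPn: N; apply.
  rewrite subr0; apply/eqP; apply: contraNT N => nz.
  have [s sS] := exists_sorting_perm mu.
  have nzs : coef [ffun i => mu (s i)] != 0 by rewrite coef_perm mulf_neq0 ?signr_eq0.
  have := uniq_l _ nzs; move=> El'; apply/existsP; exists s^-1%g; apply/eqP/ffunP => i.
  rewrite -El' => [|a b ab]; first by rewrite !ffunE permKV.
  rewrite !ffunE lt_neqAle sS ?(ltnW ab) // andbT (inj_eq (coef_inj nz)).
  by rewrite (inj_eq perm_inj) -(inj_eq val_inj) ltn_eqF.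
have := mon_comb_eq0 H z; rewrite big_sumType /=.
under [X in _ + X]eq_bigr do rewrite mulNr.
by rewrite sumrN => /eqP; rewrite subr_eq0 => /eqP.
Qed.

End GlnModule.

Local Open Scope complex_scope.

(** * Continuous characters of the circle *)

Section Circle.
Variable R : realType.
Local Notation C := R[i].
Implicit Types (x y : R) (w u : C).

Definition cis x : C := cos x +i* sin x.

Lemma cis0 : cis 0 = 1.
Proof. by rewrite /cis cos0 sin0. Qed.

Lemma cisD x y : cis (x + y) = cis x * cis y.
Proof. by rewrite /cis cosD sinD; simpc; congr (_ +i* _); ring. Qed.

Lemma cisMn x n : cis (x *+ n) = cis x ^+ n.
Proof. by elim: n => [|n IHn]; rewrite ?cis0 // mulrS cisD IHn exprS. Qed.

Lemma norm_cis x : `|cis x| = 1.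
Proof. by rewrite normc_def /= cos2Dsin2 sqrtr1. Qed.

Lemma cisN x : cis (- x) = (cis x)^-1.
Proof.
apply: (mulfI (x := cis x)); first by rewrite -normr_gt0 norm_cis.
by rewrite -cisD subrr cis0 divff // -normr_gt0 norm_cis.
Qed.

Lemma cisMz x (m : int) : cis (x *~ m) = cis x ^ m.
Proof. by case: m => n; rewrite ?cisMn // NegzE mulrNz cisN -exprnN cisMn. Qed.

Lemma pi2_gt0 : 0 < pi *+ 2 :> R.
Proof. by rewrite pmulrn_lgt0 ?pi_gt0. Qed.

Lemma pi2_ge0 : 0 <= pi *+ 2 :> R. Proof. exact: ltW pi2_gt0. Qed.

Lemma cis_surj w : `|w| = 1 -> exists2 x, 0 <= x <= pi *+ 2 & w = cis x.
Proof.
case: w => a b; rewrite normc_def /= => /complexI E.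
have E2 : a ^+ 2 + b ^+ 2 = 1.
  by rewrite -[LHS]sqr_sqrtr ?E ?expr1n // addr_ge0 ?sqr_ge0.
have a1 : -1 <= a <= 1.
  by rewrite -ler_norml -(@expr_le1 _ 2) // ?normr_ge0// real_normK ?num_real// -E2 lerDl sqr_ge0.
have Eb : Num.sqrt (1 - a ^+ 2) = `|b| by rewrite -E2 addrAC subrr add0r sqrtr_sqr.
have [b0|b0] := leP 0 b.
  exists (acos a).
    by rewrite acos_ge0 //= (le_trans (acos_lepi _)) // mulr2n lerDl pi_ge0.
  by rewrite /cis acosK ?in_itv // sin_acos // Eb ger0_norm.
exists (pi *+ 2 - acos a).
  by rewrite subr_ge0 (le_trans (acos_lepi _)) ?mulr2n ?lerDl ?pi_ge0 //= gerBl acos_ge0.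
rewrite addrC /cis cosD2pi sinD2pi cosN sinN acosK ?in_itv // sin_acos // Eb.
by rewrite ltr0_norm ?opprK.
Qed.

Lemma posC_Re (e : C) : 0 < e -> e = (complex.Re e)%:C /\ 0 < complex.Re e.
Proof. by case: e => a b; rewrite ltcE /= => /andP [/eqP -> ->]. Qed.

Lemma cis_near1 (e : C) : 0 < e ->
  exists2 h : R, 0 < h & forall x, `|x| < h -> `|cis x - 1| <= e.
Proof.
move=> /posC_Re [-> e0]; set r := complex.Re e in e0 *.
have r2 : 0 < r / 2 by rewrite divr_gt0.
have /cvgrPdist_le /(_ _ r2) := @continuous_cos R 0.
rewrite cos0 => /nbhs_ballP [h1 /= h10 H1].
have /cvgrPdist_le /(_ _ r2) := @continuous_sin R 0.
rewrite sin0 => /nbhs_ballP [h2 /= h20 H2].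
exists (Num.min h1 h2) => [|x]; first by rewrite lt_min h10.
rewrite lt_min => /andP [x1 x2].
have := H1 x; rewrite /ball /= sub0r normrN => /(_ x1) c1.
have := H2 x; rewrite /ball /= !sub0r !normrN => /(_ x2) s1.
have -> : cis x - 1 = (cos x - 1)%:C + (sin x)%:C * 'i.
  by rewrite /cis; simpc.
apply: le_trans (ler_normD _ _) _; rewrite normrM.
have -> : `|'i : C| = 1 by rewrite normc_def /= expr0n /= add0r expr1n sqrtr1.
rewrite mulr1 !normc_def /= expr0n /= !addr0 !sqrtr_sqr -rmorphD lecR distrC; lra.
Qed.

(** Arguments are at most [2 pi], so a single [N] serves all [w]. *)
Lemma circle_roots_near1 (e : C) : 0 < e -> exists2 N : nat, (0 < N)%N &
  forall w, `|w| = 1 -> exists u, [/\ `|u| = 1, u ^+ N = w & `|u - 1| <= e].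
Proof.
move=> /cis_near1 [h h0 H]; pose N := (Num.bound (pi *+ 2 / h)).+1.
have hN : (pi *+ 2 / h) < N%:R.
  apply: lt_trans (archi_boundP _) _; last by rewrite ltr_nat.
  by rewrite divr_ge0 ?pi2_ge0 // ltW.
exists N => // w /cis_surj [x /andP [x0 x1] ->]; exists (cis (x / N%:R)).
have N0 : (0 : R) < N%:R by rewrite ltr0n.
split; first exact: norm_cis.
  by rewrite -cisMn -[X in cis X]mulr_natr divfK // gt_eqF.
apply: H; rewrite ger0_norm ?divr_ge0 // ?ltW // ltr_pdivrMr //.
by apply: le_lt_trans x1 _; rewrite mulrC -ltr_pdivrMr.
Qed.

Definition zeta k : C := cis (pi *+ 2 / 2 ^+ k).

Lemma zeta0 : zeta 0 = 1.
Proof. by rewrite /zeta expr0 divr1 /cis cos2pi sin2pi. Qed.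

Lemma zeta1 : zeta 1 = -1.
Proof.
rewrite /zeta expr1 -[pi *+ 2]mulr_natr mulfK ?pnatr_eq0 // /cis cospi sinpi.
by apply/eqP; rewrite eq_complex /= oppr0 !eqxx.
Qed.

Lemma zetaS k : zeta k.+1 ^+ 2 = zeta k.
Proof.
rewrite -cisMn; congr cis; rewrite exprS invfM mulrA mulrAC -[LHS]mulr_natr.
by rewrite divfK ?pnatr_eq0.
Qed.

Lemma zetaX k : zeta k ^+ (2 ^ k) = 1.
Proof. by elim: k => [|k IHk]; rewrite ?zeta0 ?expr1n // expnS exprM zetaS. Qed.

Lemma norm_zeta k : `|zeta k| = 1. Proof. exact: norm_cis. Qed.

Lemma zeta_prim k : (2 ^ k).-primitive_root (zeta k).
Proof.
case: k => [|k]; first by apply/andP; split=> //; apply/forallP => i; rewrite ord1 unity_rootE zeta0 expr1n !eqxx.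
have zN1 j : zeta j.+1 ^+ (2 ^ j) = -1.
  by elim: j => [|j IHj]; rewrite ?zeta1 // expnS exprM zetaS.
have [m mP mdvd] := prim_order_exists (expn_gt0 2 k.+1) (zetaX k.+1).
have /dvdn_pfactor : (m %| 2 ^ k.+1)%N by [].
case/(_ isT) => j jk Em; move: jk; rewrite leq_eqVlt => /orP [/eqP Ej|]; first by move: mP; rewrite Em Ej.
rewrite ltnS => jk; have := zN1 k.
have -> : (2 ^ k = m * 2 ^ (k - j))%N by rewrite Em -expnD subnKC.
rewrite exprM (prim_expr_order mP) expr1n => /eqP.
by rewrite -subr_eq0 opprK -(natrD _ 1 1) pnatr_eq0.
Qed.

Lemma dyadic_near (e : C) : 0 < e -> exists K, forall k, (K <= k)%N ->
  forall w, `|w| = 1 ->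
  exists q u, [/\ `|u| = 1, w = zeta k ^+ q * u & `|u - 1| <= e].
Proof.
move=> /cis_near1 [h h0 H]; exists (Num.bound (pi *+ 2 / h)) => k Kk w.
have pi2 := pi2_gt0.
have k2 : 0 < 2 ^+ k :> R by rewrite exprn_gt0.
have hk : pi *+ 2 / 2 ^+ k < h.
  rewrite ltr_pdivrMr // mulrC -ltr_pdivrMr //.
  apply: lt_le_trans (archi_boundP _) _; first by rewrite divr_ge0 ?ltW.
  by rewrite -natrX ler_nat (leq_trans Kk) // ltnW // ltn_expl.
move=> /cis_surj [x /andP [x0 _] ->].
have y0 : 0 <= x / (pi *+ 2 / 2 ^+ k) by apply: divr_ge0 => //; rewrite ltW ?divr_gt0.
have /andP [] := truncn_itv y0; set q := Num.truncn _.
rewrite ler_pdivlMr ?divr_gt0 // ltr_pdivrMr ?divr_gt0 // => q1 q2.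
exists q, (cis (x - q%:R * (pi *+ 2 / 2 ^+ k))); split; first exact: norm_cis.
  by rewrite /zeta -cisMn -cisD -[_ *+ q]mulr_natl addrC subrK.
apply: H; rewrite ger0_norm ?subr_ge0 //; apply: lt_trans hk.
by rewrite ltrBlDl; move: q2; rewrite -[q.+1]addn1 natrD mulrDl mul1r.
Qed.

(** This tells apart the two square roots of a power of a root of unity. *)
Lemma zetaz_Re_ge0 k (m : int) : (`|m| * 4 <= 2 ^ k)%N -> 0 <= complex.Re (zeta k ^ m).
Proof.
move=> mk; rewrite /zeta -cisMz /=; apply: cos_ge0_pihalf.
have k2 : 0 < 2 ^+ k :> R by rewrite exprn_gt0.
have A : 0 <= pi *+ 2 / 2 ^+ k :> R by rewrite divr_ge0 ?pi2_ge0 ?exprn_ge0.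
rewrite -ler_norml -mulrzr normrM (ger0_norm A).
rewrite mulrAC ler_pdivrMr // -[pi *+ 2]mulr_natr -!mulrA ler_pM2l ?pi_gt0 //.
have : (`|m|%N%:R * 4 <= 2 ^+ k :> R) by rewrite -natrM -natrX ler_nat.
by rewrite -[`|m%:~R|]intr_norm -abszE; lra.
Qed.

Lemma norm_unit_exprz w (m : int) : `|w| = 1 -> `|w ^ m| = 1.
Proof.
move=> w1; case: m => n; first by rewrite -exprnP normrX w1 expr1n.
by rewrite NegzE -exprnN normfV normrX w1 expr1n invr1.
Qed.

Lemma unit_exprz_sub1 w (m : int) : `|w| = 1 -> `|w ^ m - 1| <= `|m|%:~R * `|w - 1|.
Proof.
move=> w1; have w0 : w != 0 by rewrite -normr_gt0 w1.
have nat_case n : `|w ^+ n - 1| <= n%:R * `|w - 1|.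
  elim: n => [|n IHn]; first by rewrite subrr normr0 mul0r.
  have -> : w ^+ n.+1 - 1 = w * (w ^+ n - 1) + (w - 1) by rewrite exprS; ring.
  apply: le_trans (ler_normD _ _) _; rewrite normrM w1 mul1r.
  by rewrite -[n.+1]addn1 natrD mulrDl mul1r lerD2r.
case: m => n; first exact: nat_case.
rewrite NegzE -exprnN normrN; have -> : w ^- n.+1 - 1 = - (w ^- n.+1 * (w ^+ n.+1 - 1)).
  by rewrite mulrBr mulVf ?expf_neq0 // mulr1 opprB.
by rewrite normrN normrM normfV normrX w1 expr1n invr1 mul1r; exact: nat_case.
Qed.

Lemma minC_gt0 (a b : C) : 0 < a -> 0 < b -> exists c, [/\ 0 < c, c <= a & c <= b].
Proof.
move=> /posC_Re [-> a0] /posC_Re [-> b0].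
exists (Num.min (complex.Re a) (complex.Re b))%:C.
by rewrite ltcR !lecR lt_min a0 b0 !ge_min !lexx orbT.
Qed.

Lemma norm_small_eq0 (V : normedZmodType C) (v : V) :
  (forall e : C, 0 < e -> `|v| <= e) -> v = 0.
Proof.
move=> H; apply/eqP; rewrite -normr_eq0; apply: contraT => v0.
have v1 : 0 < `|v| by rewrite lt_neqAle eq_sym v0 normr_ge0.
have := H (`|v| / 2) (divr_gt0 v1 (ltr0Sn _ _)).
by rewrite ler_pdivlMr ?ltr0n // mulr_natr mulr2n gerDr normr_le0 -normr_eq0 (negPf v0).
Qed.

Local Opaque zeta.

(** Roots of unity of order [2^K] go to roots of unity of the same order, so
    [phi (zeta K) = zeta K ^ m] with [|m| <= 2^(K-1)].  Each further square root
    is determined up to sign, and near 1 the sign is forced by continuity and by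
    the bound on [m].  Dyadic roots of unity are dense in the circle. *)
Theorem circle_char (phi : C -> C) :
  phi 1 = 1 -> (forall w u, `|w| = 1 -> `|u| = 1 -> phi (w * u) = phi w * phi u) ->
  (forall e : C, 0 < e -> exists2 h, 0 < h & forall w, `|w| = 1 ->
     `|w - 1| <= h -> `|phi w - 1| <= e) ->
  exists m : int, forall w, `|w| = 1 -> phi w = w ^ m.
Proof.
move=> phi1 phiM phic.
have phiX w n : `|w| = 1 -> phi (w ^+ n) = phi w ^+ n.
  move=> w1; elim: n => [|n IHn] //; rewrite !exprS phiM ?IHn //.
  by rewrite normrX w1 expr1n.
have half0 : 0 < 2^-1 :> C by rewrite invr_gt0 ltr0n.
have [h h0 Hh] := phic _ half0.
have [K HK] : exists K, forall k, (K <= k)%N -> `|zeta k - 1| <= h.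
  have [h' h'0 H'] := cis_near1 h0; exists (Num.bound (pi *+ 2 / h')) => k Kk.
  apply: H'; rewrite ger0_norm ?divr_ge0 ?pi2_ge0 ?exprn_ge0 //.
  rewrite ltr_pdivrMr ?exprn_gt0 // mulrC -ltr_pdivrMr //.
  apply: lt_le_trans (archi_boundP _) _; first by rewrite divr_ge0 ?pi2_ge0 ?ltW.
  by rewrite -natrX ler_nat (leq_trans Kk) // ltnW // ltn_expl.
have z0 k : zeta k != 0 by rewrite -normr_gt0 norm_zeta.
have phizX : phi (zeta K) ^+ (2 ^ K) = 1 by rewrite -phiX ?norm_zeta // zetaX.
have [i Ei] := prim_rootP (zeta_prim K) phizX.
have [m mK Em] : exists2 m : int, (`|m| * 2 <= 2 ^ K)%N & phi (zeta K) = zeta K ^ m.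
  have [iK|iK] := leqP (i * 2) (2 ^ K); first by exists i.
  exists (i%:Z - (2 ^ K)%N%:Z); first by have := ltn_ord i; lia.
  by rewrite expfzDr // -exprnN zetaX invr1 mulr1.
have phiz k : (K <= k)%N -> phi (zeta k) = zeta k ^ m.
  elim: k => [|k IHk]; first by rewrite leqn0 => /eqP <-.
  rewrite leq_eqVlt => /orP [/eqP <- //|]; rewrite ltnS => Kk.
  have : phi (zeta k.+1) ^+ 2 = (zeta k.+1 ^ m) ^+ 2.
    rewrite -(phiX _ 2 (norm_zeta k.+1)) zetaS (IHk Kk) -(zetaS k).
    exact: exprzAC (zeta k.+1) 2 m.
  move=> /eqP; rewrite eqf_sqr => /orP [/eqP //|/eqP Eneg]; exfalso.
  have := Hh _ (norm_zeta _) (HK k.+1 (leqW Kk)).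
  move=> /(le_trans (normc_ge_Re _)); rewrite Eneg.
  have : 0 <= complex.Re (zeta k.+1 ^ m).
    apply: zetaz_Re_ge0; rewrite expnS.
    have : (2 ^ K <= 2 ^ k)%N by rewrite leq_exp2l.
    by move: mK; lia.
  case: (zeta k.+1 ^ m) => a b /= a0.
  have -> : 2^-1 = (2^-1)%:C :> C by rewrite fmorphV rmorph_nat.
  by rewrite lecR ler_norml => /andP []; lra.
exists m => w w1.
have w0 : w != 0 by rewrite -normr_gt0 w1.
suff E : phi w * w ^ (- m) - 1 = 0.
  move/eqP: E; rewrite subr_eq0 => /eqP E.
  by rewrite -[LHS](mulfK (expfz_neq0 (- m) w0)) E div1r invr_expz opprK.
apply: norm_small_eq0 => e e0.
have e2 : 0 < e / 2 by rewrite divr_gt0 ?ltr0n.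
have [h1 h10 H1] := phic _ e2.
have m0 : 0 < (`|m| + 1)%:~R :> C by rewrite ltr0z; lia.
have [h2 [h20 h21 h22]] := minC_gt0 h10 (divr_gt0 e2 m0).
have [K1 HK1] := dyadic_near h20.
have [q [u [u1 Ew uh]]] := HK1 _ (leq_maxl K1 K) w w1.
have u0 : u != 0 by rewrite -normr_gt0 u1.
set k := maxn K1 K in Ew.
have -> : phi w * w ^ (- m) = phi u * u ^ (- m).
  have zq1 : `|zeta k ^+ q| = 1 by rewrite normrX norm_zeta expr1n.
  rewrite Ew (phiM _ _ zq1 u1) (phiX _ q (norm_zeta k)).
  have Eq : (zeta k ^ m) ^+ q = (zeta k ^+ q) ^ m by exact: exprzAC (zeta k) m q.
  rewrite (phiz k (leq_maxr K1 K)) Eq expfzMl.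
  rewrite mulrACA -expfzDr ?expfz_neq0 ?expf_neq0 //.
  by rewrite subrr mul1r.
have -> : phi u * u ^ (- m) - 1 = (phi u - u ^ m) * u ^ (- m).
  by rewrite mulrBl -expfzDr // subrr.
have nz n : `|u ^ n| = 1 := norm_unit_exprz n u1.
rewrite normrM nz mulr1.
have -> : phi u - u ^ m = (phi u - 1) - (u ^ m - 1) by ring.
apply: le_trans (ler_normB _ _) _; rewrite [e]splitr lerD //.
  by apply: H1 => //; apply: le_trans h21.
apply: le_trans (unit_exprz_sub1 m u1) _.
apply: (@le_trans _ _ ((`|m| + 1)%:~R * `|u - 1|)).
  by rewrite ler_wpM2r // ler_int lerDl.
by rewrite mulrC -ler_pdivlMr // (le_trans uh).
Qed.

End Circle.

(** * Weights of a representation on the diagonal torus *)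

Section EntryNorm.
Variable C : numFieldType.

(** A submultiplicative norm that bounds and is bounded by the entries. *)
Definition nrm p q (A : 'M[C]_(p, q)) : C := \sum_i \sum_j `|A i j|.

Lemma nrm_ge0 p q (A : 'M[C]_(p, q)) : 0 <= nrm A.
Proof. by rewrite sumr_ge0 // => i _; rewrite sumr_ge0. Qed.

Lemma nrm_entry p q (A : 'M[C]_(p, q)) i j : `|A i j| <= nrm A.
Proof.
rewrite /nrm (bigD1 i) //= (bigD1 j) //= -addrA lerDl addr_ge0 ?sumr_ge0 //.
by move=> k _; rewrite sumr_ge0.
Qed.

Lemma nrm_le p q (A : 'M[C]_(p, q)) e :
  (forall i j, `|A i j| <= e) -> nrm A <= (p * q)%:R * e.
Proof.
move=> H; apply: (@le_trans _ _ (\sum_(i < p) \sum_(j < q) e)).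
  by apply: ler_sum => i _; apply: ler_sum => j _.
by rewrite !sumr_const !card_ord -mulrnA mulr_natl mulnC.
Qed.

Lemma nrmD p q (A B : 'M[C]_(p, q)) : nrm (A + B) <= nrm A + nrm B.
Proof.
rewrite /nrm -big_split; apply: ler_sum => i _ /=.
by rewrite -big_split; apply: ler_sum => j _ /=; rewrite mxE ler_normD.
Qed.

Lemma nrmM p q r (A : 'M[C]_(p, q)) (B : 'M[C]_(q, r)) :
  nrm (A *m B) <= nrm A * nrm B.
Proof.
rewrite /nrm mulr_suml; apply: ler_sum => i _.
apply: (@le_trans _ _ (\sum_k \sum_j `|A i j| * `|B j k|)).
  apply: ler_sum => k _; rewrite mxE; apply: le_trans (ler_norm_sum _ _ _) _.
  by apply: ler_sum => j _; rewrite normrM.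
rewrite exchange_big /= mulr_suml; apply: ler_sum => j _.
rewrite -mulr_sumr ler_wpM2l // (bigD1 j) //= lerDl.
by rewrite sumr_ge0 // => i' _; rewrite sumr_ge0.
Qed.

End EntryNorm.

Section Codiagonalization.
Variables (F : fieldType) (d : nat) (I : eqType) (A : I -> 'M[F]_d).

(** Only finitely many members are needed to span the whole family. *)
Lemma codiagonalizable_family :
  (forall i j, A i *m A j = A j *m A i) ->
  (forall i, diagonalizable (A i)) ->
  exists2 B, B \in unitmx & forall i, is_diag_mx (B *m A i *m invmx B).
Proof.
move=> Acomm Adiag.
have [s As] : exists s : seq I, forall i, A i \in <<map A s>>%VS.
  suff : forall N, (exists s : seq I, forall i, A i \in <<map A s>>%VS) \/
                   exists s : seq I, (N <= \dim <<map A s>>%VS)%N.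
    move/(_ (\dim {:'M[F]_d}).+1) => [//|[s]].
    by rewrite leqNgt ltnS dimvS ?subvf.
  elim=> [|N [IH|[s IH]]]; [by right; exists [::]|by left|].
  have [H|] := pselect (forall i, A i \in <<map A s>>%VS); first by left; exists s.
  move=> /existsNP [i /negP Ai]; right; exists (i :: s).
  rewrite (leq_ltn_trans IH) //= span_cons.
  rewrite ltnNge; apply: contra Ai => le.
  have /eqP -> : (<<map A s>> == <[A i]> + <<map A s>>)%VS.
    by rewrite eqEdim addvSr.
  exact: (subvP (addvSl _ _)) _ (memv_line _).
have [H _] := mxpoly.codiagonalizableP (map A s).
have [|B Bu /allP BD] := H.
  split=> [X Y /mapP [i _ ->] /mapP [j _ ->]|X /mapP [i _ ->]]; last exact: Adiag.
  exact: Acomm.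
exists B => // i.
have Es := coord_span (As i : A i \in <<in_tuple (map A s)>>%VS).
apply/is_diag_mxP => a b ab; rewrite Es mulmx_sumr mulmx_suml summxE big1 // => k _.
rewrite -scalemxAr -scalemxAl mxE.
have /BD /= : (map A s)`_k \in map A s by apply: mem_nth.
by move/(mxpoly.diagonalizable_forP _ Bu) => ->; rewrite ?mulr0.
Qed.

End Codiagonalization.

Section Torus.
Variable R : realType.
Local Notation C := R[i].

(** Continuity at the identity, in terms of [nrm], is all that is used of the
    topology; it propagates to the whole group by [rho_lipschitz]. *)
Record cont_rep n d (rho : 'M[C]_n -> 'M[C]_d) : Prop := ContRep {
  cont_rep1 : rho 1%:M = 1%:M;
  cont_repM : forall g h, g \is unitarymx -> h \is unitarymx ->
    rho (g *m h) = rho g *m rho h;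
  cont_rep_cont : forall e : C, 0 < e -> exists2 h : C, 0 < h &
    forall g, g \is unitarymx -> nrm (g - 1%:M) <= h -> nrm (rho g - 1%:M) <= e }.

Lemma cont_rep_conj n d (rho : 'M[C]_n -> 'M[C]_d) B : B \in unitmx ->
  cont_rep rho -> cont_rep (fun g => B *m rho g *m invmx B).
Proof.
move=> Bu [r1 rM rc]; split; first by rewrite r1 mulmx1 mulmxV.
  by move=> g h gU hU; rewrite rM // !mulmxA mulmxKV.
move=> e e0; pose K := nrm B * nrm (invmx B) + 1.
have K0 : 0 < K by rewrite ltr_wpDl ?mulr_ge0 ?nrm_ge0.
have [h h0 H] := rc _ (divr_gt0 e0 K0); exists h => // g gU /(H _ gU).
have -> : B *m rho g *m invmx B - 1%:M = B *m (rho g - 1%:M) *m invmx B.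
  by rewrite mulmxBr mulmx1 mulmxBl mulmxV.
rewrite ler_pdivlMr // => le_e; apply: le_trans le_e.
apply: le_trans (nrmM _ _) _; apply: le_trans (ler_wpM2r (nrm_ge0 _) (nrmM _ _)) _.
by rewrite mulrAC mulrC ler_wpM2l ?nrm_ge0 // lerDl.
Qed.

Definition tor n (z : 'I_n -> C) : 'M[C]_n := diag_mx (\row_i z i).

Lemma torM n (z w : 'I_n -> C) : tor z *m tor w = tor (fun i => z i * w i).
Proof. by rewrite /tor mulmx_diag; congr diag_mx; apply/rowP => i; rewrite !mxE. Qed.

Lemma eq_tor n (z w : 'I_n -> C) : z =1 w -> tor z = tor w.
Proof. by move=> zw; congr diag_mx; apply/rowP => i; rewrite !mxE. Qed.

Lemma tor1 n : tor (fun _ : 'I_n => 1) = 1%:M.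
Proof. by apply/matrixP => i j; rewrite !mxE. Qed.

Lemma conj_tor n (z : 'I_n -> C) : ((tor z)^t*)%sesqui = tor (fun i => (z i)^*%R).
Proof.
apply/matrixP => i j; rewrite !mxE eq_sym; case: eqP => [->|_]; rewrite ?mulr1n //.
by rewrite !mulr0n rmorph0.
Qed.

Lemma tor_unitary n (z : 'I_n -> C) : (forall i, `|z i| = 1) -> tor z \is unitarymx.
Proof.
move=> z1; apply/unitarymxP.
by rewrite conj_tor torM -tor1; apply: eq_tor => i; rewrite -normCK z1 expr1n.
Qed.

Definition tor_at n (i : 'I_n) (w : C) := tor (fun k => if k == i then w else 1).

Lemma tor_atM n (i : 'I_n) w u : tor_at i w *m tor_at i u = tor_at i (w * u).
Proof. by rewrite torM; apply: eq_tor => k; case: eqP; rewrite ?mulr1. Qed.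

Lemma tor_at1 n (i : 'I_n) : tor_at i 1 = 1%:M.
Proof. by rewrite -tor1; apply: eq_tor => k; case: eqP. Qed.

Lemma tor_at_unitary n (i : 'I_n) w : `|w| = 1 -> tor_at i w \is unitarymx.
Proof. by move=> w1; apply: tor_unitary => k; case: eqP; rewrite ?normr1. Qed.

Lemma nrm_tor_sub1 n (z : 'I_n -> C) : nrm (tor z - 1%:M) = \sum_i `|z i - 1|.
Proof.
rewrite /nrm; apply: eq_bigr => i _; rewrite (bigD1 i) //= !mxE eqxx big1 ?addr0 //.
by move=> j; rewrite !mxE eq_sym => /negPf ->; rewrite subrr normr0.
Qed.

Lemma nrm_tor_at_sub1 n (i : 'I_n) w : nrm (tor_at i w - 1%:M) = `|w - 1|.
Proof.
rewrite nrm_tor_sub1 (bigD1 i) //= eqxx big1 ?addr0 // => j /negPf ->.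
by rewrite subrr normr0.
Qed.

Section Weights.
Variables (n d : nat) (rho : 'M[C]_n -> 'M[C]_d).
Hypothesis rhoP : cont_rep rho.

Let rho1 := cont_rep1 rhoP.
Let rhoM := cont_repM rhoP.

Lemma rho_tor_atX i w q : `|w| = 1 ->
  rho (tor_at i (w ^+ q)) = iter q (mulmx (rho (tor_at i w))) 1%:M.
Proof.
move=> w1; elim: q => [|q IHq]; first by rewrite tor_at1.
by rewrite exprS -tor_atM rhoM ?tor_at_unitary ?normrX ?w1 ?expr1n // iterS -IHq.
Qed.

(** An operator of finite order is a root of the separable polynomial
    [X^N - 1]. *)
Lemma torsion_diagonalizable N i w : N.-primitive_root w -> `|w| = 1 ->
  diagonalizable (rho (tor_at i w)).
Proof.
move=> wP w1; set A := rho _.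
have AN : iter N (mulmx A) 1%:M = 1%:M.
  by rewrite -rho_tor_atX // (prim_expr_order wP) tor_at1.
case: d rho rhoP @A AN => [|d'] r _ A AN.
  by exists 1%:M; rewrite ?unitmx1 //; apply/diagonalizable_forP; rewrite ?unitmx1 // => -[].
have {}AN : A ^+ N = 1 by rewrite -[RHS]AN; elim: (N) => // k IH; rewrite exprS IH.
apply/diagonalizableP; exists [seq w ^+ k | k <- index_iota 0 N].
  rewrite map_inj_in_uniq ?iota_uniq // => a b; rewrite !mem_index_iota /= => aN bN /eqP.
  by rewrite (eq_prim_root_expr wP) !modn_small // => /eqP.
rewrite big_map (factor_Xn_sub_1 wP).
by apply: mxminpoly_min; rewrite rmorphB rmorphXn /= horner_mx_X rmorph1 AN subrr.
Qed.

Lemma torsion_basis : exists2 B, B \in unitmx &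
  forall i k, is_diag_mx (B *m rho (tor_at i (zeta R k)) *m invmx B).
Proof.
have [||B Bu HB] := @codiagonalizable_family _ _ _
  (fun p : 'I_n * nat => rho (tor_at p.1 (zeta R p.2))).
- move=> [i k] [j l] /=; rewrite -!rhoM ?tor_at_unitary ?norm_zeta //.
  by rewrite !torM; congr rho; apply: eq_tor => a; rewrite mulrC.
- by move=> [i k]; apply: torsion_diagonalizable (zeta_prim _ _) (norm_zeta _ _).
by exists B => // i k; apply: (HB (i, k)).
Qed.

Hypothesis rho_diag : forall i k, is_diag_mx (rho (tor_at i (zeta R k))).

(** Dyadic roots of unity are dense, and the diagonal matrices by which they act
    have entries of modulus 1, hence do not amplify the error. *)
Lemma rho_tor_at_diag i w : `|w| = 1 -> is_diag_mx (rho (tor_at i w)).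
Proof.
move=> w1; apply/is_diag_mxP => a b ab; apply: norm_small_eq0 => e e0.
have [h h0 H] := cont_rep_cont rhoP e0.
have [K HK] := dyadic_near h0.
have [q [u [u1 -> uh]]] := HK K (leqnn K) w w1.
have z1 : `|zeta R K ^+ q| = 1 by rewrite normrX norm_zeta expr1n.
rewrite -tor_atM rhoM ?tor_at_unitary // rho_tor_atX ?norm_zeta //.
set D := rho (tor_at i (zeta R K)); set U := rho (tor_at i u).
have [e1 De] := diag_mxP _ (rho_diag i K).
have iterD a' c X : (iter c (mulmx D) X) a a' = e1 0 a ^+ c * X a a'.
  elim: c => [|c IHc] /=; first by rewrite mul1r.
  by rewrite {1}/D De mul_diag_mx mxE IHc exprS mulrA.
have e1a : `|e1 0 a| = 1.
  have : (iter (2 ^ K) (mulmx D) 1%:M) a a = 1.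
    by rewrite -rho_tor_atX ?norm_zeta // zetaX tor_at1 rho1 mxE eqxx.
  rewrite iterD mxE eqxx mulr1 => /(congr1 Num.norm); rewrite normrX normr1 => /eqP.
  by rewrite pexprn_eq1 ?expn_eq0 //= => /eqP.
have -> M : iter q (mulmx D) 1%:M *m M = iter q (mulmx D) M.
  by elim: (q) => [|c IHc] /=; rewrite ?mul1mx // -mulmxA IHc.
rewrite iterD normrM normrX e1a expr1n mul1r.
have := H _ (tor_at_unitary i u1); rewrite nrm_tor_at_sub1 => /(_ uh).
apply: le_trans; apply: le_trans (nrm_entry _ a b).
by rewrite !mxE (negPf (ab : a != b)) subr0.
Qed.

(** The diagonal entries are continuous characters of circles, one for each
    coordinate. *)
Theorem torus_weights : exists m : 'I_d -> 'I_n -> int,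
  forall z, (forall i, `|z i| = 1) ->
    rho (tor z) = diag_mx (\row_j \prod_i z i ^ m j i).
Proof.
have chi j i : exists m : int, forall w, `|w| = 1 -> rho (tor_at i w) j j = w ^ m.
  apply: circle_char => [|w u w1 u1|e e0].
  - by rewrite tor_at1 rho1 mxE eqxx.
  - rewrite -tor_atM rhoM ?tor_at_unitary //.
    have [a ->] := diag_mxP _ (rho_tor_at_diag i w1).
    by rewrite mul_diag_mx !mxE eqxx mulr1n.
  have [h h0 H] := cont_rep_cont rhoP e0; exists h => // w w1 wh.
  have := H _ (tor_at_unitary i w1); rewrite nrm_tor_at_sub1 => /(_ wh).
  by apply: le_trans; apply: le_trans (nrm_entry _ j j); rewrite !mxE eqxx.
exists (fun j i => projT1 (cid (chi j i))) => z z1.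
have Ei i : rho (tor_at i (z i)) = diag_mx (\row_j (z i) ^ projT1 (cid (chi j i))).
  have [a E] := diag_mxP _ (rho_tor_at_diag i (z1 i)).
  rewrite E; congr diag_mx; apply/rowP => j; rewrite !mxE.
  rewrite -(projT2 (cid (chi j i))) // E mxE eqxx mulr1n //.
have E (s : seq 'I_n) : uniq s -> rho (tor (fun k => if k \in s then z k else 1)) =
    diag_mx (\row_j \prod_(i <- s) z i ^ projT1 (cid (chi j i))).
  elim: s => [_|i s IHs /= /andP [iNs us]].
    rewrite tor1 rho1; apply/matrixP => a b; rewrite !mxE.
    by rewrite big_nil.
  have -> : tor (fun k => if k \in i :: s then z k else 1) =
     tor_at i (z i) *m tor (fun k => if k \in s then z k else 1).
    rewrite torM; apply: eq_tor => k; rewrite inE.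
    by case: eqP => [->|_] /=; rewrite ?(negPf iNs) ?mulr1 ?mul1r.
  rewrite rhoM ?tor_at_unitary ?tor_unitary //; last first.
    by move=> k; case: ifP; rewrite ?normr1.
  rewrite IHs // Ei mulmx_diag; congr diag_mx; apply/rowP => j.
  by rewrite !mxE big_cons.
rewrite -(E _ (index_enum_uniq 'I_n)); congr rho.
by apply: eq_tor => k; rewrite mem_index_enum.
Qed.

End Weights.
End Torus.

(** * First-order expansions of sequences *)

Section Jets.
Variable R : realType.
Local Notation C := R[i].
Implicit Types (u v : nat -> C).

(** The small parameter of all expansions. *)
Definition eps N : C := N.+1%:R^-1.

Lemma eps_gt0 N : 0 < eps N. Proof. by rewrite invr_gt0 ltr0n. Qed.
Lemma eps_ge0 N : 0 <= eps N. Proof. exact: ltW (eps_gt0 N). Qed.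
Lemma eps_le1 N : eps N <= 1. Proof. by rewrite invf_le1 ?ltr0n // ler1n. Qed.

Lemma eps_small (K e : C) : 0 <= K -> 0 < e -> exists N0, forall N, (N0 <= N)%N -> K * eps N <= e.
Proof.
move=> K0 /posC_Re [-> e0]; have -> : K = (complex.Re K)%:C by rewrite RRe_real ?ger0_real.
have k0 : 0 <= complex.Re K by rewrite -lecR RRe_real ?ger0_real.
exists (Num.bound (complex.Re K / complex.Re e)) => N leN.
rewrite /eps ler_pdivrMr ?ltr0n // -(rmorph_nat (real_complex R)) -rmorphM lecR mulrC.
rewrite -ler_pdivrMr //; apply: ltW; apply: lt_le_trans (archi_boundP _) _.
  by rewrite divr_ge0 // ltW.
by rewrite ler_nat leqW.
Qed.

Definition bigo k u := exists2 K, 0 <= K & forall N, `|u N| <= K * eps N ^+ k.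

Lemma bigo_le k u v (c : C) : 0 <= c -> (forall N, `|u N| <= c * `|v N|) -> bigo k v -> bigo k u.
Proof.
move=> c0 uv [K K0 H]; exists (c * K) => [|N]; first exact: mulr_ge0.
by apply: le_trans (uv N) _; rewrite -mulrA ler_wpM2l.
Qed.

Lemma eq_bigo k u v : u =1 v -> bigo k u -> bigo k v.
Proof. by move=> uv; apply: (@bigo_le _ _ _ 1) => // N; rewrite uv mul1r. Qed.

Lemma bigo_const c : bigo 0 (fun=> c).
Proof. by exists `|c| => // N; rewrite mulr1. Qed.

Lemma bigo0 k : bigo k (fun=> 0).
Proof. by exists 0 => // N; rewrite normr0 mul0r. Qed.

Lemma bigo_eps : bigo 1 eps.
Proof. by exists 1 => // N; rewrite ger0_norm ?eps_ge0 // mul1r. Qed.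

Lemma bigoD k u v : bigo k u -> bigo k v -> bigo k (fun N => u N + v N).
Proof.
move=> [K K0 HK] [L L0 HL]; exists (K + L) => [|N]; first exact: addr_ge0.
by rewrite mulrDl; apply: le_trans (ler_normD _ _) (lerD _ _).
Qed.

Lemma bigoN k u : bigo k u -> bigo k (fun N => - u N).
Proof. by apply: (@bigo_le _ _ _ 1) => // N; rewrite normrN mul1r. Qed.

Lemma bigoM k l u v : bigo k u -> bigo l v -> bigo (k + l) (fun N => u N * v N).
Proof.
move=> [K K0 HK] [L L0 HL]; exists (K * L) => [|N]; first exact: mulr_ge0.
by rewrite normrM exprD mulrACA ler_pM.
Qed.

Lemma bigo_weak k l u : (l <= k)%N -> bigo k u -> bigo l u.
Proof.
move=> lk [K K0 HK]; exists K => // N; apply: le_trans (HK N) _.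
by rewrite ler_wpM2l // ler_wiXn2l ?eps_ge0 ?eps_le1.
Qed.

Lemma bigo_sum k (I : Type) (r : seq I) (u : I -> nat -> C) :
  (forall i, bigo k (u i)) -> bigo k (fun N => \sum_(i <- r) u i N).
Proof.
move=> H; elim: r => [|i r IH].
  by apply: eq_bigo (bigo0 k) => N; rewrite big_nil.
by apply: eq_bigo (bigoD (H i) IH) => N; rewrite big_cons.
Qed.

Lemma bigo1_const0 c : bigo 1 (fun=> c) -> c = 0.
Proof.
case=> K K0 H; apply: norm_small_eq0 => e e0.
have [N /(_ N (leqnn N)) HN] := eps_small K0 e0.
by apply: le_trans (H N) HN.
Qed.

(** [a] and [b] are the value and the derivative at 0 of a curve sampled at the
    points [eps N], the remainder being quadratic.  Sequences replace
    differentiable curves throughout. *)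
Definition sjet u a b := bigo 2 (fun N => u N - (a + b * eps N)).

Lemma sjet_bounded u a b : sjet u a b -> bigo 0 u.
Proof.
move=> H; have := bigoD (bigo_weak (leq0n 2) H) (bigoD (bigo_const a)
  (bigo_weak (leq0n 1) (bigoM (bigo_const b) bigo_eps))).
by apply: eq_bigo => N; rewrite subrK.
Qed.

Lemma eq_sjet u v a b : u =1 v -> sjet u a b -> sjet v a b.
Proof. by move=> uv; apply: eq_bigo => N; rewrite uv. Qed.

Lemma sjet_const c : sjet (fun=> c) c 0.
Proof. by apply: eq_bigo (bigo0 2) => N; rewrite mul0r addr0 subrr. Qed.

Lemma sjetD u v a b a' b' : sjet u a b -> sjet v a' b' ->
  sjet (fun N => u N + v N) (a + a') (b + b').
Proof. by move=> Hu Hv; apply: eq_bigo (bigoD Hu Hv) => N; ring. Qed.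

Lemma sjet_eps b : sjet (fun N => b * eps N) 0 b.
Proof. by apply: eq_bigo (bigo0 2) => N; rewrite add0r subrr. Qed.

Lemma sjetM u v a b a' b' : sjet u a b -> sjet v a' b' ->
  sjet (fun N => u N * v N) (a * a') (a * b' + b * a').
Proof.
move=> Hu Hv; have H1 := bigoM Hu (sjet_bounded Hv).
have H2 := bigoM (sjet_bounded (sjetD (sjet_const a) (sjet_eps b))) Hv.
have H3 := bigoM (bigo_const (b * b')) (bigoM bigo_eps bigo_eps).
by apply: eq_bigo (bigoD (bigoD H1 H2) H3) => N /=; ring.
Qed.

Lemma sjet_sum (I : Type) (r : seq I) (u : I -> nat -> C) a b :
  (forall i, sjet (u i) (a i) (b i)) ->
  sjet (fun N => \sum_(i <- r) u i N) (\sum_(i <- r) a i) (\sum_(i <- r) b i).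
Proof.
move=> H; apply: eq_bigo (bigo_sum r H) => N.
by rewrite mulr_suml -big_split -sumrB.
Qed.

Lemma sjet_uniq u a b b' : sjet u a b -> sjet u a b' -> b = b'.
Proof.
move=> H H'; apply/eqP; rewrite -subr_eq0; apply/eqP/bigo1_const0.
have [K K0 HK] := bigoD H' (bigoN H); exists K => // N.
have := HK N.
have -> : u N - (a + b' * eps N) - (u N - (a + b * eps N)) = (b - b') * eps N by ring.
rewrite normrM (ger0_norm (eps_ge0 N)) exprS expr1 mulrA.
by rewrite ler_pM2r ?eps_gt0.
Qed.

Lemma sjet_conj u a b : sjet u a b -> sjet (fun N => (u N)^*%R) (a^*%R) (b^*%R).
Proof.
apply: (@bigo_le _ _ _ 1) => // N; rewrite mul1r.
by rewrite -[X in _ <= X]norm_conjC !rmorphB rmorphD rmorphM /= (CrealP (ger0_real (eps_ge0 N))).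
Qed.

(** The Cayley transform: a rational curve on the unit circle through 1 with
    velocity [2 i a], in place of the exponential. *)
Definition cay (a : C) N : C := (1 + 'i%C * a * eps N) / (1 - 'i%C * a * eps N).

Section Cayley.
Variable a : C.
Hypothesis aR : a \is Num.real.

Let cay_real N : exists r : R, 'i%C * a * eps N = 0 +i* r.
Proof.
rewrite -mulrA.
have [r ->] := complex_realP _ (rpredM aR (ger0_real (eps_ge0 N)) : a * eps N \is Num.real).
by exists r; simpc.
Qed.

Let cayden_ge1 N : 1 <= `|1 - 'i%C * a * eps N|.
Proof.
apply: le_trans (normc_ge_Re _); have [r ->] := cay_real N.
by rewrite /= subr0 normr1.
Qed.

Lemma cayden_neq0 N : 1 - 'i%C * a * eps N != 0.
Proof. by rewrite -normr_gt0 (lt_le_trans ltr01 (cayden_ge1 N)). Qed.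

Lemma norm_cay N : `|cay a N| = 1.
Proof.
rewrite /cay normrM normfV.
have -> : `|1 + 'i%C * a * eps N| = `|1 - 'i%C * a * eps N|.
  by have [r ->] := cay_real N; rewrite !normc_def /= subr0 addr0 sub0r add0r sqrrN.
by rewrite divff // normr_eq0 cayden_neq0.
Qed.

Lemma sjet_cay : sjet (cay a) 1 ('i%C * a *+ 2).
Proof.
have H := bigoM (bigo_const (('i%C * a) ^+ 2 *+ 2)) (bigoM bigo_eps bigo_eps).
apply: bigo_le (ler01) _ H => N; rewrite mul1r.
have -> : cay a N - (1 + 'i%C * a *+ 2 * eps N) =
  ('i%C * a) ^+ 2 *+ 2 * (eps N * eps N) / (1 - 'i%C * a * eps N).
  by rewrite /cay; field; exact: cayden_neq0.
rewrite normrM normfV ler_pdivrMr ?(lt_le_trans ltr01 (cayden_ge1 N)) //.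
by rewrite ler_peMr ?cayden_ge1.
Qed.

Lemma cayN N : cay (- a) N = (cay a N)^-1.
Proof. by rewrite /cay invf_div mulrN !mulNr opprK. Qed.

Lemma sjet_cay_exprn (n : nat) : sjet (fun N => cay a N ^+ n) 1 ('i%C * a *+ 2 *+ n).
Proof.
elim: n => [|n IHn]; first exact: sjet_const.
have := sjetM sjet_cay IHn; rewrite !mulr1 mul1r addrC => J.
by rewrite [_ *+ n.+1]mulrS; apply: eq_sjet J => N; rewrite exprS.
Qed.
End Cayley.

Lemma sjet_cay_exprz a (m : int) : a \is Num.real ->
  sjet (fun N => cay a N ^ m) 1 ('i%C * a *+ 2 *~ m).
Proof.
move=> aR; case: m => n; first exact: sjet_cay_exprn.
have := @sjet_cay_exprn (- a) _ n.+1; rewrite rpredN => /(_ aR).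
rewrite NegzE mulrNz mulrN mulNrn mulNrn.
by apply: eq_sjet => N; rewrite cayN // exprVn exprnN.
Qed.

(** Factors tending to 1 make the product rule a sum. *)
Lemma sjet_prod1 (I : Type) (r : seq I) (u : I -> nat -> C) b :
  (forall i, sjet (u i) 1 (b i)) ->
  sjet (fun N => \prod_(i <- r) u i N) 1 (\sum_(i <- r) b i).
Proof.
move=> H; elim: r => [|i r IH].
  by rewrite big_nil; apply: eq_sjet (sjet_const 1) => N; rewrite big_nil.
have := sjetM (H i) IH; rewrite !mulr1 mul1r addrC => J.
by rewrite big_cons; apply: eq_sjet J => N; rewrite big_cons.
Qed.

Definition jet p q (F : nat -> 'M[C]_(p, q)) (A B : 'M[C]_(p, q)) :=
  forall i j, sjet (fun N => F N i j) (A i j) (B i j).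

Lemma jet_const p q (A : 'M[C]_(p, q)) : jet (fun=> A) A 0.
Proof. by move=> i j; rewrite mxE; apply: sjet_const. Qed.

Lemma jetM p q r (F : nat -> 'M[C]_(p, q)) (G : nat -> 'M[C]_(q, r)) A B A' B' :
  jet F A B -> jet G A' B' -> jet (fun N => F N *m G N) (A *m A') (A *m B' + B *m A').
Proof.
move=> HF HG i j; rewrite !mxE -big_split /=.
have := sjet_sum (index_enum 'I_q) (fun k => sjetM (HF i k) (HG k j)).
by apply: eq_sjet => N; rewrite mxE.
Qed.

Lemma jet_uniq p q (F : nat -> 'M[C]_(p, q)) A B B' : jet F A B -> jet F A B' -> B = B'.
Proof. by move=> H H'; apply/matrixP => i j; apply: sjet_uniq (H i j) (H' i j). Qed.

Lemma eq_jet p q (F G : nat -> 'M[C]_(p, q)) A B : F =1 G -> jet F A B -> jet G A B.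
Proof. by move=> FG H i j; apply: eq_sjet (H i j) => N; rewrite FG. Qed.

Lemma jet_conjt p q (F : nat -> 'M[C]_(p, q)) A B : jet F A B ->
  jet (fun N => ((F N)^t*)%sesqui) ((A^t*)%sesqui) ((B^t*)%sesqui).
Proof.
move=> H i j; rewrite !mxE; apply: eq_sjet (sjet_conj (H j i)) => N.
by rewrite !mxE.
Qed.

Lemma jet_tor_cay n (a : 'I_n -> C) : (forall i, a i \is Num.real) ->
  jet (fun N => tor (fun i => cay (a i) N)) 1%:M (tor (fun i => 'i%C * a i *+ 2)).
Proof.
move=> aR i j; rewrite !mxE; have [->|ij] := eqVneq i j.
  by rewrite !mulr1n; apply: eq_sjet (sjet_cay (aR j)) => N; rewrite !mxE eqxx mulr1n.
rewrite !mulr0n.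
by apply: eq_sjet (sjet_const 0) => N; rewrite !mxE (negPf ij) mulr0n.
Qed.

End Jets.

(** * Representations of the unitary group are Lipschitz *)

Section Unitary.
Variable R : realType.
Local Notation C := R[i].
Variable n : nat.
Implicit Types g P : 'M[C]_n.

Lemma unitary1 : (1%:M : 'M[C]_n) \is unitarymx.
Proof. by rewrite -tor1 tor_unitary // => i; rewrite normr1. Qed.

Lemma invmx_unitarymx P : P \is unitarymx -> invmx P \is unitarymx.
Proof. by move=> PU; rewrite (invmx_unitary PU) trmxC_unitary; exact: PU. Qed.

Lemma unitaryM (A B : 'M[C]_n) :
  A \is unitarymx -> B \is unitarymx -> A *m B \is unitarymx.
Proof. exact: mul_unitarymx. Qed.

Lemma normr_unitary_entry g i j : g \is unitarymx -> `|g i j| <= 1.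
Proof.
move=> /unitarymxP /matrixP /(_ i i); rewrite !mxE eqxx /= => E.
rewrite -(@expr_le1 _ 2) // -[leRHS]E (bigD1 j) //= !mxE -normCK lerDl.
by rewrite sumr_ge0 // => k _; rewrite !mxE -normCK exprn_ge0.
Qed.

Lemma nrm_unitary g : g \is unitarymx -> nrm g <= (n * n)%:R.
Proof.
by move=> gU; rewrite -[leRHS]mulr1 nrm_le // => i j; apply: normr_unitary_entry.
Qed.

Lemma normal_spectral g : g *m (g^t*)%sesqui = (g^t*)%sesqui *m g ->
  exists P z, P \is unitarymx /\ g = invmx P *m tor z *m P.
Proof.
move=> /normalmxP /orthomx_spectralP; have PU := spectral_unitarymx g.
move: (spectralmx g) (spectral_diag g) PU => P D PU E.
exists P, (fun i => D 0 i); split; first exact: PU.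
have -> : tor (fun i => D 0 i) = diag_mx D.
  by congr diag_mx; apply/rowP => i; rewrite mxE.
exact: E.
Qed.

Lemma mulmx_conjt (A B : 'M[C]_n) :
  ((A *m B)^t*)%sesqui = ((B^t*)%sesqui *m (A^t*)%sesqui).
Proof. by rewrite trmx_mul map_mxM. Qed.

Lemma unitary_spectral g : g \is unitarymx -> exists P z,
  [/\ P \is unitarymx, forall i, `|z i| = 1 & g = invmx P *m tor z *m P].
Proof.
move=> gU; have [|P [z [PU Eg]]] := @normal_spectral g.
  by rewrite -invmx_unitary // mulmxV ?mulVmx ?unitarymx_unit.
exists P, z; split=> // i.
have Pu := unitarymx_unit PU.
have tU : tor z \is unitarymx.
  have -> : tor z = P *m g *m invmx P.
    by rewrite Eg !mulmxA mulmxV // mul1mx mulmxK.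
  exact: (unitaryM (unitaryM PU gU) (invmx_unitarymx PU)).
have /unitarymxP := tU; rewrite conj_tor torM => /matrixP /(_ i i).
rewrite !mxE eqxx !mulr1n -normCK => /eqP.
by rewrite pexprn_eq1 //= => /eqP.
Qed.

Lemma skew_spectral g : (g^t*)%sesqui = - g -> exists P a,
  [/\ P \is unitarymx, forall i, a i \is Num.real &
      g = invmx P *m tor (fun i => 'i%C * a i *+ 2) *m P].
Proof.
move=> gS; have [|P [z [PU Eg]]] := @normal_spectral g.
  by rewrite gS mulmxN mulNmx.
have Pu := unitarymx_unit PU.
have i0 : 'i%C *+ 2 != 0 :> C.
  by rewrite mulrn_eq0 /= eq_complex /= oner_eq0 andbF.
have ic : ('i%C : C)^*%R = - 'i%C by rewrite -[LHS]/(conjc _) /=; simpc.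
have Ez : tor (fun i => 'i%C * (z i / ('i%C *+ 2)) *+ 2) = tor z.
  by apply: eq_tor => i; rewrite -mulrnAl mulrC divfK.
exists P, (fun i => z i / ('i%C *+ 2)); rewrite Ez; split; [exact: PU| |exact: Eg].
move=> i; have : ((tor z)^t*)%sesqui = - tor z.
  have -> : tor z = P *m g *m invmx P.
    by rewrite Eg !mulmxA mulmxV // mul1mx mulmxK.
  rewrite !mulmx_conjt gS invmx_unitary // trmxCK.
  by rewrite mulNmx mulmxN mulmxA.
rewrite conj_tor => /matrixP /(_ i i); rewrite !mxE eqxx !mulr1n => zi.
apply/CrealP; rewrite rmorphM fmorphV /= zi rmorphMn /= ic.
by rewrite mulNrn invrN mulrNN.
Qed.

End Unitary.

Section Lipschitz.
Variable R : realType.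
Local Notation C := R[i].
Variables (n d : nat) (rho : 'M[C]_n -> 'M[C]_d).
Hypothesis rhoP : cont_rep rho.
Variable m : 'I_d -> 'I_n -> int.
Hypothesis rhoT : forall z, (forall i, `|z i| = 1) ->
  rho (tor z) = diag_mx (\row_j \prod_i z i ^ m j i).

Let rho1 := cont_rep1 rhoP.
Let rhoM := cont_repM rhoP.

Lemma rho_inv u : u \is unitarymx -> rho u *m rho (invmx u) = 1%:M.
Proof.
by move=> uU; rewrite -rhoM ?invmx_unitarymx // mulmxV ?unitarymx_unit.
Qed.

Lemma rho_invl u : u \is unitarymx -> rho (invmx u) *m rho u = 1%:M.
Proof.
by move=> uU; rewrite -rhoM ?invmx_unitarymx // mulVmx ?unitarymx_unit.
Qed.

Lemma mulmx_conj_iter (P X : 'M[C]_n) q : P \in unitmx ->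
  iter q (mulmx (invmx P *m X *m P)) 1%:M = invmx P *m iter q (mulmx X) 1%:M *m P.
Proof.
move=> Pu; elim: q => [|q IHq] /=; first by rewrite mulmx1 mulVmx.
by rewrite IHq !mulmxA mulmxK.
Qed.

(** By the spectral theorem every unitary matrix is an [N]-th power of a unitary
    matrix close to 1, with [N] independent of the matrix, and [rho] is bounded
    near 1. *)
Lemma rho_bounded : exists2 M : C, 0 <= M & forall g, g \is unitarymx -> nrm (rho g) <= M.
Proof.
have [h h0 H] := cont_rep_cont rhoP ltr01.
(* Conjugation by a unitary matrix and its inverse costs a factor [(n * n)^2]
   in [nrm], and the diagonal a factor [n]. *)
pose c : C := ((n * n)%:R * n%:R) * (n * n)%:R + 1.
have c0 : 0 < c by rewrite ltr_wpDl ?mulr_ge0 ?ler0n.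
have [N N0 HN] := circle_roots_near1 (divr_gt0 h0 c0).
pose L : C := nrm (1%:M : 'M[C]_d) + 1.
have L0 : 0 <= L by rewrite addr_ge0 ?nrm_ge0.
exists (L ^+ N * nrm (1%:M : 'M[C]_d)) => [|g gU]; first by rewrite mulr_ge0 ?exprn_ge0 ?nrm_ge0.
have [P [z [PU z1 Eg]]] := unitary_spectral gU.
have [u Hu] := choice (fun i => HN (z i) (z1 i)).
have u1 i : `|u i| = 1 by case: (Hu i).
have uN i : u i ^+ N = z i by case: (Hu i).
have uh i : `|u i - 1| <= h / c by case: (Hu i).
have Pu := unitarymx_unit PU.
pose g1 := invmx P *m tor u *m P.
have PVU := invmx_unitarymx PU.
have g1U : g1 \is unitarymx := unitaryM (unitaryM PVU (tor_unitary u1)) PU.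
have Eg1 : g = iter N (mulmx g1) 1%:M.
  rewrite mulmx_conj_iter // Eg; congr (_ *m _ *m _).
  have -> : tor z = tor (fun i => u i ^+ N) by apply: eq_tor => i.
  elim: (N) => [|k IH] /=; first by rewrite -tor1.
  by rewrite -IH torM; apply: eq_tor => i; rewrite exprS.
have rg1 : nrm (rho g1) <= L.
  have -> : rho g1 = 1%:M + (rho g1 - 1%:M) by rewrite addrC subrK.
  apply: le_trans (nrmD _ _) _; rewrite lerD2l; apply: H => //.
  have -> : g1 - 1%:M = invmx P *m (tor u - 1%:M) *m P.
    by rewrite mulmxBr mulmxBl mulmx1 mulVmx.
  apply: le_trans (nrmM _ _) _.
  apply: (@le_trans _ _ ((n * n)%:R * (n%:R * (h / c)) * (n * n)%:R)).
    apply: ler_pM (nrm_ge0 _) (nrm_ge0 _) _ (nrm_unitary PU).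
    apply: le_trans (nrmM _ _) _.
    apply: ler_pM (nrm_ge0 _) (nrm_ge0 _) (nrm_unitary PVU) _.
    rewrite nrm_tor_sub1; apply: (@le_trans _ _ (\sum_(i < n) h / c)).
      by apply: ler_sum => i _.
    by rewrite sumr_const card_ord mulr_natl.
  have -> : (n * n)%:R * (n%:R * (h / c)) * (n * n)%:R =
     (n * n)%:R * n%:R * (n * n)%:R * h / c by ring.
  rewrite ler_pdivrMr // mulrC ler_pM2l // lerDl.
  exact: ler01.
have itU k : iter k (mulmx g1) 1%:M \is unitarymx.
  by elim: k => [|k IH]; [exact: unitary1 | rewrite iterS; exact: (unitaryM g1U IH)].
rewrite Eg1; elim: (N) => [|k IH] /=; first by rewrite rho1 mul1r.
rewrite (rhoM g1U (itU k)); apply: le_trans (nrmM _ _) _.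
by rewrite exprS -mulrA ler_pM ?nrm_ge0.
Qed.

Lemma prod_unit_sub1 (I : Type) (r : seq I) (u : I -> C) :
  (forall i, `|u i| = 1) -> `|\prod_(i <- r) u i - 1| <= \sum_(i <- r) `|u i - 1|.
Proof.
move=> u1; elim: r => [|i r IH]; first by rewrite !big_nil subrr normr0.
rewrite !big_cons; set p := \prod_(_ <- r) _ in IH *.
have -> : u i * p - 1 = (u i - 1) + u i * (p - 1) by ring.
by apply: le_trans (ler_normD _ _) _; rewrite normrM u1 mul1r lerD2l.
Qed.

(** Up to translation one of the two elements is 1 and the other is conjugate to
    a diagonal matrix [z]; there the entries of [rho] are monomials in [z], and the
    conjugating matrices and their images under [rho] are bounded. *)
Lemma rho_lipschitz : exists2 K : C, 0 <= K & forall g h,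
  g \is unitarymx -> h \is unitarymx -> nrm (rho g - rho h) <= K * nrm (g - h).
Proof.
have [M M0 HM] := rho_bounded.
pose W : C := \sum_(j < d) \sum_(i < n) `|m j i|%:~R.
pose V : C := (n * n)%:R.
have W0 : 0 <= W by rewrite sumr_ge0 // => j _; rewrite sumr_ge0 // => i _; rewrite ler0z.
have V0 : 0 <= V by rewrite ler0n.
have near1 g : g \is unitarymx -> nrm (rho g - 1%:M) <= M * (W * (V * nrm (g - 1%:M) * V)) * M.
  move=> gU; have [P [z [PU z1 Eg]]] := unitary_spectral gU.
  have Pu := unitarymx_unit PU; have PVU := invmx_unitarymx PU.
  have tU := tor_unitary z1.
  have -> : rho g - 1%:M = rho (invmx P) *m (rho (tor z) - 1%:M) *m rho P.
    by rewrite Eg (rhoM (unitaryM PVU tU) PU) (rhoM PVU tU) mulmxBr mulmxBl mulmx1 (rho_invl PU).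
  apply: le_trans (nrmM _ _) _; apply: ler_pM (nrm_ge0 _) (nrm_ge0 _) _ (HM _ PU).
  apply: le_trans (nrmM _ _) _; apply: ler_pM (nrm_ge0 _) (nrm_ge0 _) (HM _ PVU) _.
  have zi i : `|z i - 1| <= V * nrm (g - 1%:M) * V.
    have -> : z i - 1 = (P *m (g - 1%:M) *m invmx P) i i.
      rewrite Eg mulmxBr mulmxBl mulmx1 !mulmxA mulmxV // mul1mx mulmxK //.
      by rewrite !mxE eqxx.
    apply: le_trans (nrm_entry _ _ _) _; apply: le_trans (nrmM _ _) _.
    apply: ler_pM (nrm_ge0 _) (nrm_ge0 _) _ (nrm_unitary PVU).
    apply: le_trans (nrmM _ _) _.
    exact: ler_pM (nrm_ge0 _) (nrm_ge0 _) (nrm_unitary PU) (lexx _).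
  rewrite rhoT //.
  have -> : diag_mx (\row_j \prod_i z i ^ m j i) = tor (fun j => \prod_i z i ^ m j i).
    by [].
  rewrite nrm_tor_sub1 /W mulr_suml; apply: ler_sum => j _.
  apply: le_trans (prod_unit_sub1 _ (fun i => norm_unit_exprz (m j i) (z1 i))) _.
  rewrite mulr_suml; apply: ler_sum => i _.
  by apply: le_trans (unit_exprz_sub1 _ (z1 i)) _; rewrite ler_wpM2l // ler0z.
exists (M * (M * (W * (V * V * V)) * M)) => [|g h gU hU].
  by rewrite !mulr_ge0.
have hVU := invmx_unitarymx hU; have hu := unitarymx_unit hU.
have -> : rho g - rho h = rho h *m (rho (invmx h *m g) - 1%:M).
  by rewrite mulmxBr mulmx1 -(rhoM hU (unitaryM hVU gU)) mulKVmx.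
apply: le_trans (nrmM _ _) _; rewrite -!mulrA; apply: ler_pM (nrm_ge0 _) (nrm_ge0 _) (HM _ hU) _.
apply: le_trans (near1 _ (unitaryM hVU gU)) _.
rewrite -!mulrA; apply: ler_wpM2l => //; apply: ler_wpM2l => //; apply: ler_wpM2l => //.
have -> : invmx h *m g - 1%:M = invmx h *m (g - h) by rewrite mulmxBr mulVmx.
apply: le_trans (_ : V * nrm (g - h) * (V * M) <= _); last first.
  by rewrite le_eqVlt; apply/orP; left; apply/eqP; ring.
rewrite ler_wpM2r ?mulr_ge0 //; apply: le_trans (nrmM _ _) _.
exact: ler_pM (nrm_ge0 _) (nrm_ge0 _) (nrm_unitary hVU) (lexx _).
Qed.

End Lipschitz.

(** * The differential of a representation *)

Lemma mulrz_lin (F : comRingType) (c a b : F) (k : int) :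
  c * (a *~ k) + b *~ k = (c * a + b) *~ k.
Proof. by rewrite mulrzAr mulrzDl. Qed.

Section Differential.
Variable R : realType.
Local Notation C := R[i].
Variables (n d : nat) (rho : 'M[C]_n -> 'M[C]_d).
Hypothesis rhoP : cont_rep rho.
Variable m : 'I_d -> 'I_n -> int.
Hypothesis rhoT : forall z, (forall i, `|z i| = 1) ->
  rho (tor z) = diag_mx (\row_j \prod_i z i ^ m j i).

Let rhoM := cont_repM rhoP.

Definition adj (A : 'M[C]_n) : 'M[C]_n := (A^t*)%sesqui.
Definition skew A := adj A = - A.

Lemma adjE A i j : adj A i j = (A j i)^*%R.
Proof. by rewrite !mxE. Qed.

Lemma adjK A : adj (adj A) = A.
Proof. by apply/matrixP => i j; rewrite !adjE conjCK. Qed.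

Lemma adjD A B : adj (A + B) = adj A + adj B.
Proof. by apply/matrixP => i j; rewrite adjE !mxE rmorphD. Qed.

Lemma adjZ c A : adj (c *: A) = c^*%R *: adj A.
Proof. by apply/matrixP => i j; rewrite adjE !mxE rmorphM. Qed.

Lemma adjN A : adj (- A) = - adj A.
Proof. by apply/matrixP => i j; rewrite adjE !mxE rmorphN. Qed.

Lemma adjM A B : adj (A *m B) = adj B *m adj A.
Proof. exact: mulmx_conjt. Qed.

Lemma realC (r : R) : r%:C \is Num.real.
Proof. by apply/complex_realP; exists r. Qed.

(** [Y] is the derivative of [rho] along some curve of unitary matrices through 1
    with velocity [B]. *)
Definition dexp B Y := exists2 g : nat -> 'M[C]_n, (forall N, g N \is unitarymx) &
  jet g 1%:M B /\ jet (fun N => rho (g N)) 1%:M Y.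

(** Two curves with the same velocity stay at quadratic distance, and so do their
    images because [rho] is Lipschitz. *)
Lemma dexp_uniq B Y Y' : dexp B Y -> dexp B Y' -> Y = Y'.
Proof.
move=> [g gU [jg jY]] [g' gU' [jg' jY']].
have [K K0 HK] := rho_lipschitz rhoP rhoT.
apply: jet_uniq jY _ => a b; have := jY' a b.
have O : bigo 2 (fun N => rho (g N) a b - rho (g' N) a b).
  have Onrm : bigo 2 (fun N => nrm (g N - g' N)).
    rewrite /nrm; apply: bigo_sum => i; apply: bigo_sum => j.
    have := bigoD (jg i j) (bigoN (jg' i j)).
    apply: bigo_le (ler01) _ => N; rewrite mul1r normr_id !mxE.
    by rewrite opprB addrA subrK.
  apply: bigo_le K0 _ Onrm => N.
  rewrite (ger0_norm (nrm_ge0 _)); apply: le_trans (HK _ _ (gU N) (gU' N)).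
  by apply: le_trans (nrm_entry _ a b); rewrite !mxE.
by move=> J; apply: eq_bigo (bigoD O J) => N; rewrite addrA subrK.
Qed.

Lemma dexp_tor (a : 'I_n -> C) : (forall i, a i \is Num.real) ->
  dexp (tor (fun i => 'i%C * a i *+ 2))
       (tor (fun j => \sum_i 'i%C * a i *+ 2 *~ m j i)).
Proof.
move=> aR; exists (fun N => tor (fun i => cay (a i) N)).
  by move=> N; apply: tor_unitary => i; apply: norm_cay.
split; first exact: jet_tor_cay.
move=> j k; have E N : rho (tor (fun i => cay (a i) N)) =
    tor (fun j => \prod_i cay (a i) N ^ m j i).
  by rewrite rhoT // => i; apply: norm_cay.
rewrite !mxE; have [->|jk] := eqVneq j k.
  rewrite !mulr1n.
  have := sjet_prod1 (index_enum 'I_n) (fun i => sjet_cay_exprz (m k i) (aR i)).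
  by apply: eq_sjet => N; rewrite E !mxE eqxx mulr1n.
rewrite !mulr0n; apply: eq_sjet (sjet_const 0) => N.
by rewrite E !mxE (negPf jk) mulr0n.
Qed.

Lemma dexpJ u B Y : u \is unitarymx -> dexp B Y ->
  dexp (u *m B *m invmx u) (rho u *m Y *m rho (invmx u)).
Proof.
move=> uU [g gU [jg jY]]; have vU := invmx_unitarymx uU.
have ugU N : u *m g N \is unitarymx := mul_unitarymx uU (gU N).
exists (fun N => u *m g N *m invmx u) => [N|]; first exact: (mul_unitarymx (ugU N) vU).
split.
  have := jetM (jetM (jet_const u) jg) (jet_const (invmx u)).
  by rewrite mulmx1 mulmxV ?unitarymx_unit // mul0mx mulmx0 addr0 add0r.
have := jetM (jetM (jet_const (rho u)) jY) (jet_const (rho (invmx u))).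
rewrite mulmx1 rho_inv // mul0mx mulmx0 addr0 add0r.
by apply: eq_jet => N; rewrite (rhoM (ugU N) vU) (rhoM uU (gU N)).
Qed.

Lemma dexpD B Y B' Y' : dexp B Y -> dexp B' Y' -> dexp (B + B') (Y + Y').
Proof.
move=> [g gU [jg jY]] [g' gU' [jg' jY']].
exists (fun N => g N *m g' N) => [N|]; first exact: mul_unitarymx.
split.
  by have := jetM jg jg'; rewrite !mul1mx mulmx1 addrC.
have := jetM jY jY'; rewrite !mul1mx mulmx1 addrC.
by apply: eq_jet => N; rewrite rhoM.
Qed.

(** A skew-hermitian direction is unitarily diagonal, where the Cayley curve and
    its image are explicit; the same basis serves all real multiples. *)
Lemma dexp_skew_scale B : skew B -> exists Y, forall r : C, r \is Num.real ->
  dexp (r *: B) (r *: Y).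
Proof.
move=> Bs; have [P [a [PU aR EB]]] := skew_spectral Bs.
exists (rho (invmx P) *m tor (fun j => \sum_i 'i%C * a i *+ 2 *~ m j i) *m rho P) => r rR.
have := dexpJ (invmx_unitarymx PU) (dexp_tor (fun i => rpredM rR (aR i))).
rewrite invmxK; set T := tor _; set T' := tor _ => H.
have ET : T = r *: tor (fun i => 'i%C * a i *+ 2).
  apply/matrixP => i j; rewrite !mxE mulrnAr; congr (_ *+ _).
  by rewrite mulrCA mulrnAr.
have ET' : T' = r *: tor (fun j => \sum_i 'i%C * a i *+ 2 *~ m j i).
  apply/matrixP => i j; rewrite !mxE mulrnAr; congr (_ *+ _).
  by rewrite mulr_sumr; apply: eq_bigr => k _; rewrite mulrzAr mulrCA mulrnAr.
by move: H; rewrite ET ET' -!scalemxAr -!scalemxAl -EB.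
Qed.

Definition dskew B : 'M[C]_d := if pselect (skew B) is left Bs then
  projT1 (cid (dexp_skew_scale Bs)) else 0.

Lemma dskewP B : skew B -> dexp B (dskew B).
Proof.
move=> Bs; rewrite /dskew; case: pselect => // H.
by have := projT2 (cid (dexp_skew_scale H)) 1 (rpred1 _); rewrite !scale1r.
Qed.

Lemma skewD A B : skew A -> skew B -> skew (A + B).
Proof. by rewrite /skew adjD => -> ->; rewrite opprD. Qed.

Lemma skewZ r A : r \is Num.real -> skew A -> skew (r *: A).
Proof. by move=> rR; rewrite /skew adjZ => ->; rewrite (CrealP rR) scalerN. Qed.

Lemma dskewD A B : skew A -> skew B -> dskew (A + B) = dskew A + dskew B.
Proof.
move=> As Bs; apply: dexp_uniq (dskewP (skewD As Bs)) _.
by apply: dexpD; apply: dskewP.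
Qed.

Lemma dskewZ r A : r \is Num.real -> skew A -> dskew (r *: A) = r *: dskew A.
Proof.
move=> rR As; have [Y HY] := dexp_skew_scale As.
have -> : dskew A = Y.
  by apply: dexp_uniq (dskewP As) _; have := HY 1 (rpred1 _); rewrite !scale1r.
by apply: dexp_uniq (dskewP (skewZ rR As)) (HY r rR).
Qed.

Lemma dskewJ u A : u \is unitarymx -> skew A ->
  dskew (u *m A *m invmx u) = rho u *m dskew A *m rho (invmx u).
Proof.
move=> uU As; apply: dexp_uniq (dexpJ uU (dskewP As)).
apply: dskewP; rewrite /skew !invmx_unitary // -/(adj u) !adjM adjK As.
by rewrite mulNmx mulmxN mulmxA.
Qed.

Local Opaque dskew.

(** Every matrix is [S + i T] with [S] and [T] skew-hermitian, namely the
    [skew_part] of [X] and of [- i X]; the differential is extended to all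
    matrices by complex linearity. *)
Definition skew_part (X : 'M[C]_n) : 'M[C]_n := 2^-1 *: (X - adj X).
Definition drho X : 'M[C]_d :=
  dskew (skew_part X) + 'i%C *: dskew (skew_part (- 'i%C *: X)).

Lemma conj_i : ('i%C : C)^*%R = - 'i%C.
Proof. by rewrite -[LHS]/(conjc _) /=; simpc. Qed.

Lemma ii : 'i%C * 'i%C = -1 :> C.
Proof. by rewrite -expr2 sqr_i. Qed.

Lemma half_real : (2^-1 : C) \is Num.real.
Proof. by rewrite rpredV rpred_nat. Qed.

Lemma skew_partP X : skew (skew_part X).
Proof.
rewrite /skew /skew_part adjZ (CrealP half_real) adjD adjN adjK -scalerN.
by rewrite opprB addrC.
Qed.

Lemma skew_part_real r X : r \is Num.real -> skew_part (r *: X) = r *: skew_part X.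
Proof.
move=> rR; rewrite /skew_part adjZ (CrealP rR) -scalerBr !scalerA.
by rewrite [_ * r]mulrC.
Qed.

Lemma skew_partD X Y : skew_part (X + Y) = skew_part X + skew_part Y.
Proof. by rewrite /skew_part adjD -scalerDr opprD addrACA. Qed.

Local Opaque skew_part.

Lemma drhoD X Y : drho (X + Y) = drho X + drho Y.
Proof.
rewrite /drho scalerDr (skew_partD X Y) (skew_partD (- 'i%C *: X)).
rewrite (dskewD (skew_partP X) (skew_partP Y)).
rewrite (dskewD (skew_partP (- 'i%C *: X)) (skew_partP (- 'i%C *: Y))).
by rewrite scalerDr addrACA.
Qed.

Lemma drho_real r X : r \is Num.real -> drho (r *: X) = r *: drho X.
Proof.
move=> rR; rewrite /drho.
have -> : - 'i%C *: (r *: X) = r *: (- 'i%C *: X) by rewrite !scalerA mulrC.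
rewrite !(skew_part_real _ rR) (dskewZ rR (skew_partP X)) (dskewZ rR (skew_partP (- 'i%C *: X))).
by rewrite scalerDr !scalerA [r * _]mulrC.
Qed.

Lemma drho_i X : drho ('i%C *: X) = 'i%C *: drho X.
Proof.
have E : - 'i%C *: ('i%C *: X) = X by rewrite scalerA mulNr ii opprK scale1r.
have N1 : -1 \is @Num.real C by rewrite rpredN rpred1.
rewrite /drho E scalerDr scalerA ii scaleN1r addrC; congr (_ + _).
rewrite -scaleN1r -(dskewZ N1 (skew_partP _)) -(skew_part_real _ N1).
by rewrite scalerA mulrN mulNr mul1r opprK.
Qed.

Lemma drhoZ c X : drho (c *: X) = c *: drho X.
Proof.
rewrite [c]complexE scalerDl drhoD -scalerA drho_i !drho_real; last 2 first.
- exact: realC.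
- exact: realC.
by rewrite scalerA -scalerDl.
Qed.

Lemma drho_sum (I : Type) (r : seq I) (X : I -> 'M[C]_n) :
  drho (\sum_(i <- r) X i) = \sum_(i <- r) drho (X i).
Proof.
elim: r => [|i r IH]; last by rewrite !big_cons drhoD IH.
by rewrite !big_nil -[X in drho X](scale0r 0) drhoZ scale0r.
Qed.

Lemma drho_expand X : drho X = \sum_i \sum_j X i j *: drho (delta_mx i j).
Proof.
rewrite {1}[X]matrix_sum_delta drho_sum; apply: eq_bigr => i _.
by rewrite drho_sum; apply: eq_bigr => j _; rewrite drhoZ.
Qed.

Local Transparent skew_part.

Lemma drho_skew X : skew X -> drho X = dskew X.
Proof.
move=> Xs; have E : skew_part X = X.
  rewrite /skew_part Xs opprK -mulr2n -[X *+ 2]scaler_nat scalerA.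
  by rewrite mulVf ?pnatr_eq0 // scale1r.
have E0 : skew_part (- 'i%C *: X) = 0.
  rewrite /skew_part adjZ rmorphN /= conj_i opprK Xs scalerN scaleNr.
  by rewrite opprK addrC subrr scaler0.
rewrite /drho E E0.
have -> : dskew 0 = 0.
  by have := @dskewZ 0 0; rewrite !scale0r => -> //; rewrite /skew -[0](scale0r 0) adjZ rmorph0 !scale0r oppr0.
by rewrite scaler0 addr0.
Qed.

Local Opaque drho.

Lemma skew_ind (T : 'M[C]_n -> Prop) : (forall X, skew X -> T X) ->
  (forall c X Y, T X -> T Y -> T (c *: X + Y)) -> forall X, T X.
Proof.
move=> Ts TD X; have -> : X = 'i%C *: skew_part (- 'i%C *: X) + skew_part X.
  rewrite /skew_part adjZ rmorphN /= conj_i opprK; apply/matrixP => a b.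
  rewrite !mxE; set x := X a b; set y := Num.conj _.
  rewrite !mulNr -opprD -mulrDr mulrCA mulrN ['i%C * ('i%C * _)]mulrA ii mulN1r opprK.
  by rewrite -mulrDr addrACA subrr addr0 -mulr2n -[x *+ 2]mulr_natl mulKf ?pnatr_eq0.
by apply: TD; apply: Ts; apply: skew_partP.
Qed.

Lemma mulmx_conjD p q (A : 'M[C]_(p, q)) (B : 'M[C]_(q, p)) c (X Y : 'M[C]_q) :
  A *m (c *: X + Y) *m B = c *: (A *m X *m B) + A *m Y *m B.
Proof. by rewrite mulmxDr mulmxDl -scalemxAr -scalemxAl. Qed.

Lemma mulmx_bracketD p c (X X' Y : 'M[C]_p) :
  (c *: X + X') *m Y - Y *m (c *: X + X') =
  c *: (X *m Y - Y *m X) + (X' *m Y - Y *m X').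
Proof.
by rewrite mulmxDl mulmxDr -scalemxAl -scalemxAr opprD addrACA -scalerBr.
Qed.

(** Both sides are linear in [X], so that skew-hermitian matrices suffice. *)
Lemma drhoJ u X : u \is unitarymx ->
  drho (u *m X *m invmx u) = rho u *m drho X *m rho (invmx u).
Proof.
move=> uU; elim/skew_ind: X => [X Xs|c X Y IHX IHY].
  rewrite !drho_skew ?dskewJ //.
  by rewrite /skew !invmx_unitary // -/(adj u) !adjM adjK Xs mulNmx mulmxN mulmxA.
by rewrite mulmx_conjD !drhoD !drhoZ IHX IHY mulmx_conjD.
Qed.

Lemma jet_drho (F : nat -> 'M[C]_n) A B : jet F A B ->
  jet (fun N => drho (F N)) (drho A) (drho B).
Proof.
move=> J a b.
have E X : drho X a b = \sum_i \sum_j X i j * drho (delta_mx i j) a b.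
  rewrite {1}drho_expand summxE; apply: eq_bigr => i _; rewrite summxE.
  by apply: eq_bigr => j _; rewrite [LHS]mxE.
have S : sjet (fun N => \sum_i \sum_j F N i j * drho (delta_mx i j) a b)
    (\sum_i \sum_j A i j * drho (delta_mx i j) a b)
    (\sum_i \sum_j B i j * drho (delta_mx i j) a b).
  apply: sjet_sum => i; apply: sjet_sum => j.
  by have := sjetM (J i j) (sjet_const (drho (delta_mx i j) a b)); rewrite mulr0 add0r.
rewrite -(E A) -(E B) in S.
by apply: eq_sjet S => N; rewrite -(E (F N)).
Qed.

Lemma jetM1r p (F G : nat -> 'M[C]_p) A B B' : jet F A B -> jet G 1%:M B' ->
  jet (fun N => F N *m G N) A (A *m B' + B).
Proof. by move=> H H'; have := jetM H H'; rewrite !mulmx1. Qed.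

Lemma jetM1c p (F : nat -> 'M[C]_p) (A B : 'M[C]_p) : jet F 1%:M B ->
  jet (fun N => F N *m A) A (B *m A).
Proof. by move=> H; have := jetM H (jet_const A); rewrite !mul1mx add0r. Qed.

Lemma addr_subr p (a b c : 'M[C]_p) : a = b + c -> c = a - b.
Proof. by move=> ->; rewrite addrAC subrr add0r. Qed.

(** For skew-hermitian [X] this is the derivative of the equivariance
    [drho (g Y g^-1) rho g = rho g drho Y] along a curve [g] with velocity
    [X]. *)
Lemma drho_bracket X Y : drho (X *m Y - Y *m X) = drho X *m drho Y - drho Y *m drho X.
Proof.
elim/skew_ind: X => [X Xs|c X X' IH IH']; last first.
  by rewrite mulmx_bracketD (drhoD (c *: _)) (drhoZ _ (_ - _)) IH IH' (drhoD (c *: X)) drhoZ mulmx_bracketD.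
have [g gU [jg jX]] := dskewP Xs; rewrite -drho_skew // in jX.
(* The inverse of [g N] is its conjugate transpose, whose expansion is
   immediate. *)
have jg' := jet_conjt jg; have e1 : (1%:M^t*)%sesqui = 1%:M :> 'M[C]_n.
  by apply/matrixP => i j; rewrite !mxE eq_sym rmorph_nat.
rewrite e1 -/(adj X) Xs in jg'.
have J0 : jet (fun N => g N *m Y *m ((g N)^t*)%sesqui) Y (X *m Y - Y *m X).
  have := jetM (jetM jg (jet_const Y)) jg'.
  by rewrite !mul1mx !mulmx1 add0r mulmxN addrC.
have J2 := jetM1r (jet_drho J0) jX.
have J3 := jetM1c (drho Y) jX.
have EN N : drho (g N *m Y *m ((g N)^t*)%sesqui) *m rho (g N) = rho (g N) *m drho Y.
  by rewrite -(invmx_unitary (gU N)) (drhoJ _ (gU N)) -mulmxA (rho_invl rhoP (gU N)) mulmx1.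
have E := jet_uniq J3 (eq_jet EN J2).
exact: addr_subr E.
Qed.

Lemma drho_tor a : drho (tor a) = tor (fun j => \sum_i a i *~ m j i).
Proof.
have real_case (r : 'I_n -> C) : (forall i, r i \is Num.real) ->
    drho (tor (fun i => 'i%C * r i *+ 2)) = tor (fun j => \sum_i 'i%C * r i *+ 2 *~ m j i).
  move=> rR; have Ts : skew (tor (fun i => 'i%C * r i *+ 2)).
    rewrite /skew /adj conj_tor; apply/matrixP => i j; rewrite !mxE.
    by rewrite rmorphMn rmorphM /= conj_i (CrealP (rR i)) mulNr mulNrn mulNrn.
  by rewrite drho_skew //; apply: dexp_uniq (dskewP Ts) (dexp_tor rR).
pose x i : C := (complex.Im (a i) / 2)%:C.
pose y i : C := (- complex.Re (a i) / 2)%:C.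
have two (r : R) : (r / 2)%:C *+ 2 = r%:C :> C.
  by rewrite -rmorphMn /= -mulr_natr divfK ?pnatr_eq0.
have Ea i : a i = 'i%C * ('i%C * y i *+ 2) + 'i%C * x i *+ 2.
  rewrite -!mulrnAr !two mulrA ii rmorphN mulN1r opprK; exact: complexE.
have xR i : x i \is Num.real by apply: realC.
have yR i : y i \is Num.real by apply: realC.
have -> : tor a = 'i%C *: tor (fun i => 'i%C * y i *+ 2) + tor (fun i => 'i%C * x i *+ 2).
  by apply/matrixP => i j; rewrite !mxE; case: (i == j); rewrite ?mulr1n -?Ea // !mulr0n mulr0 addr0.
rewrite drhoD drhoZ (real_case y yR) (real_case x xR).
apply/matrixP => j k; rewrite !mxE.
case: (j == k); rewrite ?mulr1n; last by rewrite !mulr0n mulr0 addr0.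
rewrite mulr_sumr -big_split /=; apply: eq_bigr => i _.
by rewrite [in RHS](Ea i); exact: mulrz_lin.
Qed.

End Differential.

(** * The Weyl character formula for the unitary group *)

Lemma int_interpolation (C : numFieldType) (s : seq int) (f : int -> C) :
  uniq s -> exists p : {poly C}, forall k, k \in s -> p.[k%:~R] = f k.
Proof.
elim: s => [_|k s IH /= /andP [ks us]]; first by exists 0.
have [p Hp] := IH us; pose q : {poly C} := \prod_(j <- s) ('X - (j%:~R)%:P).
have qE (k' : int) : (q.[k'%:~R] == 0) = (k' \in s).
  rewrite /q horner_prod; elim: (s) => [|j s' IHs]; first by rewrite big_nil oner_eq0.
  by rewrite big_cons mulf_eq0 hornerXsubC subr_eq0 eqr_int inE IHs.
exists (p + ((f k - p.[k%:~R]) / q.[k%:~R]) *: q) => k'.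
rewrite inE => /orP [/eqP ->|k's].
  by rewrite hornerD hornerZ divfK ?qE // addrC subrK.
have /eqP -> : (p + ((f k - p.[k%:~R]) / q.[k%:~R]) *: q).[k'%:~R] == p.[k'%:~R].
  by rewrite hornerD hornerZ -subr_eq0 addrAC subrr add0r mulf_eq0 qE k's orbT.
exact: Hp.
Qed.

Lemma irreducible_rep_conj (R : realType) n d (rho : 'M[R[i]]_n -> 'M[R[i]]_d) B : B \in unitmx ->
  irreducible_rep rho -> irreducible_rep (fun g => B *m rho g *m invmx B).
Proof.
move=> Bu [d0 irr]; split=> // W HW.
pose f := linfun (mulmx (invmx B) : 'cV[R[i]]_d -> 'cV[R[i]]_d).
have fE u : f u = invmx B *m u by rewrite lfunE.
have [g gU v /memv_imgP [w wW ->]|W0|Wf] := irr (f @: W)%VS.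
- apply/memv_imgP; exists (B *m rho g *m invmx B *m w); first exact: HW.
  by rewrite (fE w) (fE (_ *m w)) -!mulmxA (mulKmx Bu).
- left; apply/eqP; rewrite -subv0; apply/subvP => w wW.
  have : f w \in 0%VS by rewrite -W0 memv_img.
  rewrite !memv0 fE => /eqP E.
  by rewrite -[w](mulKVmx Bu) E mulmx0.
right; apply/eqP; rewrite eqEsubv subvf; apply/subvP => w _.
have : invmx B *m w \in (f @: W)%VS by rewrite Wf memvf.
move=> /memv_imgP [w' wW']; rewrite fE => /(congr1 (mulmx B)).
by rewrite !mulmxA mulmxV // !mul1mx => ->.
Qed.

Lemma continuous_cont_rep (R : realType) n d (rho : 'M[R[i]]_n -> 'M[R[i]]_d) :
  continuous_rep rho -> cont_rep rho.
Proof.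
move=> [r1 rM rc]; split=> // e e0.
have c0 : 0 < (d * d)%:R + 1 :> R[i] by rewrite ltr_wpDl ?ler0n.
have e1 : 0 < e / ((d * d)%:R + 1) by rewrite divr_gt0.
move/subspace_continuousP: rc => /(_ (1%:M : 'M[R[i]^o]_n) (unitary1 _ _)).
have N1 : nbhs (rho (1%:M : 'M[R[i]^o]_n) : 'M[R[i]^o]_d) (ball (1%:M : 'M[R[i]^o]_d) (e / ((d * d)%:R + 1))).
  exact: (eq_ind_r (fun x : 'M[R[i]^o]_d => nbhs x (ball (1%:M : 'M[R[i]^o]_d) _))
    (nbhsx_ballx _ _ e1) r1).
move=> /(_ _ N1) /=.
rewrite /within /= => /nbhs_ballP [h /= h0 H]; exists (h / 2) => [|g gU gh].
  by rewrite divr_gt0 ?ltr0n.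
have /H : ball (1%:M : 'M[R[i]^o]_n) h g.
  split=> // i j; rewrite -ball_normE /= distrC.
  apply: (@le_lt_trans _ _ (h / 2)).
    by apply: le_trans gh; apply: le_trans (nrm_entry _ i j); rewrite !mxE.
  by rewrite ltr_pdivrMr ?ltr0n // mulr_natr mulr2n ltrDl.
move=> /(_ gU) [_ He].
apply: le_trans (nrm_le (e := e / ((d * d)%:R + 1)) _) _.
  move=> i j; have := He i j; rewrite -ball_normE /= distrC => /ltW.
  by rewrite !mxE.
rewrite mulrCA ger_pMr // ler_pdivrMr // mul1r lerDl.
exact: ler01.
Qed.

Section LieInvariant.
Variable R : realType.
Local Notation C := R[i].
Variables (n d : nat) (rho : 'M[C]_n -> 'M[C]_d).
Hypothesis rhoP : cont_rep rho.
Variable m : 'I_d -> 'I_n -> int.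
Hypothesis rhoT : forall z, (forall i, `|z i| = 1) ->
  rho (tor z) = diag_mx (\row_j \prod_i z i ^ m j i).
Hypothesis irr : irreducible_rep rho.

Local Opaque drho.

Let E i j : 'M[C]_d := drho rhoP rhoT (delta_mx i j).

Lemma drho_delta_bracket i j k l : E i j *m E k l - E k l *m E i j =
  (j == k)%:R *: E i l - (l == i)%:R *: E k j.
Proof.
have drhoMn X b : drho rhoP rhoT (X *+ b) = b%:R *: drho rhoP rhoT X.
  by rewrite -scaler_nat drhoZ.
have drhoB X Y : drho rhoP rhoT (X - Y) = drho rhoP rhoT X - drho rhoP rhoT Y.
  by rewrite -[- Y]scaleN1r drhoD drhoZ scaleN1r.
rewrite /E -(drho_bracket rhoP rhoT) !mul_delta_mx_cond drhoB.
by rewrite (drhoMn (delta_mx i l)) (drhoMn (delta_mx k j)).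
Qed.

Lemma drho_delta_diag i : E i i = diag_mx (\row_a (m a i)%:~R).
Proof.
have -> : E i i = drho rhoP rhoT (tor (fun k => (k == i)%:R)).
  congr drho; apply/matrixP => a b; rewrite !mxE.
  by case: (a =P b) => [->|]; case: (_ =P i) => //= <-; case: eqP => // ->.
rewrite drho_tor; congr diag_mx; apply/rowP => a; rewrite !mxE (bigD1 i) //= eqxx.
by rewrite big1 ?addr0 // => k /negPf ->; rewrite mul0rz.
Qed.

(** A unitary matrix is [P^-1 diag(z) P]; its image is a product of conjugates of
    the matrices [diag(z_i ^ m_a)], each of them a polynomial in the differential
    of [P^-1 delta_ii P].  Irreducibility of the group representation thus passes
    to the Lie algebra. *)
Lemma drho_invariant (W : {vspace 'cV[C]_d}) :
  (forall i j v, v \in W -> E i j *m v \in W) ->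
  forall g, g \is unitarymx -> forall v, v \in W -> rho g *m v \in W.
Proof.
move=> HW; pose S (A : 'M[C]_d) := forall v : 'cV[C]_d, v \in W -> A *m v \in W.
have SM A A' : S A -> S A' -> S (A *m A').
  by move=> HA HA' v vW; rewrite -mulmxA; apply/HA/HA'.
have SD A A' : S A -> S A' -> S (A + A').
  by move=> HA HA' v vW; rewrite mulmxDl rpredD ?HA ?HA'.
have S1 c : S c%:M by move=> v vW; rewrite mul_scalar_mx rpredZ.
have SdX X : S (drho rhoP rhoT X).
  move=> v vW; rewrite drho_expand mulmx_suml rpred_sum // => i _.
  rewrite mulmx_suml rpred_sum // => j _; rewrite -scalemxAl rpredZ //.
  exact: HW.
move=> g gU; have [P [z [PU z1 Eg]]] := unitary_spectral gU.
have PVU := invmx_unitarymx PU.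
pose T A := S (rho (invmx P) *m A *m rho P).
have TM A A' : T A -> T A' -> T (A *m A').
  move=> HA HA'; have := SM _ _ HA HA'; rewrite /T.
  have -> : rho (invmx P) *m A *m rho P *m (rho (invmx P) *m A' *m rho P) =
      rho (invmx P) *m A *m (rho P *m rho (invmx P)) *m A' *m rho P.
    by rewrite !mulmxA.
  by rewrite (rho_inv rhoP PU) mulmx1 -(mulmxA _ A A').
have TD A A' : T A -> T A' -> T (A + A').
  by move=> HA HA'; rewrite /T mulmxDr mulmxDl; apply: SD.
have T1 c : T c%:M.
  by rewrite /T scalar_mxC -mulmxA (rho_invl rhoP PU) mulmx1; apply: S1.
have Tdiag i : T (diag_mx (\row_a (m a i)%:~R)).
  rewrite -drho_delta_diag; have := drhoJ rhoP rhoT (delta_mx i i) PVU.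
  by rewrite invmxK /T => <-; apply: SdX.
have Tpoly i (p : {poly C}) : T (diag_mx (\row_a p.[(m a i)%:~R])).
  elim/poly_ind: p => [|p c IH].
    have -> : diag_mx (\row_a (0 : {poly C}).[(m a i)%:~R]) = 0%:M.
      by apply/matrixP => a b; rewrite !mxE horner0.
    exact: T1.
  have -> : diag_mx (\row_a (p * 'X + c%:P).[(m a i)%:~R]) =
      diag_mx (\row_a p.[(m a i)%:~R]) *m diag_mx (\row_a (m a i)%:~R) + c%:M.
    by rewrite mulmx_diag; apply/matrixP => a b; rewrite !mxE !hornerE -mulrnDl.
  exact: TD (TM _ _ IH (Tdiag i)) (T1 c).
(* The weights take finitely many values [k], at which [z_i ^ k] agrees with a
   polynomial in [k]. *)
have Tpow i : T (diag_mx (\row_a z i ^ m a i)).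
  have [p Hp] := int_interpolation (fun k => z i ^ k) (undup_uniq [seq m a i | a <- enum 'I_d]).
  have -> : diag_mx (\row_a z i ^ m a i) = diag_mx (\row_a p.[(m a i)%:~R]).
    congr diag_mx; apply/rowP => a; rewrite !mxE Hp // mem_undup.
    by apply/mapP; exists a; rewrite ?mem_enum.
  exact: Tpoly.
have Tprod (s : seq 'I_n) : T (diag_mx (\row_a \prod_(i <- s) z i ^ m a i)).
  elim: s => [|i s IH].
    have -> : diag_mx (\row_a \prod_(i <- [::]) z i ^ m a i) = 1%:M.
      by apply/matrixP => a b; rewrite !mxE big_nil.
    exact: T1.
  have -> : diag_mx (\row_a \prod_(i <- i :: s) z i ^ m a i) =
      diag_mx (\row_a z i ^ m a i) *m diag_mx (\row_a \prod_(i <- s) z i ^ m a i).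
    by rewrite mulmx_diag; congr diag_mx; apply/rowP => a; rewrite !mxE big_cons.
  exact: TM _ _ (Tpow i) IH.
have -> : rho g = rho (invmx P) *m rho (tor z) *m rho P.
  rewrite Eg (cont_repM rhoP (unitaryM PVU (tor_unitary z1)) PU).
  by rewrite (cont_repM rhoP PVU (tor_unitary z1)).
by rewrite rhoT //; apply: Tprod.
Qed.

Lemma trace_conj u g : u \is unitarymx -> g \is unitarymx ->
  \tr (rho (u *m g *m invmx u)) = \tr (rho g).
Proof.
move=> uU gU; have vU := invmx_unitarymx uU.
rewrite (cont_repM rhoP (unitaryM uU gU) vU) (cont_repM rhoP uU gU).
by rewrite mxtrace_mulC mulmxA rho_invl // mul1mx.
Qed.

Lemma trace_tor z : (forall i, `|z i| = 1) -> \tr (rho (tor z)) = chi m z.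
Proof.
by move=> z1; rewrite rhoT // mxtrace_diag; apply: eq_bigr => a _; rewrite mxE.
Qed.

Lemma perm_mx_unitary (s : 'S_n) : (perm_mx s : 'M[C]_n) \is unitarymx.
Proof.
apply/unitarymxP; have -> : ((perm_mx s : 'M[C]_n)^t*)%sesqui = perm_mx s^-1.
  rewrite tr_perm_mx; apply/matrixP => i j; rewrite !mxE.
  by rewrite rmorph_nat.
by rewrite -perm_mxM mulgV perm_mx1.
Qed.

Lemma tor_perm (s : 'S_n) (z : 'I_n -> C) :
  tor (fun i => z (s i)) = perm_mx s *m tor z *m invmx (perm_mx s).
Proof.
have su : (perm_mx s : 'M[C]_n) \in unitmx := unitarymx_unit (perm_mx_unitary s).
apply: (canRL (mulmxK su)); rewrite -row_permE -[X in _ = row_perm _ X]mulmx1.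
apply/matrixP => i j; rewrite /tor mul_diag_mx mulmx1 !mxE.
by rewrite mulr_natr.
Qed.

(** Permutation matrices are unitary, and conjugation by them permutes the
    coordinates of the torus. *)
Lemma trace_symmetric : @chi_symmetric C n d m.
Proof.
move=> s z z1; rewrite -!trace_tor // tor_perm trace_conj ?tor_unitary //.
exact: perm_mx_unitary.
Qed.

Theorem weyl_formula_torus : exists2 l : 'I_n -> int,
  forall i j : 'I_n, (i < j)%N -> l i < l j &
  forall z : 'I_n -> C, (forall i, `|z i| = 1) ->
    vdm z * \tr (rho (tor z)) = \det (\matrix_(i, j) z j ^ l i).
Proof.
have [d0 Hirr] := irr.
have [|l lS H] := weyl_formula drho_delta_bracket drho_delta_diag _ d0 trace_symmetric.
  by move=> W HW; apply: Hirr => g gU v; apply: drho_invariant.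
by exists l => // z z1; rewrite trace_tor // H.
Qed.

End LieInvariant.

(** * The dimension formula and the bound across blocks *)

Section Limits.
Variable R : realType.
Local Notation C := R[i].

(** Convergence at the rate [1 / (N + 1)]. *)
Definition lim1 (u : nat -> C) (a : C) := bigo 1 (fun N => u N - a).

Lemma lim1_const a : lim1 (fun=> a) a.
Proof. by apply: eq_bigo (bigo0 R 1) => N; rewrite subrr. Qed.

Lemma lim1D u v a b : lim1 u a -> lim1 v b -> lim1 (fun N => u N + v N) (a + b).
Proof. by move=> Hu Hv; apply: eq_bigo (bigoD Hu Hv) => N; ring. Qed.

Lemma lim1M u v a b : lim1 u a -> lim1 v b -> lim1 (fun N => u N * v N) (a * b).
Proof.
move=> Hu Hv.
have bv : bigo 0 v.
  have := bigoD (bigo_weak (leq0n 1) Hv) (bigo_const b).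
  by apply: eq_bigo => N; rewrite subrK.
have H1 := bigoM Hu bv; have H2 := bigoM (bigo_const a) Hv.
by apply: eq_bigo (bigoD H1 H2) => N; ring.
Qed.

Lemma eq_lim1 u v a : u =1 v -> lim1 u a -> lim1 v a.
Proof. by move=> uv; apply: eq_bigo => N; rewrite uv. Qed.

Lemma lim1_sum (I : Type) (r : seq I) (P : pred I) (u : I -> nat -> C) a :
  (forall i, P i -> lim1 (u i) (a i)) ->
  lim1 (fun N => \sum_(i <- r | P i) u i N) (\sum_(i <- r | P i) a i).
Proof.
move=> H; elim: r => [|i r IH].
  by rewrite big_nil; apply: eq_lim1 (lim1_const 0) => N; rewrite big_nil.
rewrite big_cons; case: ifP => Pi.
  by apply: eq_lim1 (lim1D (H i Pi) IH) => N; rewrite big_cons Pi.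
by apply: eq_lim1 IH => N; rewrite big_cons Pi.
Qed.

Lemma lim1_prod (I : Type) (r : seq I) (P : pred I) (u : I -> nat -> C) a :
  (forall i, P i -> lim1 (u i) (a i)) ->
  lim1 (fun N => \prod_(i <- r | P i) u i N) (\prod_(i <- r | P i) a i).
Proof.
move=> H; elim: r => [|i r IH].
  by rewrite big_nil; apply: eq_lim1 (lim1_const 1) => N; rewrite big_nil.
rewrite big_cons; case: ifP => Pi.
  by apply: eq_lim1 (lim1M (H i Pi) IH) => N; rewrite big_cons Pi.
by apply: eq_lim1 IH => N; rewrite big_cons Pi.
Qed.

Lemma lim1_norm u a : lim1 u a -> lim1 (fun N => `|u N|) `|a|.
Proof. by move=> Hu; apply: (bigo_le ler01 _ Hu) => N; rewrite mul1r ler_dist_dist. Qed.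

Lemma lim1_uniq u a b : lim1 u a -> lim1 u b -> a = b.
Proof.
move=> Ha Hb; apply/eqP; rewrite -subr_eq0; apply/eqP/bigo1_const0.
by apply: eq_bigo (bigoD Hb (bigoN Ha)) => N; ring.
Qed.

Lemma sjet_lim1 u a b : sjet u a b -> lim1 u a.
Proof.
move=> H; have := bigoD (bigo_weak (ltnW (ltnSn 1)) H) (bigoM (bigo_const b) (bigo_eps R)).
by apply: eq_bigo => N; ring.
Qed.

Lemma sjet_quotient u b : sjet u 0 b -> lim1 (fun N => u N / eps R N) b.
Proof.
move=> [K K0 HK]; exists K => // N.
have e0 := eps_gt0 R N; have := HK N.
have -> : u N - (0 + b * eps R N) = (u N / eps R N - b) * eps R N.
  by field; rewrite gt_eqF.
by rewrite normrM (ger0_norm (ltW e0)) expr1 exprS expr1 mulrA ler_pM2r.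
Qed.

Lemma lim1_le_often u a (B : C) : lim1 u a -> 0 <= a -> (forall N, 0 <= u N) ->
  (forall N0, exists2 N, (N0 <= N)%N & u N <= B) -> a <= B.
Proof.
move=> [K K0 HK] a0 u0 H; apply/ler_addgt0Pr => e e0.
have [N0 HN0] := eps_small K0 e0; have [N NN0 uB] := H N0.
rewrite -[a](subrK (u N)) [B + e]addrC; apply: lerD => //.
apply: le_trans (HN0 N NN0); apply: le_trans (HK N); rewrite distrC.
by rewrite real_ler_norm // rpredB ?ger0_real.
Qed.

Lemma cay_circle N : `|cay (1 : C) N| = 1.
Proof. by rewrite norm_cay ?rpred1. Qed.

Lemma cay_neq0 N : cay (1 : C) N != 0.
Proof. by rewrite -normr_gt0 cay_circle. Qed.

Lemma sjet_cayz (m : int) : sjet (fun N => cay (1 : C) N ^ m) 1 ('i%C *+ 2 *~ m).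
Proof. by have := @sjet_cay_exprz R 1 m (rpred1 _); rewrite mulr1. Qed.

Lemma cay_inj : injective (cay (1 : C)).
Proof.
have r1 : (1 : C) \is Num.real by exact: rpred1.
have d0 N := cayden_neq0 r1 N.
move=> k l /eqP; rewrite /cay eqr_div ?d0 // !mulr1 => /eqP Ekl.
have : 'i%C *+ 2 * (eps R k - eps R l) = 0.
  transitivity ((1 + 'i%C * eps R k) * (1 - 'i%C * eps R l) -
    (1 + 'i%C * eps R l) * (1 - 'i%C * eps R k)); first by ring.
  by rewrite Ekl subrr.
move/eqP; rewrite mulf_eq0 mulrn_eq0 /= eq_complex /= oner_eq0 andbF /= subr_eq0.
by move=> /eqP /invr_inj /eqP; rewrite eqr_nat => /eqP [].
Qed.

Lemma poly_cay_often (p : {poly C}) : p != 0 ->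
  forall N0, exists2 N, (N0 <= N)%N & p.[cay 1 N] != 0.
Proof.
move=> p0 N0; pose rs := [seq cay (1 : C) k | k <- iota N0 (size p)].
have [/allP H|/allPn [x /mapP [k kN ->] kr]] := boolP (all (root p) rs); last first.
  by move: kN; rewrite mem_iota => /andP [kN _]; exists k.
have F := @max_poly_roots _ p rs p0; rewrite size_map size_iota ltnn in F.
suff : false by []; apply: F; first exact/allP.
by rewrite map_inj_uniq ?iota_uniq //; exact: cay_inj.
Qed.

End Limits.

Section CharacterBounds.
Variable R : realType.
Local Notation C := R[i].
Variables (n d : nat) (m : 'I_d -> 'I_n -> int) (l : 'I_n -> int).
Hypothesis lS : forall i j : 'I_n, (i < j)%N -> l i < l j.
Hypothesis weyl : forall z : 'I_n -> C, (forall i, `|z i| = 1) ->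
  vdm z * chi m z = \det (\matrix_(i, j) z j ^ l i).

(** The exponents [l] translated into the natural numbers; the translation only
    multiplies the alternant by a number of modulus 1. *)
Definition lnat (i : 'I_n) : nat := absz (l i + (\sum_j `|l j|)%N%:Z).

Lemma lnatE i : (lnat i)%:Z = l i + (\sum_j `|l j|)%N%:Z.
Proof.
rewrite /lnat gez0_abs //; have : (`|l i| <= \sum_j `|l j|)%N.
  by rewrite (bigD1 i) //= leq_addr.
by lia.
Qed.

Lemma lnat_ltn (i j : 'I_n) : (i < j)%N -> (lnat i < lnat j)%N.
Proof. by move=> /lS; rewrite -ltz_nat !lnatE ltrD2r. Qed.

Lemma lnat_inj : injective lnat.
Proof.
move=> i j E; apply/val_inj; case: (ltngtP i j) => // /lnat_ltn; rewrite E ltnn //.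
Qed.

(** On [z_j = q^j] the alternant is itself a Vandermonde product, in the numbers
    [q^(l_i)].  Dividing each factor of the Weyl formula by [eps] and letting [q]
    tend to 1 along the Cayley curve gives the Weyl dimension formula. *)
Lemma dimension_formula : (d * gap (fun i : 'I_n => i : nat))%N = gap lnat.
Proof.
pose q := cay (1 : C).
have q1 N : `|q N| = 1 by exact: cay_circle.
have q0 N : q N != 0 by exact: cay_neq0.
pose dq (a b : int) N := (q N ^ b - q N ^ a) / eps R N.
have dqL a b : lim1 (dq a b) ('i%C *+ 2 * (b - a)%:~R).
  rewrite mulrzr; apply: sjet_quotient.
  have := sjetD (sjet_cayz R b) (sjetM (sjet_const (-1)) (sjet_cayz R a)).
  rewrite !mulr1 subrr addr0 mulN1r -mulrzBr.
  by apply: eq_sjet => N; rewrite mulN1r.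
pose pairs (f : 'I_n -> 'I_n -> C) := \prod_(i < n) \prod_(j < n | (i < j)%N) f i j.
have pairsL (f : 'I_n -> int) : lim1 (fun N => pairs (fun i j => dq (f i) (f j) N))
    (pairs (fun i j => 'i%C *+ 2 * (f j - f i)%:~R)).
  by apply: lim1_prod => i _; apply: lim1_prod => j _; apply: dqL.
pose zq N (i : 'I_n) : C := q N ^+ i.
have zq1 N i : `|zq N i| = 1 by rewrite normrX q1 expr1n.
have chiL : lim1 (fun N => chi m (zq N)) d%:R.
  have -> : d%:R = \sum_(a < d) \prod_(i < n) 1 :> C.
    by under eq_bigr do rewrite big1 //; rewrite sumr_const card_ord.
  apply: lim1_sum => a _; apply: lim1_prod => i _.
  apply: eq_lim1 (sjet_lim1 (sjet_cayz R (i%:Z * m a i))) => N.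
  by rewrite /zq -exprz_exp.
have weylN N : pairs (fun i j => dq i%:Z j%:Z N) * chi m (zq N) =
    pairs (fun i j => dq (l i) (l j) N).
  have e0 : eps R N != 0 by rewrite gt_eqF ?eps_gt0.
  have pairs_div (f : 'I_n -> 'I_n -> C) :
      pairs (fun i j => f i j / eps R N) = pairs f * pairs (fun _ _ => (eps R N)^-1).
    by rewrite /pairs -big_split; apply: eq_bigr => i _; rewrite -big_split.
  rewrite !pairs_div mulrAC; congr (_ * _).
  transitivity (vdm (zq N) * chi m (zq N)); first by [].
  rewrite weyl //; transitivity (\det (Vandermonde n (\row_i q N ^ l i))).
    rewrite -det_tr; congr (\det _); apply/matrixP => i j; rewrite !mxE /zq.
    exact: exprzAC (q N) i (l j).
  rewrite det_Vandermonde; apply: eq_bigr => i _; apply: eq_bigr => j _.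
  by rewrite !mxE.
have E := lim1_uniq (eq_lim1 weylN (lim1M (pairsL (fun i => i%:Z)) chiL)) (pairsL l).
have i0 : 'i%C *+ 2 != 0 :> C by rewrite mulrn_eq0 /= eq_complex /= oner_eq0 andbF.
have pairs_gap (f : 'I_n -> int) (g : 'I_n -> nat) c : (forall i, (g i)%:Z = f i + c) ->
   (forall i j : 'I_n, (i < j)%N -> (g i < g j)%N) ->
   pairs (fun i j => 'i%C *+ 2 * (f j - f i)%:~R) =
   pairs (fun _ _ => 'i%C *+ 2) * (gap g)%:R.
  move=> gf gS; rewrite /pairs /gap natr_prod -big_split; apply: eq_bigr => i _ /=.
  rewrite natr_prod -big_split; apply: eq_bigr => j ij /=; congr (_ * _).
  have -> : f j - f i = (g j)%:Z - (g i)%:Z by rewrite !gf; ring.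
  rewrite -[(g j)%:Z - _]gez0_abs // subr_ge0 lez_nat.
  exact/ltnW/gS.
move: E; rewrite (pairs_gap _ (fun i : 'I_n => i : nat) 0) => [|i|//]; last by rewrite addr0.
have p0 : pairs (fun _ _ => 'i%C *+ 2) != 0.
  by apply/prodf_neq0 => i _; apply/prodf_neq0.
rewrite (pairs_gap _ lnat _ lnatE lnat_ltn) -mulrA => /(mulfI p0).
by rewrite -natrM mulnC => /eqP; rewrite eqr_nat => /eqP.
Qed.

Lemma norm_det_shift (z : 'I_n -> C) : (forall i, `|z i| = 1) ->
  `|\det (\matrix_(i, j) z j ^ l i)| = `|\det (\matrix_(i, j) z j ^+ lnat i)|.
Proof.
move=> z1; have z0 i : z i != 0 by rewrite -normr_gt0 z1.
have -> : \matrix_(i, j) z j ^+ lnat i =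
   \matrix_(i, j) (z j ^ (\sum_j `|l j|)%N%:Z * (\matrix_(i, j) z j ^ l i) i j).
  apply/matrixP => i j; rewrite !mxE exprnP lnatE.
  by rewrite -expfzDr // addrC.
rewrite det_scale_cols normrM normr_prod big1 ?mul1r // => i _.
by rewrite norm_unit_exprz.
Qed.

End CharacterBounds.

Definition block_sum k k' (L : 'I_(k + k') -> nat) : nat := (\sum_(s : 'S_(k + k'))
     gap (L \o s \o @lshift k k') * gap (L \o s \o @rshift k k'))%N.

Section BlockBound.
Variable R : realType.
Local Notation C := R[i].
Variables (k k' d : nat) (m : 'I_d -> 'I_(k + k') -> int) (l : 'I_(k + k') -> int).
Hypothesis lS : forall i j : 'I_(k + k'), (i < j)%N -> l i < l j.
Hypothesis weyl : forall z : 'I_(k + k') -> C, (forall i, `|z i| = 1) ->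
  vdm z * chi m z = \det (\matrix_(i, j) z j ^ l i).

Let L := lnat l.

Definition cross (z : 'I_(k + k') -> C) : C :=
  \prod_(i < k) \prod_(j < k') `|z (rshift k j) - z (lshift k' i)|.

Lemma norm_vdm (z : 'I_(k + k') -> C) : `|vdm z| = gapn z.
Proof.
by rewrite /vdm normr_prod; apply: eq_bigr => i _; rewrite normr_prod.
Qed.

(** In the Weyl formula, [norm_det_powers_blocks] bounds the alternant by the
    part of the Vandermonde product internal to the two blocks; dividing by it
    leaves the factors across the blocks. *)
Lemma chi_bound_regular (z : 'I_(k + k') -> C) : (forall i, `|z i| = 1) -> vdm z != 0 ->
  `|chi m z| * cross z <= (block_sum L)%:R.
Proof.
move=> z1 vz; have := norm_det_powers_blocks L z1; rewrite -norm_det_shift // -weyl // normrM.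
have : gapn z != 0 by rewrite -norm_vdm normr_eq0.
rewrite norm_vdm gapn_split -/(cross z) !mulf_eq0 !negb_or => /andP [/andP [q0 r0] c0].
set q := gapn (_ \o _) in q0 *; set r := gapn (_ \o _) in r0 *.
have q1 : 0 < q by rewrite lt_neqAle eq_sym q0 prodr_ge0 // => i _; rewrite prodr_ge0.
have r1 : 0 < r by rewrite lt_neqAle eq_sym r0 prodr_ge0 // => i _; rewrite prodr_ge0.
by rewrite -!mulrA !(ler_pM2l q1, ler_pM2l r1) mulrC.
Qed.

(** The points [z_j q^j] are regular for infinitely many [q] tending to 1. *)
Lemma chi_bound (z : 'I_(k + k') -> C) : (forall i, `|z i| = 1) ->
  `|chi m z| * cross z <= (block_sum L)%:R.
Proof.
move=> z1; have z0 i : z i != 0 by rewrite -normr_gt0 z1.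
pose q := cay (1 : C); pose zq N (i : 'I_(k + k')) := z i * q N ^+ i.
have zq1 N i : `|zq N i| = 1 by rewrite normrM normrX cay_circle expr1n z1 mulr1.
have qL i : lim1 (fun N => q N ^+ i) 1 := sjet_lim1 (sjet_cayz R i%:Z).
have zqL i : lim1 (fun N => zq N i) (z i).
  by have := lim1M (lim1_const (z i)) (qL i); rewrite mulr1.
have chiL : lim1 (fun N => chi m (zq N)) (chi m z).
  apply: lim1_sum => a _; apply: lim1_prod => i _.
  have := lim1M (lim1_const (z i ^ m a i)) (sjet_lim1 (sjet_cayz R (i%:Z * m a i))).
  by rewrite mulr1; apply: eq_lim1 => N; rewrite /zq (expfzMl (z i)) -exprz_exp.
have crossL : lim1 (fun N => cross (zq N)) (cross z).
  apply: lim1_prod => i _; apply: lim1_prod => j _; apply: lim1_norm.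
  have := lim1D (zqL (rshift k j)) (lim1M (lim1_const (-1)) (zqL (lshift k' i))).
  by rewrite mulN1r; apply: eq_lim1 => N; rewrite mulN1r.
have cross0 w : 0 <= cross w by rewrite prodr_ge0 // => i _; rewrite prodr_ge0.
apply: (lim1_le_often (lim1M (lim1_norm chiL) crossL)) => [|N|N0].
- by rewrite mulr_ge0.
- by rewrite mulr_ge0.
pose p : {poly C} := \prod_(i < k + k') \prod_(j < k + k' | (i < j)%N)
   (z j *: 'X^j - z i *: 'X^i).
have p0 : p != 0.
  apply/prodf_neq0 => i _; apply/prodf_neq0 => j ij.
  apply/eqP => /(congr1 (fun p : {poly C} => p`_j)) /eqP.
  by rewrite coefB !coefZ !coefXn eqxx coef0 gtn_eqF // mulr0 subr0 mulr1 (negPf (z0 j)).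
have [N NN0 pN] := poly_cay_often p0 N0; exists N => //.
apply: chi_bound_regular => //.
suff -> : vdm (zq N) = p.[q N] by [].
rewrite /p horner_prod; apply: eq_bigr => i _; rewrite horner_prod.
by apply: eq_bigr => j _; rewrite hornerD hornerN !hornerZ !hornerXn.
Qed.

End BlockBound.

(** * Comparison of exponents *)

Lemma gap_gt0 k (l : 'I_k -> nat) : injective l -> (0 < gap l)%N.
Proof.
move=> li; rewrite /gap prodn_gt0 // => i; rewrite prodn_cond_gt0 // => j ij.
by rewrite absz_gt0 subr_eq0 eqz_nat (inj_eq li) -(inj_eq val_inj) gtn_eqF.
Qed.

Lemma gap_ord_sqr_le n : (gap (fun i : 'I_n => i : nat) ^ 2 <= n ^ (n * n))%N.
Proof.
rewrite gap_sqr; apply: (@leq_trans (\prod_(i < n) \prod_(j < n) n)%N).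
  apply: leq_prod => i _; rewrite big_mkcond; apply: leq_prod => j _ /=.
  case: ifP => _; last exact: leq_trans (ltn_ord i).
  by have := ltn_ord i; have := ltn_ord j; lia.
by rewrite !prod_nat_const !card_ord -expnM.
Qed.

Lemma card_perm_le n : (#|{: 'S_n}| <= n ^ n)%N.
Proof.
rewrite -[n in X in (_ <= X ^ _)%N]card_ord -[n in X in (_ <= _ ^ X)%N]card_ord -card_ffun.
exact: (leq_card (@pval _) val_inj).
Qed.

Section Numeric.
Variable R : realType.

Lemma ln_natX (a b : nat) : ln ((a ^ b)%N%:R : R) = b%:R * ln (a%:R : R).
Proof.
case: a => [|a].
  case: b => [|b]; first by rewrite expn0 ln1 mul0r.
  by rewrite exp0n // ln0 // mulr0.
by rewrite natrX lnXn ?ltr0n // mulr_natl.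
Qed.

Lemma ln_nat_le (a b : nat) : (0 < a)%N -> (a <= b)%N -> ln (a%:R : R) <= ln (b%:R : R).
Proof.
move=> a0 ab; rewrite ler_ln ?posrE ?ltr0n ?ler_nat //.
exact: leq_trans ab.
Qed.

(** The final comparison of exponents.  With [be = gamma (1 - gamma)] and
    [ka = k k' / n^2] and [V] the product of all [j - i], the last hypothesis
    bounds [ln t] by the contribution of the blocks, and the error terms, all of
    order [n^2 ln n], are at most [be / 4 * ln D].  The slack comes
    from [ka (1 - be) >= 3/4 be], as [be <= ka <= 1/4]. *)
Lemma exponent_inequality (be ka lnD lnV nn ln2' lnn lt : R) :
  0 < be -> be <= ka -> ka <= 1 / 4 -> 0 <= nn -> 0 <= ln2' -> ln2' <= lnn ->
  2 <= nn ->
  2 * nn ^+ 2 * lnn <= be / 4 * lnD -> 0 <= lnV -> 2 * lnV <= nn ^+ 2 * lnn ->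
  lt - ka * be * lnD <= nn * lnn + (1 - ka) * (lnD + lnV) + ka * nn ^+ 2 * ln2' / 2 ->
  lt <= (1 - be / 2) * lnD.
Proof.
move=> b0 bk k4 n0 l0 l2 n2 HD V0 HV H.
have lnn0 : 0 <= lnn by lra.
have nl : nn * lnn <= nn ^+ 2 * lnn / 2.
  have : 0 <= nn * lnn * (nn - 2) by rewrite !mulr_ge0 // subr_ge0.
  by rewrite expr2; lra.
have q0 : 0 <= nn ^+ 2 * ln2' by rewrite mulr_ge0 // exprn_ge0.
have ql : nn ^+ 2 * ln2' <= nn ^+ 2 * lnn by rewrite ler_wpM2l // exprn_ge0.
have h1 : ka * nn ^+ 2 * ln2' / 2 <= nn ^+ 2 * lnn / 8.
  have : ka * (nn ^+ 2 * ln2') <= 1 / 4 * (nn ^+ 2 * ln2') by rewrite ler_wpM2r.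
  by lra.
have h2 : (1 - ka) * lnV <= lnV by have : 0 <= ka * lnV; [rewrite mulr_ge0 //; lra|lra].
have D0 : 0 <= lnD.
  have : 0 <= be / 4 * lnD by apply: le_trans HD; rewrite !mulr_ge0 ?exprn_ge0.
  by rewrite pmulr_rge0 // divr_gt0.
have h3 : be / 4 * lnD <= (ka - ka * be - be / 2) * lnD.
  apply: ler_wpM2r => //; nra.
have q1 : 0 <= nn ^+ 2 * lnn by rewrite mulr_ge0 // exprn_ge0.
have -> : (1 - be / 2) * lnD = (ka - ka * be - be / 2) * lnD + (1 - ka) * lnD + ka * be * lnD.
  by ring.
lra.
Qed.

(** If [P] is the product of all differences of exponents, the contribution of a
    permutation to [block_sum] is [P / X] with [X] the product of the differences
    across the blocks, and [gap_pow_le_cross] bounds [X] below by a power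
    [k k' / n^2] of [P].  Since [P] is the dimension [d] times a factor
    independent of the representation, this is a power of [d] up to constants of
    size [n^(O(n^2))], absorbed by the assumption on [d]. *)
Lemma separated_bound (k k' d : nat) (n := (k + k')%N) (L : 'I_(k + k') -> nat) (t g : R) :
  injective L -> (d * gap (fun i : 'I_(k + k') => i : nat))%N = gap L ->
  (2 <= n)%N -> 0 < g < 1 / 2 -> g * n%:R <= k%:R -> g * n%:R <= k'%:R ->
  2 `^ (16 / g * n%:R ^+ 2 * log2 n%:R) < d%:R ->
  t * (d%:R `^ (- (g * (1 - g) / n%:R ^+ 2))) ^+ (k * k') <= (block_sum L)%:R ->
  0 <= t -> t <= d%:R `^ (1 - 1 / 2 * (g * (1 - g))).
Proof.
move=> Li dV n2 /andP [g0 g12] gk gk' HD Ht t0.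
have [->|tN0] := eqVneq t 0; first exact: powR_ge0.
have tp : 0 < t by rewrite lt_neqAle eq_sym tN0.
have dR : 0 < d%:R :> R by apply: lt_trans HD; rewrite powR_gt0.
have dN : (0 < d)%N by rewrite -(ltr0n R).
have nR : 0 < n%:R :> R by rewrite ltr0n; lia.
have nR2 : 2 <= n%:R :> R by rewrite ler_nat.
set V := gap _ in dV.
have V0 : (0 < V)%N by apply: gap_gt0 => i j /val_inj.
pose lnD := ln (d%:R : R); pose lnV := ln (V%:R : R); pose P := gap L.
have P0 : (0 < P)%N by exact: gap_gt0.
have lnP : ln (P%:R : R) = lnD + lnV by rewrite /P -dV natrM lnM ?posrE ?ltr0n.
have ln2p : 0 < ln (2 : R) by rewrite ln_gt0 // ltr1n.
have HD' : 16 / g * n%:R ^+ 2 * ln n%:R < lnD.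
  have : ln (2 `^ (16 / g * n%:R ^+ 2 * log2 n%:R)) < lnD.
    by rewrite ltr_ln ?posrE ?powR_gt0.
  have -> : ln (2 `^ (16 / g * n%:R ^+ 2 * log2 n%:R)) = 16 / g * n%:R ^+ 2 * ln n%:R.
    by rewrite ln_powR /log2 [X in X * _]mulrA divfK // gt_eqF.
  by [].
pose ka : R := (k * k')%:R / n%:R ^+ 2; pose be : R := g * (1 - g).
have nE : n%:R = k%:R + k'%:R :> R by rewrite natrD.
have n20 : 0 < n%:R ^+ 2 :> R by rewrite exprn_gt0.
have be0 : 0 < be by rewrite mulr_gt0 // subr_gt0; lra.
have beka : be <= ka.
  rewrite /ka ler_pdivlMr // natrM /be.
  have : 0 <= (k%:R - g * n%:R) * (k'%:R - g * n%:R) by rewrite mulr_ge0 // subr_ge0.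
  by rewrite nE; nra.
have ka4 : ka <= 1 / 4.
  rewrite /ka ler_pdivrMr // natrM nE.
  have : 0 <= (k%:R - k'%:R : R) ^+ 2 by rewrite sqr_ge0.
  by nra.
have lnV0 : 0 <= lnV by rewrite ln_ge0 // ler1n.
have HV : 2 * lnV <= n%:R ^+ 2 * ln n%:R.
  have V2 : (0 < V ^ 2)%N by rewrite expn_gt0 V0.
  have := ln_nat_le V2 (gap_ord_sqr_le n); rewrite !ln_natX natrM.
  by rewrite -expr2.
pose lM : R := (1 - ka) * (lnD + lnV) + ka * n%:R ^+ 2 * ln 2 / 2.
have Y_le (s : 'S_(k + k')) :
    (gap (L \o s \o @lshift k k') * gap (L \o s \o @rshift k k'))%N%:R <= expR lM.
  have Lsi : injective (L \o s) by move=> a b /= /Li /perm_inj.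
  set Y := (_ * _)%N; pose X := (\prod_(i < k) \prod_(j < k')
     `|(L \o s) (rshift k j) - (L \o s) (lshift k' i)|)%N.
  have YX : (Y * X)%N = P by rewrite /P -(gap_perm L s) gap_split.
  have YX0 : (0 < Y * X)%N by rewrite YX.
  have [Y0 X0] : (0 < Y)%N /\ (0 < X)%N by apply/andP; rewrite -muln_gt0.
  have := gap_pow_le_cross Lsi; rewrite gap_perm -/P -/X -/n => HX.
  have PX0 : (0 < P ^ (2 * (k * k')))%N by rewrite expn_gt0 P0.
  have := ln_nat_le PX0 HX; rewrite natrM lnM ?posrE ?ltr0n ?expn_gt0 ?X0 //.
  rewrite !ln_natX lnP => HX'.
  rewrite -ler_ln ?posrE ?expR_gt0 ?ltr0n // expRK.
  have lnYX : ln (Y%:R : R) + ln (X%:R : R) = lnD + lnV.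
    by rewrite -lnP -YX natrM lnM ?posrE ?ltr0n.
  have kaE : (k * k')%:R = ka * n%:R ^+ 2 :> R by rewrite /ka divfK // gt_eqF.
  have HX2 : ka * (lnD + lnV) - ka * n%:R ^+ 2 * ln 2 / 2 <= ln (X%:R : R).
    have n2p : 0 < 2 * n%:R ^+ 2 :> R by rewrite mulr_gt0.
    rewrite -(ler_pM2l n2p); move: HX'.
    rewrite (natrM _ 2 (k * k')) (natrM _ (k * k') (n ^ 2)) (natrM _ 2 (n ^ 2)) natrX kaE.
    move: (n%:R ^+ 2) (ln 2%:R) (ln X%:R) (lnD + lnV) => N2 l2 lX lP; nra.
  by rewrite /lM; lra.
have HS : (block_sum L)%:R <= (n ^ n)%N%:R * expR lM.
  rewrite /block_sum natr_sum; apply: (@le_trans _ _ (\sum_(s : 'S_(k + k')) expR lM)).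
    by apply: ler_sum => s _; apply: Y_le.
  rewrite sumr_const -[leLHS]mulr_natl ler_wpM2r ?expR_ge0 // ler_nat.
  exact: card_perm_le.
have nn0 : (0 < n ^ n)%N by rewrite expn_gt0 (leq_trans _ n2).
have e0 : 0 < d%:R `^ (- (g * (1 - g) / n%:R ^+ 2)) :> R by rewrite powR_gt0.
have Hln : ln t + (k * k')%:R * (- (be / n%:R ^+ 2) * lnD) <= n%:R * ln n%:R + lM.
  have := le_trans Ht HS.
  rewrite -ler_ln ?posrE ?mulr_gt0 ?exprn_gt0 ?expR_gt0 ?ltr0n //.
  rewrite !lnM ?posrE ?exprn_gt0 ?expR_gt0 ?ltr0n // lnXn // ln_powR expRK ln_natX => H.
  by rewrite (mulr_natl _ (k * k')).
rewrite -ler_ln ?posrE ?powR_gt0 // ln_powR.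
have -> : 1 - 1 / 2 * (g * (1 - g)) = 1 - be / 2 by rewrite /be; ring.
have ln2n : ln 2 <= ln n%:R :> R by rewrite ler_ln ?posrE.
have q : 0 <= n%:R ^+ 2 * ln n%:R :> R.
  by rewrite mulr_ge0 ?exprn_ge0 ?(ltW nR) ?(le_trans (ltW ln2p)).
have hD : 2 * n%:R ^+ 2 * ln n%:R <= be / 4 * lnD.
  apply: le_trans (_ : be / 4 * (16 / g * n%:R ^+ 2 * ln n%:R) <= _); last first.
    by rewrite ler_wpM2l ?divr_ge0 ?(ltW be0) // ltW.
  have -> : be / 4 * (16 / g * n%:R ^+ 2 * ln n%:R) = 4 * (1 - g) * (n%:R ^+ 2 * ln n%:R).
    by rewrite /be; field; rewrite gt_eqF.
  by rewrite -mulrA; apply: (ler_wpM2r q); lra.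
apply: (exponent_inequality be0 beka ka4 (ltW nR) (ltW ln2p) ln2n nR2 hD lnV0 HV).
have -> : ka * be * lnD = - ((k * k')%:R * (- (be / n%:R ^+ 2) * lnD)).
  by rewrite /ka; move: (k * k')%N => x; field; rewrite gt_eqF.
by rewrite opprK -addrA; exact: Hln.
Qed.

End Numeric.

(** * The bound at separated elements *)

Lemma char_poly_conj (F : fieldType) n (P A : 'M[F]_n) : P \in unitmx ->
  char_poly (invmx P *m A *m P) = char_poly A.
Proof.
move=> Pu; rewrite /char_poly /char_poly_mx.
have -> : 'X%:M - map_mx (@polyC F) (invmx P *m A *m P) =
   map_mx (@polyC F) (invmx P) *m ('X%:M - map_mx (@polyC F) A) *m map_mx (@polyC F) P.
  rewrite !map_mxM mulmxBr mulmxBl; congr (_ - _).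
  by rewrite scalar_mxC -mulmxA -map_mxM mulVmx // map_mx1 mulmx1.
rewrite !det_mulmx mulrAC -det_mulmx -map_mxM mulVmx // map_mx1 det1 mul1r //.
Qed.

Lemma eigenvalue_list (R : realType) n (P : 'M[R[i]]_n) (w : 'I_n -> R[i]) (s : seq R[i]) :
  P \in unitmx -> char_poly (invmx P *m tor w *m P) = \prod_(z <- s) ('X - z%:P) ->
  exists2 p : 'S_n, size s = n & forall i : 'I_n, s`_i = w (p i).
Proof.
move=> Pu; rewrite char_poly_conj // char_poly_trig ?diag_mx_is_trig // => E.
have {}E : \prod_(z <- [tuple w i | i < n]) ('X - z%:P) = \prod_(z <- s) ('X - z%:P).
  rewrite -E big_map -big_enum /=.
  by apply: eq_bigr => i _; rewrite !mxE eqxx mulr1n.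
have /perm_size := prod_XsubC_eq E; rewrite size_tuple => Es.
have pe : perm_eq s [tuple w i | i < n] by rewrite perm_sym prod_XsubC_eq.
have /tuple_permP [p Ep] := pe; exists p => // i.
by rewrite Ep -tnth_nth !tnth_mktuple.
Qed.

(** All [k k'] factors of [cross] are at least [epsilon]. *)
Lemma separated_chi_bound (R : realType) k k' d (m : 'I_d -> 'I_(k + k') -> int)
    (l : 'I_(k + k') -> int) (z : 'I_(k + k') -> R[i]) (gamma : R) (n := (k + k')%N)
    (epsilon := d%:R `^ (- (gamma * (1 - gamma) / n%:R ^+ 2)) : R) :
  (forall i j : 'I_(k + k'), (i < j)%N -> l i < l j) ->
  (forall z : 'I_(k + k') -> R[i], (forall i, `|z i| = 1) ->
     vdm z * chi m z = \det (\matrix_(i, j) z j ^ l i)) ->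
  (forall i, `|z i| = 1) -> (2 <= n)%N -> 0 < gamma < 1 / 2 ->
  gamma * n%:R <= k%:R -> gamma * n%:R <= k'%:R ->
  2 `^ (16 / gamma * n%:R ^+ 2 * log2 n%:R) < d%:R ->
  (forall i j, epsilon%:C <= `|z (rshift k j) - z (lshift k' i)|) ->
  `|chi m z| <= (d%:R `^ (1 - 1 / 2 * (gamma * (1 - gamma))))%:C.
Proof.
move=> lS weyl z1 n2 gam gk gk' Hd sep.
have tE : `|chi m z| = (complex.Re `|chi m z|)%:C by rewrite RRe_real ?normr_real.
set t := complex.Re _ in tE; have t0 : 0 <= t by rewrite -lecR -tE normr_ge0.
rewrite tE lecR; apply: (separated_bound (lnat_inj lS) (dimension_formula lS weyl)) => //.
rewrite -/n -/epsilon -lecR (rmorph_nat (real_complex R)).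
have CB := chi_bound weyl z1; apply: le_trans CB.
rewrite rmorphM /= tE rmorphXn /= ler_wpM2l ?lecR //.
have e0 : 0 <= epsilon%:C :> R[i] by rewrite lecR powR_ge0.
rewrite /cross mulnC exprM -[k in X in X <= _]card_ord -prodr_const.
rewrite ler_prod // => i _; rewrite exprn_ge0 //= -[k' in X in X <= _]card_ord -prodr_const.
by rewrite ler_prod // => j _; rewrite e0 sep.
Qed.

Unset Implicit Arguments.
Local Open Scope classical_set_scope.
Local Open Scope ring_scope.
Local Open Scope complex_scope.

Theorem theorem3p6 (R : realType) (n : nat) (g : 'M[R[i]]_n)
    (rho : 'M[R[i]]_n -> R[i]) (gamma : R) :
  (2 <= n)%N ->
  Un R n g ->
  Irr_U R n rho ->
  0 < gamma < 1 / 2 ->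
  let D : R := complex.Re (rho 1%:M) in
  let epsilon : R := D `^ (- (gamma * (1 - gamma) / n%:R ^+ 2)) in
  2 `^ (16 / gamma * n%:R ^+ 2 * log2 n%:R) < D ->
  eig_separated gamma epsilon g ->
  `|rho g| <= (D `^ (1 - 1 / 2 * (gamma * (1 - gamma))))%:C.
Proof.
move=> n2 gU [d [rep [repC repI chiE]]] gam D epsilon HD [Q [S [Echar kQ kS sep]]].
have En : n = (size Q + size S)%N.
  by apply/eqP; rewrite -eqSS -(size_char_poly g) Echar size_prod_XsubC size_cat.
subst n; have [B Bu Bdiag] := torsion_basis (continuous_cont_rep repC).
pose r g := B *m rep g *m invmx B.
have rP : cont_rep r := cont_rep_conj Bu (continuous_cont_rep repC).
have rI : irreducible_rep r := irreducible_rep_conj Bu repI.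
have [m rT] := torus_weights rP Bdiag.
have [l lS weyl] := weyl_formula_torus rP rT rI.
have trE h : Un R _ h -> rho h = \tr (r h).
  by move=> hU; rewrite chiE // /r mxtrace_mulC mulmxA mulVmx // mul1mx.
have weyl' (z : 'I_(size Q + size S) -> R[i]) : (forall i, `|z i| = 1) -> vdm z * chi m z = \det (\matrix_(i, j) z j ^ l i).
  by move=> z1; have := weyl z z1; rewrite (trace_tor rT z1).
have DE : D = d%:R.
  have E1 : rho 1%:M = d%:R.
    rewrite trE; last exact: (unitary1 R _).
    by rewrite (cont_rep1 rP) mxtrace1.
  by rewrite /D E1 -(rmorph_nat (real_complex R)).
have [P [w [PU w1 Eg]]] := unitary_spectral gU.
have [|p Es Ep] := @eigenvalue_list R _ P w (Q ++ S) (unitarymx_unit PU).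
  by rewrite -Eg Echar.
pose z i := w (p i); have z1 i : `|z i| = 1 by exact: w1.
have chiz : rho g = chi m z.
  have PVU := invmx_unitarymx PU; have tU := tor_unitary w1.
  rewrite trE // Eg -{2}[P]invmxK (trace_conj rP PVU tU) (trace_tor rT w1).
  by rewrite -(trace_symmetric rP rT p w1).
have zQ i : z (lshift _ i) \in Q by rewrite /z -Ep /= nth_cat ltn_ord mem_nth.
have zS j : z (rshift _ j) \in S.
  by rewrite /z -Ep /= nth_cat ltnNge leq_addr /= addKn mem_nth.
rewrite chiz DE; rewrite DE in HD; apply: (separated_chi_bound lS weyl' z1) => //.
by move=> i j; rewrite distrC -DE; apply: sep.
Qed.
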